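(* Let $F$ be a finite extension of $\mathbf Q_p$. Suppose that $p$ is odd and that $\psi$ is normalized. Let $\chi$ be an unramified character of $F^\times$. Then $$\prod_{a\in F^\times/F^{\times2}}\tilde\gamma(1-s,\chi^{-1}\eta_{a,(2)},\psi)=(\varpi,-1)_2\cdot\gamma(1-2s,\chi^{-2},\psi)^2\cdot\frac{L(2s,\chi^2)\,L(-2s,\chi^{-2})}{L(1-2s,\chi^{-2})\,L(1+2s,\chi^2)}.$$
   Context: $O_F$ is the ring of integers of $F$, $\mathfrak p$ its maximal ideal, $\varpi$ a uniformizer, $q=|O_F/\mathfrak p|$, $|\varpi|=q^{-1}$. $\psi$ is a nontrivial additive character of $F$; normalized means trivial on $O_F$ but not on $\mathfrak p^{-1}$. $(-,-)_2$ is the quadratic Hilbert symbol, $\eta_{a,(2)}(x)=(a,x)_2$. $\psi_a(x)=\psi(ax)$; $d_\psi x$ is the $\psi$-self-dual Haar measure on $F$ and $d_\psi^\times x=d_\psi x/|x|$. The Weil index is $\omega(\psi)=\lim_{r\to\infty}\int_{\mathfrak p^{-r}}\psi(x^2)\,d_{\psi_2}x$ and $\omega_\psi(a)=\omega(\psi_a)/\omega(\psi)$. For a character $\xi$ of $F^\times$, $\gamma(s,\xi,\psi)$ is Tate's gamma factor: $\gamma(1-s,\xi^{-1},\psi)$ is the meromorphic continuation of $\lim_{r\to\infty}\int_{\mathfrak p^{-r}}\xi(x)|x|^s\psi(x)\,d_\psi^\times x$; the metaplectic gamma factor $\tilde\gamma(1-s,\xi^{-1},\psi)$ is the meromorphic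 continuation of $\lim_{r\to\infty}\int_{\mathfrak p^{-r}}\xi(x)|x|^s\,\omega_\psi(x)^{-1}\psi(x)\,d_\psi^\times x$. For unramified $\xi$, $L(s,\xi)=(1-q^{-s}\xi(\varpi))^{-1}$. The identity is one of meromorphic functions of $s$. *)

(* Defs.v *)
From HB Require Import structures.
From mathcomp Require Import all_boot all_order all_algebra all_field.
From mathcomp Require Import all_classical all_reals all_analysis.
From mathcomp Require Import complex.

Set Implicit Arguments.
Unset Strict Implicit.
Unset Printing Implicit Defensive.

Import Order.TTheory GRing.Theory Num.Theory numFieldNormedType.Exports.

Local Open Scope classical_set_scope.
Local Open Scope ring_scope.
Local Open Scope complex_scope.
Local Open Scope card_scope.

(* The topology of the modulus; the library provides it for an abstract
   numClosedFieldType only. *)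
HB.instance Definition _ (R : realType) :=
  NormedModule.copy R[i] ((R[i] : numClosedFieldType)^o).

Section Meromorphic.
Variable R : realType.
Implicit Types (f g : R[i] -> R[i]) (s z : R[i]).

(* a ^ s for a > 0 *)
Definition cpow (a : R) s : R[i] :=
  (expR (complex.Re s * ln a))%:C *
  (cos (complex.Im s * ln a) +i* sin (complex.Im s * ln a)).

(* A meromorphic function is represented by a total function whose values on
   a closed discrete set (containing the poles) are irrelevant: around each
   point z0 it has a Laurent expansion with finite principal part. *)
Definition meromorphic f :=
  forall z0 : R[i], exists (n : nat) (a : nat -> R[i]),
    \forall z \near z0^',
      series (fun k => a k * (z - z0) ^+ k) @ \oo --> (z - z0) ^+ n * f z.

Definition mero_eq f g := forall z0 : R[i], \forall z \near z0^', f z = g z.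

End Meromorphic.

Section AbsoluteValues.
Variable R : realType.

Record nonarch_abs (K : fieldType) (v : K -> R) : Prop := NonarchAbs {
  nonarch_abs_ge0 : forall x, 0 <= v x;
  nonarch_abs_eq0 : forall x, (v x == 0) = (x == 0);
  nonarch_absM : forall x y, v (x * y) = v x * v y;
  nonarch_absD : forall x y, v (x + y) <= Num.max (v x) (v y)
}.

Definition padic_abs (p : nat) (x : rat) : R :=
  if x == 0 then 0
  else p%:R ^+ logn p `|denq x|%N / p%:R ^+ logn p `|numq x|%N.

(* (Qp, v) is a completion of (rat, padic_abs p). *)
Record is_Qp (p : nat) (Qp : fieldType) (v : Qp -> R) : Prop := IsQp {
  is_Qp_abs : nonarch_abs v;
  is_Qp_rat : forall x : rat, v (ratr x) = padic_abs p x;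
  is_Qp_dense : forall (x : Qp) (e : R), 0 < e ->
    exists r : rat, v (x - ratr r) < e;
  is_Qp_complete : forall u : nat -> Qp,
    (forall e : R, 0 < e -> exists N : nat, forall m n : nat,
       (N <= m)%N -> (N <= n)%N -> v (u m - u n) < e) ->
    exists l : Qp, forall e : R, 0 < e -> exists N : nat, forall n : nat,
      (N <= n)%N -> v (u n - l) < e
}.

Definition integers (K : fieldType) (v : K -> R) : set K := [set x | v x <= 1].

(* nrm is the normalized absolute value of the finite extension F of Qp,
   varpi a uniformizer and q the cardinality of the residue field. *)
Record normalized_abs (Qp : fieldType) (v : Qp -> R) (F : fieldExtType Qp)
    (nrm : F -> R) (varpi : F) (q : nat) : Prop := NormalizedAbs {
  normalized_abs_abs : nonarch_abs nrm;
  normalized_abs_above : forall x : Qp, (nrm x%:A <= 1) = (v x <= 1);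
  normalized_abs_uniformizer :
    [set x | nrm x < 1] = [set varpi * y | y in integers nrm];
  normalized_abs_residue :
    [set [set y | nrm (y - x) < 1] | x in integers nrm] #= (`I_q);
  normalized_abs_varpi : nrm varpi = q%:R^-1
}.

End AbsoluteValues.

(* The field K with the topology of an absolute value nrm; the topology axioms
   hold for every function nrm. *)
Definition valued (R : realType) (K : fieldType) (nrm : K -> R) : Type := K.

Section ValuedTopology.
Variables (R : realType) (K : fieldType) (nrm : K -> R).

HB.instance Definition _ := GRing.Field.on (valued nrm).
HB.instance Definition _ := isPointed.Build (valued nrm) 0.

Definition valued_open : set_system (valued nrm) :=
  [set U | forall x, U x ->
     exists2 e : R, 0 < e & forall y, nrm (y - x) < e -> U y].

Lemma valued_openT : valued_open setT.
Proof. by move=> x _; exists 1. Qed.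

Lemma valued_openI : setI_closed valued_open.
Proof.
move=> A B oA oB x [/oA[e e0 eA] /oB[d d0 dB]].
exists (Num.min e d); first by rewrite lt_min e0.
by move=> y; rewrite lt_min => /andP[/eA ? /dB ?].
Qed.

Lemma valued_open_bigU (I : Type) (f : I -> set (valued nrm)) :
  (forall i, valued_open (f i)) -> valued_open (\bigcup_i f i).
Proof.
move=> of_ x [i _ /of_[e e0 ef]].
by exists e => // y /ef fy; exists i.
Qed.

HB.instance Definition _ := isOpenTopological.Build (valued nrm)
  valued_openT valued_openI valued_open_bigU.

Definition borel := g_sigma_algebraType (@open (valued nrm)).

End ValuedTopology.

Section Characters.
Variables (R : realType) (K : fieldType) (nrm : K -> R).
Implicit Types (psi chi xi : K -> R[i]).

Definition additive_character psi :=
  [/\ forall x y, psi (x + y) = psi x * psi y,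
      forall x, `|psi x| = 1
    & continuous (psi : valued nrm -> R[i])].

(* the powers of the maximal ideal (varpi) of the ring of integers *)
Definition ideal_pow (varpi : K) (n : int) : set K :=
  [set x | nrm x <= nrm varpi ^ n].

Definition normalized_character (varpi : K) psi :=
  (forall x, integers nrm x -> psi x = 1) /\
  (exists2 x, ideal_pow varpi (-1) x & psi x != 1).

(* psi_a *)
Definition twist psi (a : K) : K -> R[i] := fun x => psi (a * x).

(* A character of K^*, not necessarily unitary; its value at 0 is
   irrelevant. *)
Definition mult_character chi :=
  [/\ forall x y, x != 0 -> y != 0 -> chi (x * y) = chi x * chi y,
      forall x, x != 0 -> chi x != 0
    & forall x : valued nrm, x != 0 ->
        {for x, continuous (chi : valued nrm -> R[i])}].

Definition unramified chi := forall x, nrm x = 1 -> chi x = 1.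

Definition hilbert (a b : K) : R[i] :=
  if `[< exists x y z : K, [|| x != 0, y != 0 | z != 0] /\
           z ^+ 2 = a * x ^+ 2 + b * y ^+ 2 >] then 1 else -1.

(* K^* / K^*2 as a set of cosets *)
Definition square_classes : set (set K) :=
  [set [set a * b ^+ 2 | b in [set b | b != 0]] | a in [set a | a != 0]].

(* L(s, xi) for xi unramified *)
Definition Lfactor (varpi : K) (q : nat) (s : R[i]) xi : R[i] :=
  (1 - cpow q%:R (- s) * xi varpi)^-1.

End Characters.

Arguments hilbert R {K} a b.
Arguments square_classes K : clear implicits.

Section HaarMeasure.
Variables (R : realType) (K : fieldType) (nrm : K -> R).
Implicit Types (mu : {measure set (borel nrm) -> \bar R}) (D : set K).
Implicit Types (f psi : K -> R[i]).

Definition is_haar mu :=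
  [/\ forall (x : K) (A : set (borel nrm)), measurable A ->
        mu [set x + y | y in (A : set K)] = mu A,
      forall A : set (valued nrm), compact A -> (mu A < +oo)%E
    & forall U : set (valued nrm), open U -> U !=set0 -> (0 < mu U)%E].

Definition cintegrable mu D f :=
  mu.-integrable (D : set (borel nrm)) (fun x : borel nrm => (complex.Re (f x))%:E) /\
  mu.-integrable (D : set (borel nrm)) (fun x : borel nrm => (complex.Im (f x))%:E).

Definition cintegral mu D f : R[i] :=
  (\int[mu]_(x in (D : set (borel nrm))) complex.Re (f x))%R +i*
  (\int[mu]_(x in (D : set (borel nrm))) complex.Im (f x))%R.

Definition schwartz_bruhat f :=
  (forall x : valued nrm, \forall y \near x, f y = f x) /\
  (exists2 A : set (valued nrm), compact A & forall x, ~ A x -> f x = 0).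

Definition fourier mu psi f : K -> R[i] :=
  fun y => cintegral mu setT (fun x => f x * psi (x * y)).

Definition self_dual_haar psi mu :=
  is_haar mu /\
  forall f, schwartz_bruhat f ->
    forall x, fourier mu psi (fourier mu psi f) x = f (- x).

End HaarMeasure.

(* In this section dx psi stands for the psi-self-dual Haar measure. *)
Section GammaFactors.
Variables (R : realType) (K : fieldType) (nrm : K -> R) (varpi : K).
Variable dx : (K -> R[i]) -> {measure set (borel nrm) -> \bar R}.
Implicit Types (psi xi phi : K -> R[i]) (s : R[i]) (r : nat).

Definition weil_index psi : R[i] :=
  lim ((fun r => cintegral (dx (twist psi 2)) (ideal_pow nrm varpi (- r%:Z))
                   (fun x => psi (x ^+ 2))) @ \oo).

(* omega_psi(a) *)
Definition weil_ratio psi (a : K) : R[i] :=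
  weil_index (twist psi a) / weil_index psi.

(* The integral of phi(x) |x|^s dx/|x| over the nonzero x in p^{-r} *)
Definition zeta_domain r : set K :=
  ideal_pow nrm varpi (- r%:Z) `\ 0.

Definition zeta_integrand phi s : K -> R[i] :=
  fun x => phi x * cpow (nrm x) s / (nrm x)%:C.

Definition is_zeta_continuation (mu : {measure set (borel nrm) -> \bar R}) phi
    (G : R[i] -> R[i]) :=
  meromorphic G /\
  exists sigma : R, forall s, sigma < complex.Re s ->
    (forall r, cintegrable mu (zeta_domain r) (zeta_integrand phi s)) /\
    (fun r => cintegral mu (zeta_domain r) (zeta_integrand phi s)) @ \oo --> G s.

(* well defined up to mero_eq *)
Definition zeta_continuation (mu : {measure set (borel nrm) -> \bar R}) phi :
    R[i] -> R[i] :=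
  xget (fun=> 0) [set G | is_zeta_continuation mu phi G].

(* gamma(z, xi, psi), where z = 1 - s *)
Definition tate_gamma (z : R[i]) xi psi : R[i] :=
  zeta_continuation (dx psi) (fun x => (xi x)^-1 * psi x) (1 - z).

Definition metaplectic_gamma (z : R[i]) xi psi : R[i] :=
  zeta_continuation (dx psi)
    (fun x => (xi x)^-1 * (weil_ratio psi x)^-1 * psi x) (1 - z).

End GammaFactors.

(* Main.v *)
Require Import Defs.
From mathcomp Require Import all_boot all_order all_algebra all_field.
From mathcomp Require Import all_classical all_reals all_analysis.
From mathcomp Require Import complex.
From mathcomp Require Import measurable_realfun ring lra zify.

Set Implicit Arguments.
Unset Strict Implicit.
Unset Printing Implicit Defensive.

Import Order.TTheory GRing.Theory Num.Theory numFieldNormedType.Exports.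
Import Normc.

Local Open Scope classical_set_scope.
Local Open Scope ring_scope.
Local Open Scope complex_scope.

(** Put [X = chi varpi * q ^ (- s)]. As [p] is odd, the square classes are
    those of [1], [e], [varpi] and [varpi * e], for a unit [e] which is not a
    square modulo [varpi]. The point is that all the functions under the
    integrals are tame: if [qres u] denotes the quadratic residue symbol of a
    unit [u], then on the shell of the elements [varpi ^ n * u] the Hilbert
    symbol with a fixed entry and the Weil ratio are a constant times [1] or
    [qres u], and both the constant and the choice depend on the parity of [n]
    only. For the Weil ratio they are [1] for even [n] and [g * qres u] for odd
    [n], where [g] is the quadratic Gauss sum of the residue field divided by
    the square root of [q] ([weil_ratio_even], [weil_ratio_odd]); moreover
    [g ^+ 2 = qres (-1)] ([weil_root_sq]), which is the Hilbert symbol of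
    [varpi] and [-1].

    The integral over a shell is a finite sum over cosets, since the integrand
    is locally constant ([cintegral_coset_sum]). It vanishes for [n <= -2],
    where [psi] oscillates and nothing else does; up to constants, for [n = -1]
    it is a Gauss sum or the sum [-1] of a nontrivial additive character of the
    residue field over its nonzero elements; for [n >= 0], where [psi] is
    trivial, it is [0] or the measure of the shell ([shell_integral]). Hence a
    zeta integral is a principal term in [X ^ (-1)] plus two geometric series,
    one for each parity: it is a rational function of [X] on a half-plane, and
    the identity theorem makes this function its meromorphic continuation
    ([zeta_continuationE]).

    With [Y = X ^+ 2], [B = (1 - q^-1) / (1 - Y)] and [S = q ^ (-1/2)] the
    values are [B + S / X] and [B - S / X] for the classes of [1] and [e]
    ([metaplectic_unit]), and [g * X * T] and [- g * X * T] for the classes of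
    [varpi] and [varpi * e] ([metaplectic_varpi]), where
    [T = B - q^-1 / Y = (1 - q^-1 / Y) / (1 - Y)] is the Tate factor
    ([tate_unramified]). The product formula follows from the identities [B ^+
    2 - S ^+ 2 / Y = (1 - q^-1 / Y) * (1 - q^-1 * Y) / (1 - Y) ^+ 2] and
    [(1 - Y) * (1 - Y^-1) = - (1 - Y) ^+ 2 / Y] ([product_identity]).

    The constants rest on three facts about the field: it is complete
    ([padic_extension_complete]), so that units close to a square are squares
    ([sqrt_one_plus]) and balls are compact ([ideal_compact]); the residue
    symbol is multiplicative and sums to zero ([qresM], [coset_sum_qres]), both
    consequences of counting square roots in the residue field; and Fourier
    inversion gives the self-dual measure of the ring of integers
    ([self_dual_vol]). *)

(** * Modulus and limits of complex numbers *)

Section ComplexTopology.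
Variable R : realType.
Implicit Types (z w : R[i]) (u v : nat -> R[i]).

Lemma normc_normE z : `|z| = (normc z)%:C.
Proof. by []. Qed.

Lemma normc_ge0 z : 0 <= normc z.
Proof. by rewrite -ler0c -normc_normE. Qed.

Lemma normcD_le z w : normc (z + w) <= normc z + normc w.
Proof. exact: le_normcD. Qed.

Lemma normcN_eq z : normc (- z) = normc z.
Proof. exact: normcN. Qed.

Lemma normcB z w : normc (z - w) = normc (w - z).
Proof. by rewrite -normcN_eq opprB. Qed.

Lemma normc_eq0 z : (normc z == 0) = (z == 0).
Proof. by apply/eqP/eqP => [/eq0_normc //|->]; exact: normc0. Qed.

Lemma normc_gt0 z : (0 < normc z) = (z != 0).
Proof. by rewrite lt_def normc_eq0 normc_ge0 andbT. Qed.

Lemma normcX z n : normc (z ^+ n) = normc z ^+ n.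
Proof.
elim: n => [|n IHn]; first by rewrite !expr0 normc1.
by rewrite !exprS normcM IHn.
Qed.

Lemma normc_real (a : R) : normc a%:C = `|a|.
Proof. by rewrite /= expr0n addr0 sqrtr_sqr. Qed.

Lemma normc_sum (I : Type) (r : seq I) (P : pred I) (F : I -> R[i]) :
  normc (\sum_(i <- r | P i) F i) <= \sum_(i <- r | P i) normc (F i).
Proof.
elim/big_ind2: _ => [|x1 x2 y1 y2 h1 h2|//]; first by rewrite normc0.
by apply: le_trans (lerD h1 h2); exact: normcD_le.
Qed.

Lemma Re_le_normc z : `|complex.Re z| <= normc z.
Proof. by rewrite -lecR -normc_normE; exact: normc_ge_Re. Qed.

Lemma Im_le_normc z : `|complex.Im z| <= normc z.
Proof.
case: z => a b /=; rewrite -sqrtr_sqr ler_wsqrtr // lerDr; exact: sqr_ge0.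
Qed.

Lemma normc_le_ReIm z : normc z <= `|complex.Re z| + `|complex.Im z|.
Proof.
have {1}-> : z = (complex.Re z)%:C + (complex.Im z)%:C * (0 +i* 1).
  by case: z => a b; simpc.
apply: le_trans (normcD_le _ _) _; rewrite normcM !normc_real.
rewrite [normc (_ +i* _)]/= expr0n expr1n add0r sqrtr1 mulr1.
by [].
Qed.

(** The topology of [R[i]] is defined with the norm valued in [R[i]]; this
    and [cvgCP] trade it for the real modulus, in which all estimates are
    made. *)
Lemma nearCP (z0 : R[i]) (P : R[i] -> Prop) :
  (\forall z \near z0, P z) <->
  exists2 e : R, 0 < e & forall z, normc (z - z0) < e -> P z.
Proof.
split.
  move/nbhs_ballP => [e e0 eP]; exists (complex.Re e).
    by move: e0; rewrite /= ltcE /= => /andP[].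
  move=> z ze; apply: eP; rewrite /ball /= -opprB normrN.
  have eR : e = (complex.Re e)%:C.
    by move: e0; rewrite /= ltcE /= => /andP[/eqP e0 _]; case: (e) e0 => a b /= ->.
  by rewrite eR normc_normE ltcR.
move=> [e e0 eP]; apply/nbhs_ballP; exists e%:C => /=; first by rewrite ltcR.
move=> z; rewrite /ball /= -opprB normrN normc_normE ltcR; exact: eP.
Qed.

Lemma dnearCP (z0 : R[i]) (P : R[i] -> Prop) :
  (\forall z \near z0^', P z) <->
  exists2 e : R, 0 < e & forall z, normc (z - z0) < e -> z != z0 -> P z.
Proof. exact: nearCP. Qed.

Lemma cvgCP (T : Type) (G : set_system T) {FG : Filter G} (u : T -> R[i]) l :
  u @ G --> l <-> (fun n => normc (u n - l)) @ G --> (0 : R).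
Proof.
split.
  move=> ul; apply/cvgr0Pnorm_lt => e e0.
  have : \forall z \near l, normc (z - l) < e by apply/nearCP; exists e.
  move=> /ul; apply: (@filterS T G) => x /=.
  by rewrite [`|normc _|]ger0_norm ?normc_ge0.
move=> /cvgr0Pnorm_lt h P /nearCP [e e0 eP].
have := h e e0; apply: (@filterS T G) => x /=.
rewrite [`|normc _|]ger0_norm ?normc_ge0 //; exact: eP.
Qed.

Lemma cvgC_squeeze (T : Type) (G : set_system T) {FG : Filter G} (u : T -> R[i]) l
    (b : T -> R) :
  (\forall n \near G, normc (u n - l) <= b n) -> b @ G --> (0 : R) -> u @ G --> l.
Proof.
move=> ub b0; apply/cvgCP; apply: (squeeze_cvgr _ (cvg_cst 0) b0).
by apply: filterS ub => x xb; rewrite normc_ge0.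
Qed.

(** Complex integrals are defined by their real and imaginary parts, and so
    is the exponential; this carries limits through these definitions. *)
Lemma cvgC_ReIm (T : Type) (G : set_system T) {FG : Filter G} (u : T -> R[i]) l :
  u @ G --> l <->
  (fun n => complex.Re (u n)) @ G --> complex.Re l /\
  (fun n => complex.Im (u n)) @ G --> complex.Im l.
Proof.
split=> [/cvgCP ul|[/subr_cvg0 h1 /subr_cvg0 h2]].
  split; apply/subr_cvg0; apply/norm_cvg0P.
    apply: (squeeze_cvgr _ (cvg_cst 0) ul); apply: nearW => n.
    by rewrite normr_ge0 /= -raddfB; exact: Re_le_normc.
  apply: (squeeze_cvgr _ (cvg_cst 0) ul); apply: nearW => n.
  by rewrite normr_ge0 /= -raddfB; exact: Im_le_normc.
apply: (@cvgC_squeeze T G FG u l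
  (fun n => `|complex.Re (u n) - complex.Re l| + `|complex.Im (u n) - complex.Im l|)).
  by apply: nearW => n; rewrite -!raddfB; exact: normc_le_ReIm.
by rewrite -[X in _ --> X](addr0 (0 : R)); apply: cvgD; apply/norm_cvg0P.
Qed.

Lemma cvgC_unique (T : Type) (G : set_system T) {FG : ProperFilter G}
    (u : T -> R[i]) (l m : R[i]) : u @ G --> l -> u @ G --> m -> l = m.
Proof. by move=> ul um; apply: (cvg_unique (@norm_hausdorff _ R[i]) ul um). Qed.

Section ComplexLimits.
Context {T : Type} {G : set_system T} {FG : Filter G}.
Implicit Types (l m c : R[i]).

Lemma cvgC_cst c : (fun=> c) @ G --> c.
Proof. exact: cvg_cst. Qed.

Lemma cvgCD (u v : T -> R[i]) l m : u @ G --> l -> v @ G --> m ->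
  (fun n => u n + v n) @ G --> l + m.
Proof. exact: (@cvgD R[i] R[i]). Qed.

Lemma cvgCB (u v : T -> R[i]) l m : u @ G --> l -> v @ G --> m ->
  (fun n => u n - v n) @ G --> l - m.
Proof. exact: (@cvgB R[i] R[i]). Qed.

Lemma cvgCM (u v : T -> R[i]) l m : u @ G --> l -> v @ G --> m ->
  (fun n => u n * v n) @ G --> l * m.
Proof. exact: (@cvgM R[i]). Qed.

Lemma cvgCV (u : T -> R[i]) l : l != 0 -> u @ G --> l -> (fun n => (u n)^-1) @ G --> l^-1.
Proof. by move=> l0; exact: (@cvgV R[i]). Qed.

End ComplexLimits.

End ComplexTopology.

(** * Complex power series *)

Section PowerSeries.
Variable R : realType.
Implicit Types (z w l : R[i]) (a b : nat -> R[i]) (A B K M t : R).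

Lemma eq_ler A B : A = B -> A <= B.
Proof. by move=> ->. Qed.

Definition psum a w : nat -> R[i] := series (fun k => a k * w ^+ k).

(** Geometric growth of the coefficients is what a positive radius of
    convergence amounts to, and it is stable under products and inverses. *)
Definition geo_bound a B M := forall k, normc (a k) <= B * M ^+ k.

Lemma psumE a w n : psum a w n = \sum_(k < n) a k * w ^+ k.
Proof. by rewrite /psum /series /= big_mkord. Qed.

Lemma geo_bound_ge0 a B M : geo_bound a B M -> 0 <= B.
Proof. by move=> /(_ 0%N); rewrite expr0 mulr1; apply: le_trans; exact: normc_ge0. Qed.

Lemma geo_boundW a B M K : 0 <= M <= K -> geo_bound a B M -> geo_bound a B K.
Proof.
move=> /andP[M0 MK] aB k; apply: le_trans (aB k) _.
by rewrite ler_wpM2l ?(geo_bound_ge0 aB)// lerXn2r// nnegrE (le_trans M0).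
Qed.

Lemma cvg_normc_le (u : nat -> R[i]) l B :
  u @ \oo --> l -> (\forall n \near \oo, normc (u n) <= B) -> normc l <= B.
Proof.
move=> /cvgCP/cvgr0Pnorm_lt ul uB; apply/ler_addgt0Pr => e e0.
have [n [/= h1 h2]] := filter_ex (filterI uB (ul e e0)).
rewrite -[l](subrK (u n)) addrC; apply: le_trans (normcD_le _ _) _.
apply: lerD => //; rewrite normcB; apply: ltW.
by rewrite ger0_norm ?normc_ge0 in h2.
Qed.

(** The terms of a convergent series tend to zero, hence are bounded. *)
Lemma psum_geo_bound a w l : w != 0 -> psum a w @ \oo --> l ->
  exists B, exists2 M, 0 < M & geo_bound a B M.
Proof.
move=> w0 cvl.
have cl : cvgn (psum a w) by apply/cvg_ex; exists l.
have := cvg_series_cvg_0 cl => /cvgCP t0.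
have [B [_ Bb]] := cvg_seq_bounded (cvgP _ t0).
have B1 : B < B + 1 by rewrite ltrDl.
have {}Bb := Bb _ B1.
exists (B + 1); exists (normc w)^-1; first by rewrite invr_gt0 normc_gt0.
move=> k; have := Bb k I; rewrite /= subr0 ger0_norm ?normc_ge0//.
rewrite normcM normcX exprVn -ler_pdivlMr ?exprn_gt0 ?normc_gt0//.
Qed.

Lemma geo_sum_le2 t n : 0 <= t <= 2^-1 -> \sum_(k < n) t ^+ k <= 2.
Proof.
move=> /andP[t0 t2]; elim: n => [|n IHn]; first by rewrite big_ord0.
rewrite big_ord_recl expr0.
under eq_bigr do rewrite exprS.
rewrite -mulr_sumr; apply: (@le_trans _ _ (1 + 2^-1 * 2)).
  by rewrite lerD2l ler_pM // sumr_ge0// => i _; rewrite exprn_ge0.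
by rewrite mulVf ?pnatr_eq0// -natr1.
Qed.

(** Near the centre a power series is equivalent to its first nonzero term:
    the remainder is dominated by a geometric series of ratio at most one
    half. *)
Lemma psum_lead a m B M w l : 0 < M -> geo_bound a B M ->
  (forall k, (k < m)%N -> a k = 0) -> M * normc w <= 2^-1 ->
  psum a w @ \oo --> l ->
  normc (l - a m * w ^+ m) <= B * 2 * (M * normc w) ^+ m.+1.
Proof.
move=> M0 aB am wM cvl.
have t0 : 0 <= M * normc w by rewrite mulr_ge0 ?normc_ge0 ?ltW.
apply: (@cvg_normc_le (fun n => psum a w n - a m * w ^+ m)).
  by apply: (cvgCB cvl); exact: cvgC_cst.
exists m.+1 => // n /= mn.
rewrite psumE -(subnKC mn) big_split_ord /= big_ord_recr /= big1 ?add0r; last first.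
  by move=> i _; rewrite am ?mul0r.
rewrite addrAC subrr add0r; apply: le_trans (normc_sum _ _ _) _.
apply: (@le_trans _ _ (\sum_(k < n - m.+1) B * (M * normc w) ^+ m.+1 * (M * normc w) ^+ k)).
  apply: ler_sum => k _; rewrite normcM normcX -mulrA -exprD exprMn mulrA.
  by rewrite ler_wpM2r ?aB// exprn_ge0 ?normc_ge0.
rewrite -mulr_sumr -[B * 2 * _]mulrAC ler_wpM2l//.
  by rewrite mulr_ge0 ?exprn_ge0// (geo_bound_ge0 aB).
by apply: geo_sum_le2; rewrite t0.
Qed.

(** The isolation of zeros: a nonzero coefficient of least index makes the
    leading term dominate in a punctured neighbourhood of the centre. *)
Lemma psum_dichotomy a (h : R[i] -> R[i]) e : 0 < e ->
  (forall w, normc w < e -> w != 0 -> psum a w @ \oo --> h w) ->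
  (forall k, a k = 0) \/
  exists m, [/\ a m != 0, forall k, (k < m)%N -> a k = 0 &
    exists2 d, 0 < d & forall w, normc w < d -> w != 0 -> h w != 0].
Proof.
move=> e0 ha.
have [allz|/existsNP [k0 /eqP ak0]] := pselect (forall k, a k = 0); first by left.
right.
have exm : exists m, a m != 0 by exists k0.
pose m := ex_minn exm.
have am : a m != 0 by rewrite /m; case: ex_minnP.
have ltm k : (k < m)%N -> a k = 0.
  rewrite /m; case: ex_minnP => m' _ min km; apply/eqP/negPn/negP => /min.
  by rewrite leqNgt km.
exists m; split=> //.
have [B [M M0 aB]] : exists B, exists2 M, 0 < M & geo_bound a B M.
  apply: (@psum_geo_bound _ (e / 2)%:C (h (e / 2)%:C)).
    by rewrite -normc_gt0 normc_real normr_gt0 gt_eqF// divr_gt0.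
  apply: ha; last by rewrite -normc_gt0 normc_real normr_gt0 gt_eqF// divr_gt0.
  by rewrite normc_real gtr0_norm ?divr_gt0// ltr_pdivrMr// ltr_pMr// ltr1n.
have B0 := geo_bound_ge0 aB.
have na : 0 < normc (a m) by rewrite normc_gt0.
pose D := B * 2 * M ^+ m.+1 + 1.
have D0 : 0 < D by rewrite ltr_wpDl// mulr_ge0 ?mulr_ge0// exprn_ge0 ?ltW.
exists (Num.min e (Num.min ((2 * M)^-1) (normc (a m) / D))).
  by rewrite !lt_min e0 invr_gt0 mulr_gt0//= divr_gt0.
move=> w; rewrite !lt_min => /and3P[we wM wD] w0.
have nw : 0 < normc w by rewrite normc_gt0.
have wM2 : M * normc w <= 2^-1.
  move: wM; rewrite invfM -ltr_pdivrMr ?invr_gt0// invrK mulrC => /ltW //.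
have := psum_lead M0 aB ltm wM2 (ha _ we w0).
apply: contraPN => /eqP ->; apply/negP; rewrite -ltNge add0r normcN_eq normcM normcX.
rewrite exprMn [normc w ^+ m.+1]exprS !mulrA ltr_pM2r ?exprn_gt0//.
apply: le_lt_trans (_ : D * normc w < _).
  by rewrite ler_wpM2r ?normc_ge0// lerDl.
by rewrite mulrC -ltr_pdivlMr.
Qed.

Lemma psum_shift a w l n : psum a w @ \oo --> l ->
  psum (fun k => if (k < n)%N then 0 else a (k - n)%N) w @ \oo --> w ^+ n * l.
Proof.
move=> cvl; rewrite -(cvg_shiftn n).
have -> : (fun k => psum (fun k => if (k < n)%N then 0 else a (k - n)%N) w (k + n)%N)
   = (fun k => w ^+ n * psum a w k).
  apply/funext => k; rewrite !psumE addnC big_split_ord /= big1 ?add0r; last first.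
    by move=> i _; rewrite ltn_ord /= mul0r.
  rewrite mulr_sumr; apply: eq_bigr => i _.
  by rewrite ltnNge leq_addr /= addKn exprD mulrCA.
by apply: (cvgCM _ cvl); exact: cvgC_cst.
Qed.

Lemma psum_drop a w l m : w != 0 -> (forall k, (k < m)%N -> a k = 0) ->
  psum a w @ \oo --> l -> psum (fun k => a (m + k)%N) w @ \oo --> l / w ^+ m.
Proof.
move=> w0 am; rewrite -(cvg_shiftn m) => cvl.
have -> : psum (fun k => a (m + k)%N) w = (fun k => psum a w (k + m)%N / w ^+ m).
  apply/funext => k; rewrite !psumE addnC big_split_ord /= [X in _ = (X + _) / _]big1 ?add0r; last first.
    by move=> i _; rewrite am ?mul0r.
  rewrite mulr_suml; apply: eq_bigr => i _.
  by rewrite exprD mulrA mulrAC mulfK// expf_neq0.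
by apply: (cvgCM cvl); exact: cvgC_cst.
Qed.

Definition cauchy_prod a b k := \sum_(i < k.+1) a i * b (k - i)%N.

Lemma natr_expn2_le n : (n%:R : R) <= 2 ^+ n.
Proof. by rewrite -natrX ler_nat ltnW// ltn_expl. Qed.

(** The partial sums are values at [1] of polynomials of size at most [n],
    and the truncated Cauchy product is the lower half of the product of
    these polynomials. The [n] coefficients of the upper half are at most
    [A * B * 2 * n * 8^-1 ^+ n] each, and [n <= 2 ^+ n]. *)
Lemma psum_prod_sub a b w A B M n : 0 < M ->
  geo_bound a A M -> geo_bound b B M -> M * normc w <= 8^-1 ->
  normc (psum (cauchy_prod a b) w n - psum a w n * psum b w n) <=
  A * B * 2 * 2^-1 ^+ n.
Proof.
move=> M0 aA bB wM.
set t := M * normc w in wM.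
have t0 : 0 <= t by rewrite mulr_ge0 ?normc_ge0 ?ltW.
have t1 : t <= 1 by apply: le_trans wM _; rewrite invf_le1// ler1n.
have A0 := geo_bound_ge0 aA; have B0 := geo_bound_ge0 bB.
pose P := \poly_(i < n) (a i * w ^+ i); pose Q := \poly_(i < n) (b i * w ^+ i).
have PE : psum a w n = P.[1].
  rewrite psumE horner_poly; apply: eq_bigr => i _; by rewrite expr1n mulr1.
have QE : psum b w n = Q.[1].
  rewrite psumE horner_poly; apply: eq_bigr => i _; by rewrite expr1n mulr1.
have szPQ : (size (P * Q)%R <= n + n)%N.
  apply: leq_trans (size_polyMleq _ _) _.
  apply: leq_trans (leq_pred _) _.
  by apply: leq_add; exact: size_poly.
rewrite PE QE -hornerM (horner_coef_wide _ szPQ) big_split_ord /=.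
have -> : psum (cauchy_prod a b) w n = \sum_(i < n) (P * Q)`_i * 1 ^+ i.
  rewrite psumE; apply: eq_bigr => i _; rewrite expr1n mulr1 coefM /cauchy_prod.
  rewrite mulr_suml; apply: eq_bigr => j _.
  have ji : (j <= i)%N by rewrite -ltnS ltn_ord.
  rewrite !coef_poly (leq_ltn_trans ji (ltn_ord i)) (leq_ltn_trans (leq_subr _ _) (ltn_ord i)).
  by rewrite mulrACA -exprD subnKC.
rewrite opprD addrA subrr add0r normcN_eq.
apply: le_trans (normc_sum _ _ _) _.
have Pc k : normc P`_k <= A * t ^+ k.
  rewrite coef_poly; case: ifP => _; last by rewrite normc0 mulr_ge0 ?exprn_ge0.
  by rewrite normcM normcX exprMn mulrA ler_wpM2r ?exprn_ge0 ?normc_ge0.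
have Qc k : normc Q`_k <= B * t ^+ k.
  rewrite coef_poly; case: ifP => _; last by rewrite normc0 mulr_ge0 ?exprn_ge0.
  by rewrite normcM normcX exprMn mulrA ler_wpM2r ?exprn_ge0 ?normc_ge0.
apply: (@le_trans _ _ (\sum_(i < n) A * B * (2 * n%:R) * t ^+ n)).
  apply: ler_sum => i _; rewrite expr1n mulr1 coefM.
  apply: le_trans (normc_sum _ _ _) _.
  apply: (@le_trans _ _ (\sum_(j < (n + i).+1) A * B * t ^+ n)).
    apply: ler_sum => j _; rewrite normcM.
    apply: le_trans (ler_pM (normc_ge0 _) (normc_ge0 _) (Pc _) (Qc _)) _.
    rewrite mulrACA -exprD subnKC; last by rewrite -ltnS.
    rewrite ler_wpM2l ?mulr_ge0// exprD ler_piMr ?exprn_ge0//.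
    by rewrite exprn_ile1.
  rewrite sumr_const card_ord -[X in X <= _]mulr_natr -[A * B * (2 * _) * _]mulrAC.
  rewrite ler_wpM2l ?mulr_ge0 ?exprn_ge0// -natrM ler_nat mul2n -addnn.
  by rewrite -addnS leq_add2l ltn_ord.
rewrite sumr_const card_ord -[X in X <= _]mulr_natr.
apply: (@le_trans _ _ (A * B * (2 * 2 ^+ n) * 8^-1 ^+ n * 2 ^+ n)).
  apply: ler_pM => //; last exact: natr_expn2_le.
    by rewrite !mulr_ge0 ?exprn_ge0.
  apply: ler_pM; rewrite ?mulr_ge0 ?exprn_ge0//.
    by rewrite ler_wpM2l ?mulr_ge0// ler_wpM2l// natr_expn2_le.
  by rewrite lerXn2r// nnegrE// invr_ge0.
apply: eq_ler.
have -> : (8 : R) = 2 * 2 * 2 by rewrite -!natrM.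
rewrite !invfM !exprMn !exprVn; field.
by rewrite expf_neq0.
Qed.

Lemma psum_mul a b w A B M l l' : 0 < M ->
  geo_bound a A M -> geo_bound b B M -> M * normc w <= 8^-1 ->
  psum a w @ \oo --> l -> psum b w @ \oo --> l' ->
  psum (cauchy_prod a b) w @ \oo --> l * l'.
Proof.
move=> M0 aA bB wM al bl; have abl : (fun n => psum a w n * psum b w n) @ \oo --> l * l' by exact: cvgCM al bl.
have d0 : (fun n => psum (cauchy_prod a b) w n - psum a w n * psum b w n) @ \oo
    --> (0 : R[i]).
  apply: (@cvgC_squeeze _ _ _ _ _ _ (geometric (A * B * 2) 2^-1)).
    by apply: nearW => n; rewrite subr0; exact: psum_prod_sub aA bB wM.
  by apply: cvg_geometric; rewrite ger0_norm ?invr_ge0// invf_lt1// ltr1n.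
have : (fun n => (psum (cauchy_prod a b) w n - psum a w n * psum b w n) +
  psum a w n * psum b w n) @ \oo --> 0 + l * l' by exact: cvgCD d0 abl.
rewrite add0r; apply: cvg_trans; apply: near_eq_cvg; apply: nearW => n.
by rewrite subrK.
Qed.

(** The coefficients of the inverse series satisfy a recursion that calls all
    the previous ones. [inv_table a n] is the function giving those of index
    at most [n], which makes the recursion structural. *)
Fixpoint inv_table a n : nat -> R[i] :=
  if n is n'.+1 then
    fun k => if (k <= n')%N then inv_table a n' k
      else - (a 0%N)^-1 * \sum_(i < n) a i.+1 * inv_table a n' (n' - i)%N
  else fun=> (a 0%N)^-1.

Definition inv_coef a k := inv_table a k k.

Lemma inv_tableE a n k : (k <= n)%N -> inv_table a n k = inv_coef a k.
Proof.
elim: n => [|n IHn]; first by rewrite leqn0 => /eqP ->.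
rewrite leq_eqVlt => /predU1P[->//|]; rewrite ltnS => kn.
by rewrite /= kn IHn.
Qed.

Lemma inv_coefS a n : inv_coef a n.+1 =
  - (a 0%N)^-1 * \sum_(i < n.+1) a i.+1 * inv_coef a (n - i)%N.
Proof.
rewrite {1}/inv_coef /= ltnn; congr (_ * _); apply: eq_bigr => i _.
by rewrite inv_tableE// leq_subr.
Qed.

Lemma cauchy_prod_inv a k : a 0%N != 0 ->
  cauchy_prod a (inv_coef a) k = (k == 0)%:R.
Proof.
move=> a0; rewrite /cauchy_prod; case: k => [|k].
  by rewrite big_ord1 subn0 /inv_coef /= mulfV.
rewrite big_ord_recl /= subn0 inv_coefS mulNr mulrN mulVKf//.
by apply/eqP; rewrite addrC subr_eq0; apply/eqP; apply: eq_bigr => i _; rewrite /= subSS.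
Qed.

(** With [r = A / normc (a 0)] and [K = M + r * M] the recursion preserves
    the bound [K ^+ n], because the sum over [i <= n] of
    [r * M ^+ i.+1 * K ^+ (n - i)] telescopes to [K ^+ n.+1 - M ^+ n.+1]. *)
Lemma inv_coef_bound a A M : 0 < M -> a 0%N != 0 -> geo_bound a A M ->
  exists2 K, M <= K & geo_bound (inv_coef a) (normc (a 0%N))^-1 K.
Proof.
move=> M0 a0 aA; have A0 := geo_bound_ge0 aA.
have n0 : 0 < normc (a 0%N) by rewrite normc_gt0.
pose r := A / normc (a 0%N); have r0 : 0 <= r by rewrite divr_ge0// ltW.
have MK : M <= M + r * M by rewrite lerDl mulr_ge0// ltW.
exists (M + r * M) => //; set K := M + r * M.
have K0 : 0 <= K by apply: le_trans MK; exact: ltW.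
have sumK n : \sum_(i < n.+1) r * M ^+ i.+1 * K ^+ (n - i) <= K ^+ n.+1 - M ^+ n.+1.
  elim: n => [|n IHn].
    by rewrite big_ord1 /= subnn !expr1 expr0 mulr1 /K addrAC subrr add0r.
  rewrite big_ord_recl /= subn0 expr1.
  have -> : \sum_(i < n.+1) r * M ^+ (bump 0 i).+1 * K ^+ (n.+1 - bump 0 i) =
     M * \sum_(i < n.+1) r * M ^+ i.+1 * K ^+ (n - i).
    by rewrite mulr_sumr; apply: eq_bigr => i _; rewrite /bump /= add1n subSS [M ^+ i.+2]exprS; ring.
  apply: (@le_trans _ _ (r * M * K ^+ n.+1 + M * (K ^+ n.+1 - M ^+ n.+1))).
    by rewrite lerD2l ler_wpM2l// ltW.
  by rewrite [K ^+ n.+2]exprS [M ^+ n.+2]exprS {3}/K; apply: eq_ler; ring.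
elim/ltn_ind => -[|n] IHn; first by rewrite /inv_coef /= normcV expr0 mulr1.
rewrite inv_coefS normcM normcN_eq normcV ler_wpM2l//.
  by rewrite invr_ge0 ltW.
apply: le_trans (normc_sum _ _ _) _.
apply: (@le_trans _ _ (\sum_(i < n.+1) r * M ^+ i.+1 * K ^+ (n - i))).
  apply: ler_sum => i _; rewrite normcM.
  apply: le_trans (ler_pM (normc_ge0 _) (normc_ge0 _) (aA _) (IHn _ _)) _.
    by rewrite ltnS leq_subr.
  by apply: eq_ler; rewrite /r; ring.
by apply: le_trans (sumK n) _; rewrite gerBl exprn_ge0// ltW.
Qed.

(** The Cauchy product of the two series is [1], so the product of their
    partial sums tends to [1]; dividing by the partial sums of [a] yields at
    once the convergence of the inverse series and its value. *)
Lemma psum_inv a w A M K l : 0 < M -> M <= K -> a 0%N != 0 ->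
  geo_bound a A M -> geo_bound (inv_coef a) (normc (a 0%N))^-1 K ->
  K * normc w <= 8^-1 -> l != 0 ->
  psum a w @ \oo --> l -> psum (inv_coef a) w @ \oo --> l^-1.
Proof.
move=> M0 MK a0 aA iK wK l0 al.
have aA' : geo_bound a A K by apply: geo_boundW aA; rewrite ltW//.
have K0 : 0 < K by apply: lt_le_trans MK.
have prod1 : (fun n => psum a w n * psum (inv_coef a) w n) @ \oo --> (1 : R[i]).
  apply: (@cvgC_squeeze _ _ _ _ _ _ (geometric (A * (normc (a 0%N))^-1 * 2) 2^-1)).
    exists 1%N => // n /= n1.
    rewrite normcB; have := psum_prod_sub n K0 aA' iK wK.
    rewrite /geometric /= {1}psumE (_ : \sum_(k < n) _ = 1)//.
    case: n n1 => // n _; rewrite big_ord_recl cauchy_prod_inv// mul1r expr0 big1 ?addr0//.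
    by move=> i _; rewrite cauchy_prod_inv//= mul0r.
  by apply: cvg_geometric; rewrite ger0_norm ?invr_ge0// invf_lt1// ltr1n.
have : (fun n => psum a w n * psum (inv_coef a) w n * (psum a w n)^-1) @ \oo --> 1 * l^-1.
  by exact: cvgCM prod1 (cvgCV l0 al).
rewrite mul1r; apply: cvg_trans.
apply: near_eq_cvg.
have nz : \forall n \near \oo, psum a w n != 0.
  have l00 : 0 < normc l by rewrite normc_gt0.
  have /cvgCP/cvgr0Pnorm_lt/(_ _ l00) := al.
  apply: filterS => n /=; rewrite ger0_norm ?normc_ge0//; apply: contraTneq => ->.
  by rewrite sub0r normcN_eq ltxx.
by apply: filterS nz => n nz; rewrite mulrAC mulfV// mul1r.
Qed.

End PowerSeries.

(** * Meromorphic functions and the identity theorem *)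

Section Meromorphic.
Variable R : realType.
Implicit Types (z w : R[i]) (a b : nat -> R[i]) (f g : R[i] -> R[i]) (e : R).

Lemma dnearC_ex (P : R[i] -> Prop) z0 : (\forall z \near z0^', P z) -> exists z, P z.
Proof.
move=> /dnearCP [e e0 hP]; exists (z0 + (e / 2)%:C); apply: hP.
  rewrite addrAC subrr add0r normc_real gtr0_norm ?divr_gt0//.
  by rewrite ltr_pdivrMr// ltr_pMr// ltr1n.
rewrite -subr_eq0 addrAC subrr add0r -normc_gt0 normc_real normr_gt0.
by rewrite gt_eqF// divr_gt0.
Qed.

Definition laurent f z0 n a e := forall z, normc (z - z0) < e -> z != z0 ->
  psum a (z - z0) @ \oo --> (z - z0) ^+ n * f z.

(** The radius of the punctured disc is made explicit, so that the radii of
    two expansions can be compared. *)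
Definition mero_at f z0 := exists n a, exists2 e, 0 < e & laurent f z0 n a e.

Lemma meromorphicP f : meromorphic f <-> forall z0, mero_at f z0.
Proof.
split=> h z0; have [n [a]] := h z0.
  by move=> /dnearCP [e e0 he]; exists n, a, e.
by move=> [e e0 he]; exists n, a; apply/dnearCP; exists e.
Qed.

Lemma laurent_at0 f z0 n a e w : laurent f z0 n a e ->
  normc w < e -> w != 0 -> psum a w @ \oo --> w ^+ n * f (w + z0).
Proof.
move=> h we w0; have := h (w + z0); rewrite addrK; apply => //.
by rewrite -subr_eq0 addrK.
Qed.

Lemma laurent_geo_bound f z0 n a e : 0 < e -> laurent f z0 n a e ->
  exists B, exists2 M, 0 < M & geo_bound a B M.
Proof.
move=> e0 /laurent_at0 h.
have e2 : (e / 2)%:C != 0 by rewrite -normc_gt0 normc_real normr_gt0 gt_eqF// divr_gt0.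
apply: (psum_geo_bound e2 (h (e / 2)%:C _ e2)).
by rewrite normc_real gtr0_norm ?divr_gt0// ltr_pdivrMr// ltr_pMr// ltr1n.
Qed.

(** Raising the order of the pole allowed, to bring two expansions to a
    common denominator. *)
Lemma laurent_shift f z0 n a e m : laurent f z0 n a e ->
  laurent f z0 (m + n) (fun k => if (k < m)%N then 0 else a (k - m)%N) e.
Proof. by move=> h z ze zz; rewrite exprD -mulrA; apply: psum_shift; exact: h. Qed.

Lemma mero_at_ext f g z0 : (\forall z \near z0^', f z = g z) ->
  mero_at f z0 -> mero_at g z0.
Proof.
move=> /dnearCP [d d0 fg] [n [a [e e0 h]]]; exists n, a, (Num.min e d).
  by rewrite lt_min e0.
by move=> z; rewrite lt_min => /andP[ze zd] zz; rewrite -fg//; exact: h.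
Qed.

Lemma mero_at_cst (c : R[i]) z0 : mero_at (fun=> c) z0.
Proof.
exists 0%N, (fun k => if k == 0%N then c else 0), 1 => // z _ _.
rewrite expr0 mul1r; apply: cvg_near_cst; exists 1%N => // n /= n1.
rewrite psumE; case: n n1 => // n _.
by rewrite big_ord_recl /= expr0 mulr1 big1 ?addr0// => i _; rewrite mul0r.
Qed.

Lemma mero_atD f g z0 : mero_at f z0 -> mero_at g z0 ->
  mero_at (fun z => f z + g z) z0.
Proof.
move=> [n [a [e e0 ha]]] [m [b [d d0 hb]]].
have {}ha := laurent_shift (m := m) ha; have {}hb := laurent_shift (m := n) hb.
move: ha hb; set a' := (X in laurent f _ _ X _); set b' := (X in laurent g _ _ X _).
move=> ha hb.
exists (m + n)%N, (fun k => a' k + b' k), (Num.min e d); first by rewrite lt_min e0.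
move=> z; rewrite lt_min => /andP[ze zd] zz.
have := hb z zd zz; rewrite addnC => {}hb; have {}ha := ha z ze zz.
have : (fun k => psum a' (z - z0) k + psum b' (z - z0) k) @ \oo -->
   (z - z0) ^+ (m + n) * f z + (z - z0) ^+ (m + n) * g z.
  exact: cvgCD ha hb.
rewrite -mulrDr; apply: cvg_trans; apply: near_eq_cvg; apply: nearW => k.
by rewrite !psumE -big_split; apply: eq_bigr => i _; rewrite mulrDl.
Qed.

(** The constant [8^-1] is the bound under which [psum_mul] and [psum_inv]
    apply. *)
Lemma small_radius e d M : 0 < e -> 0 < d -> 0 < M ->
  exists2 r, 0 < r & forall w, normc w < r ->
    [/\ normc w < e, normc w < d & M * normc w <= 8^-1].
Proof.
move=> e0 d0 M0; exists (Num.min e (Num.min d (8^-1 / M))).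
  by rewrite !lt_min e0 d0 divr_gt0// invr_gt0.
move=> w; rewrite !lt_min => /and3P[-> -> wM]; split=> //.
by rewrite mulrC -ler_pdivlMr// ltW.
Qed.

Lemma mero_atM f g z0 : mero_at f z0 -> mero_at g z0 ->
  mero_at (fun z => f z * g z) z0.
Proof.
move=> [n [a [e e0 ha]]] [m [b [d d0 hb]]].
have [A [M M0 aA]] := laurent_geo_bound e0 ha.
have [B [K K0 bB]] := laurent_geo_bound d0 hb.
have MK0 : 0 < M + K by rewrite addr_gt0.
have {}aA : geo_bound a A (M + K).
  by apply: geo_boundW aA; rewrite (ltW M0) lerDl ltW.
have {}bB : geo_bound b B (M + K).
  by apply: geo_boundW bB; rewrite (ltW K0) lerDr ltW.
have [r r0 hr] := small_radius e0 d0 MK0.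
exists (n + m)%N, (cauchy_prod a b), r => // z /hr [ze zd zM] zz.
rewrite exprD mulrACA.
by apply: (psum_mul MK0 aA bB zM); [exact: ha|exact: hb].
Qed.

(** If all the coefficients vanish then [f] is zero near [z0], and so is its
    inverse since [0^-1 = 0]. Otherwise the lowest power of [z - z0] is
    factored out of the expansion and the remaining series, with nonzero
    constant term, is inverted. *)
Lemma mero_atV f z0 : mero_at f z0 -> mero_at (fun z => (f z)^-1) z0.
Proof.
move=> [n [a [e e0 ha]]].
have [A [M M0 aA]] := laurent_geo_bound e0 ha.
have [az|[m [am ltm _]]] := psum_dichotomy e0 (fun w => laurent_at0 (w := w) ha).
  apply: (@mero_at_ext (fun=> 0)); last exact: mero_at_cst.
  apply/dnearCP; exists e => // z ze zz.
  have lim0 : psum a (z - z0) @ \oo --> (0 : R[i]).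
    apply: cvg_near_cst; apply: nearW => k.
    by rewrite psumE big1// => i _; rewrite az mul0r.
  have /eqP : (z - z0) ^+ n * f z = 0 by exact: cvgC_unique (ha z ze zz) lim0.
  by rewrite mulf_eq0 expf_eq0 subr_eq0 (negbTE zz) andbF /= => /eqP ->; rewrite invr0.
pose b k := a (m + k)%N.
have b0 : b 0%N != 0 by rewrite /b addn0.
have bA : geo_bound b (A * M ^+ m) M by move=> k; rewrite -mulrA -exprD; exact: aA.
have [K MK iK] := inv_coef_bound M0 b0 bA.
have K0 : 0 < K := lt_le_trans M0 MK.
have hb z : normc (z - z0) < e -> z != z0 ->
    psum b (z - z0) @ \oo --> (z - z0) ^+ n * f z / (z - z0) ^+ m.
  by move=> ze zz; apply: psum_drop => //; [rewrite subr_eq0|exact: ha].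
have [d d0 hd] : exists2 d, 0 < d & forall z, normc (z - z0) < d -> z != z0 -> f z != 0.
  have [az|[m' [_ _ [d d0 hd]]]] := psum_dichotomy e0 (fun w => laurent_at0 (w := w) ha).
    by move: am; rewrite az eqxx.
  exists d => // z zd zz; have := hd (z - z0) zd; rewrite subr_eq0 => /(_ zz).
  by rewrite mulf_eq0 negb_or subrK => /andP[].
have [r r0 hr] := small_radius e0 d0 K0.
exists m, (fun k => if (k < n)%N then 0 else inv_coef b (k - n)%N), r => // z /hr [ze zd zK] zz.
have z1 : z - z0 != 0 by rewrite subr_eq0.
have -> : (z - z0) ^+ m * (f z)^-1 =
   (z - z0) ^+ n * ((z - z0) ^+ n * f z / (z - z0) ^+ m)^-1.
  by field; rewrite !expf_neq0// hd.
apply: psum_shift; apply: psum_inv M0 MK b0 bA iK zK _ (hb z ze zz).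
by rewrite !mulf_neq0 ?invr_eq0 ?expf_neq0// hd.
Qed.

Lemma mero_atX f z0 n : mero_at f z0 -> mero_at (fun z => f z ^+ n) z0.
Proof.
move=> h; elim: n => [|n IHn]; first exact: mero_at_cst.
rewrite (_ : (fun z => _) = (fun z => f z * f z ^+ n)); last first.
  by apply/funext => z; rewrite exprS.
exact: mero_atM.
Qed.

Lemma mero_at_dichotomy f z0 : mero_at f z0 ->
  (\forall z \near z0^', f z = 0) \/ (\forall z \near z0^', f z != 0).
Proof.
move=> [n [a [e e0 ha]]].
have [az|[m [_ _ [d d0 hd]]]] := psum_dichotomy e0 (fun w => laurent_at0 (w := w) ha).
  left; apply/dnearCP; exists e => // z ze zz.
  have lim0 : psum a (z - z0) @ \oo --> (0 : R[i]).
    apply: cvg_near_cst; apply: nearW => k.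
    by rewrite psumE big1// => i _; rewrite az mul0r.
  have /eqP : (z - z0) ^+ n * f z = 0 by exact: cvgC_unique (ha z ze zz) lim0.
  by rewrite mulf_eq0 expf_eq0 subr_eq0 (negbTE zz) andbF /= => /eqP.
right; apply/dnearCP; exists d => // z zd zz.
have := hd (z - z0) zd; rewrite subr_eq0 => /(_ zz).
by rewrite mulf_eq0 negb_or subrK => /andP[].
Qed.

Lemma dnear_near (P : R[i] -> Prop) z0 :
  (\forall z \near z0^', P z) -> \forall z \near z0, \forall w \near z^', P w.
Proof.
move=> /dnearCP [e e0 hP]; apply/nearCP; exists e => // z ze.
have [->|zz] := eqVneq z z0; first by apply/dnearCP; exists e.
apply/dnearCP; exists (Num.min (e - normc (z - z0)) (normc (z - z0))).
  by rewrite lt_min subr_gt0 ze normc_gt0 subr_eq0.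
move=> w; rewrite lt_min => /andP[w1 w2] wz; apply: hP.
  have -> : w - z0 = (w - z) + (z - z0) by rewrite addrA subrK.
  by apply: le_lt_trans (normcD_le _ _) _; rewrite -ltrBrDr.
by apply: contraTneq w2 => ->; rewrite normcB ltxx.
Qed.

(** The set of points around which [f - g] vanishes and the set of points
    around which it does not are both open. They cover the line through [z0]
    and [z1], which is connected, and the former contains [z1]. *)
Lemma mero_identity f g : meromorphic f -> meromorphic g ->
  (exists z1, \forall z \near z1^', f z = g z) -> mero_eq f g.
Proof.
move=> /meromorphicP mf /meromorphicP mg [z1 hz1] z0.
pose h z := f z + (-1) * g z.
have mh z : mero_at h z.
  by apply: mero_atD => //; apply: mero_atM => //; exact: mero_at_cst.
have hE z : h z = 0 <-> f z = g z.
  by rewrite /h mulN1r; split=> [/eqP|->]; rewrite ?subrr// subr_eq0 => /eqP.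
pose line (t : R) : R[i] := z1 + t%:C * (z0 - z1).
pose Z := [set t : R | \forall z \near (line t)^', h z = 0].
have line_near (P : R[i] -> Prop) t : (\forall z \near line t, P z) ->
    \forall u \near t, P (line u).
  move=> /nearCP [e e0 hP]; pose D := normc (z0 - z1) + 1.
  have D0 : 0 < D by rewrite ltr_wpDl// normc_ge0.
  apply/nbhs_ballP; exists (e / D) => /=; first by rewrite divr_gt0.
  move=> u; rewrite /ball /= => ut; apply: hP.
  rewrite /line opprD addrACA subrr add0r -mulrBl -rmorphB normcM normc_real distrC.
  apply: le_lt_trans (_ : `|t - u| * D < _); last by rewrite -ltr_pdivlMr.
  by rewrite ler_wpM2l// lerDl.
have oZ : open Z.
  rewrite openE => t Zt; apply: (line_near (fun z => \forall w \near z^', h w = 0)).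
  exact: dnear_near.
have oZC : open (~` Z).
  rewrite openE => t Zt.
  have [//|nz] := mero_at_dichotomy (mh (line t)).
  have /line_near := dnear_near nz; apply: filterS => u hu Zu.
  by have [w [/eqP h1 h2]] := dnearC_ex (filterI hu Zu); exact: h1.
have ZT : Z = setT.
  have cR : connected [set: R] by apply/connected_intervalP => x y _ _ z _.
  apply: cR.
  - by exists 0; rewrite /Z /= /line mul0r addr0; apply: filterS hz1 => z /hE.
  - by exists Z => //; rewrite setTI.
  - by exists Z; [rewrite -[Z]setCK; exact: open_closedC|rewrite setTI].
have : Z 1 by rewrite ZT.
by rewrite /Z /= /line mul1r addrC subrK; apply: filterS => z /hE.
Qed.

End Meromorphic.

(** * The complex exponential *)

Section ComplexExponential.
Variable R : realType.
Implicit Types (z w s : R[i]) (x y : R).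

(** The exponential is built from the real exponential, sine and cosine, as
    the complex powers are, so that [cpowE] is immediate; [psum_cexp] then
    recovers its power series. *)
Definition cexp w : R[i] :=
  (expR (complex.Re w))%:C * (cos (complex.Im w) +i* sin (complex.Im w)).

Lemma cexpD z w : cexp (z + w) = cexp z * cexp w.
Proof.
case: z w => a b [c d]; rewrite /cexp /= expRD cosD sinD; simpc.
congr (_ +i* _); ring.
Qed.

Lemma cexp0 : cexp 0 = 1.
Proof. by rewrite /cexp /= expR0 cos0 sin0; simpc. Qed.

Lemma cexp_neq0 z : cexp z != 0.
Proof.
apply/eqP => h; have := cexpD z (- z).
by rewrite subrr cexp0 h mul0r => /eqP; rewrite oner_eq0.
Qed.

Lemma cexpN z : cexp (- z) = (cexp z)^-1.
Proof.
by apply: (mulfI (cexp_neq0 z)); rewrite -cexpD subrr cexp0 mulfV// cexp_neq0.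
Qed.

Lemma cexpMn z n : cexp (n%:R * z) = cexp z ^+ n.
Proof.
elim: n => [|n IHn]; first by rewrite mul0r cexp0 expr0.
by rewrite -natr1 mulrDl mul1r cexpD IHn exprSr.
Qed.

Lemma normc_cexp z : normc (cexp z) = expR (complex.Re z).
Proof.
rewrite /cexp normcM normc_real ger0_norm ?expR_ge0//=.
by rewrite cos2Dsin2 sqrtr1 mulr1.
Qed.

Lemma cpowE (a : R) s : cpow a s = cexp (s * (ln a)%:C).
Proof. by case: s => x y; rewrite /cpow /cexp; simpc. Qed.

(** On the real and imaginary axes the exponential series reduces to the real
    exponential and to the series of cosine and sine. *)
Lemma psum_exp_real x :
  psum (fun k => x%:C ^+ k / k`!%:R) 1 @ \oo --> (expR x)%:C.
Proof.
apply/cvgC_ReIm; split.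
  have := is_cvg_series_exp_coeff x; rewrite -/(expR x) => h.
  apply: cvg_trans h; apply: near_eq_cvg; apply: nearW => n.
  rewrite psumE raddf_sum /series /= big_mkord; apply: eq_bigr => i _.
  by rewrite expr1n mulr1 -rmorphXn -(rmorph_nat (real_complex R)) -fmorphV -rmorphM.
apply: cvg_near_cst; apply: nearW => n.
rewrite psumE raddf_sum big1// => i _.
by rewrite expr1n mulr1 -rmorphXn -(rmorph_nat (real_complex R)) -fmorphV -rmorphM.
Qed.

Lemma exprI k : ('i%C : R[i]) ^+ k =
  ((~~ odd k)%:R * (-1) ^+ k./2) +i* ((odd k)%:R * (-1) ^+ k.-1./2).
Proof.
rewrite -{1}(odd_double_half k) -mul2n exprD exprM sqr_i.
have -> : (-1 : R[i]) ^+ k./2 = ((-1) ^+ k./2)%:C by rewrite rmorphXn rmorphN rmorph1.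
case: (boolP (odd k)) => ok /=.
  rewrite expr1; simpc; congr (_ +i* _).
  by case: k ok => //= k ok; rewrite uphalf_half (negbTE ok).
by rewrite expr0; simpc.
Qed.

Lemma psum_exp_imag y :
  psum (fun k => ('i%C * y%:C) ^+ k / k`!%:R) 1 @ \oo --> (cos y +i* sin y).
Proof.
have termE k : ('i%C * y%:C) ^+ k / k`!%:R * 1 ^+ k = cos_coeff y k +i* sin_coeff y k.
  rewrite expr1n mulr1 exprMn exprI -rmorphXn -(rmorph_nat (real_complex R)) -fmorphV.
  rewrite cos_coeffE sin_coeffE /=; simpc; congr (_ +i* _); ring.
apply/cvgC_ReIm; split => /=.
  have := @is_cvg_series_cos_coeff R y; rewrite cos.unlock => h.
  apply: cvg_trans h; apply: near_eq_cvg; apply: nearW => n.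
  by rewrite psumE raddf_sum /series /= big_mkord; apply: eq_bigr => i _; rewrite termE.
have := @is_cvg_series_sin_coeff R y; rewrite sin.unlock => h.
apply: cvg_trans h; apply: near_eq_cvg; apply: nearW => n.
by rewrite psumE raddf_sum /series /= big_mkord; apply: eq_bigr => i _; rewrite termE.
Qed.

Lemma normc_fact_inv k : normc (k`!%:R^-1 : R[i]) <= 1.
Proof.
rewrite normcV -(rmorph_nat (real_complex R)) normc_real ger0_norm//.
by rewrite invf_le1 ?ltr0n ?fact_gt0// ler1n fact_gt0.
Qed.

Lemma cauchy_prod_exp z w k :
  cauchy_prod (fun k => z ^+ k / k`!%:R) (fun k => w ^+ k / k`!%:R) k =
  (z + w) ^+ k / k`!%:R.
Proof.
rewrite /cauchy_prod addrC exprDn mulr_suml; apply: eq_bigr => i _.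
have ik : (i <= k)%N by rewrite -ltnS.
rewrite -mulr_natr -(bin_fact ik) !natrM; field.
by rewrite !pnatr_eq0 -!lt0n bin_gt0 ik !fact_gt0.
Qed.

(** The Cauchy product of the expansions on the two axes is the exponential
    series of [w], by the binomial formula [cauchy_prod_exp]. The bound on
    [w] comes from [psum_mul]. *)
Lemma psum_cexp w : normc w <= 8^-1 ->
  psum (fun k => k`!%:R^-1) w @ \oo --> cexp w.
Proof.
move=> w8.
have gb z : normc z <= 8^-1 -> geo_bound (fun k => z ^+ k / k`!%:R) 1 8^-1.
  move=> z8 k; rewrite normcM normcX mul1r -[X in _ <= X]mulr1.
  apply: ler_pM; rewrite ?exprn_ge0 ?normc_ge0 ?normc_fact_inv//.
  by rewrite lerXn2r// nnegrE ?normc_ge0// invr_ge0.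
have gx : geo_bound (fun k => (complex.Re w)%:C ^+ k / k`!%:R) 1 8^-1.
  by apply: gb; rewrite normc_real (le_trans (Re_le_normc _)).
have gy : geo_bound (fun k => ('i%C * (complex.Im w)%:C) ^+ k / k`!%:R) 1 8^-1.
  apply: gb; rewrite normcM normc_real [normc _]/= expr0n expr1n add0r sqrtr1 mul1r.
  by rewrite (le_trans (Im_le_normc _)).
have small : 8^-1 * normc (1 : R[i]) <= 8^-1 by rewrite normc1 mulr1.
have i8 : 0 < (8^-1 : R) by rewrite invr_gt0.
have := psum_mul i8 gx gy small (@psum_exp_real (complex.Re w)) (@psum_exp_imag (complex.Im w)).
rewrite -/(cexp w).
apply: cvg_trans; apply: near_eq_cvg; apply: nearW => n.
rewrite !psumE; apply: eq_bigr => k _.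
rewrite cauchy_prod_exp expr1n mulr1.
by rewrite -complexE mulrC.
Qed.

(** The expansion at [z0] is that at [0], by the addition formula. *)
Lemma mero_at_cexp (c : R[i]) z0 : mero_at (fun z => cexp (c * z)) z0.
Proof.
pose D := normc c + 1.
have D0 : 0 < D by rewrite ltr_wpDl// normc_ge0.
exists 0%N, (fun k => cexp (c * z0) * (c ^+ k / k`!%:R)), (8^-1 / D).
  by rewrite divr_gt0// invr_gt0.
move=> z zz _; rewrite expr0 mul1r.
have -> : cexp (c * z) = cexp (c * z0) * cexp (c * (z - z0)).
  by rewrite -cexpD -mulrDr subrKC.
have w8 : normc (c * (z - z0)) <= 8^-1.
  rewrite normcM; apply: (@le_trans _ _ (D * normc (z - z0))).
    by rewrite ler_wpM2r ?normc_ge0// lerDl.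
  by rewrite mulrC -ler_pdivlMr// ltW.
have : (fun n => cexp (c * z0) * psum (fun k => k`!%:R^-1) (c * (z - z0)) n) @ \oo -->
    cexp (c * z0) * cexp (c * (z - z0)).
  by apply: cvgCM; [exact: cvgC_cst|exact: psum_cexp].
apply: cvg_trans; apply: near_eq_cvg; apply: nearW => n.
rewrite !psumE mulr_sumr; apply: eq_bigr => k _.
by rewrite exprMn; ring.
Qed.

End ComplexExponential.

(** * Completeness of finite extensions of the p-adic numbers *)

Section NonarchimedeanAbs.
Variables (R : realType) (K : fieldType) (nrm : K -> R).
Hypothesis nrmP : nonarch_abs nrm.
Implicit Types (x y z : K) (u v : nat -> K) (e : R).

Lemma nrm_ge0 x : 0 <= nrm x. Proof. exact: nonarch_abs_ge0. Qed.
Lemma nrm_eq0 x : (nrm x == 0) = (x == 0). Proof. exact: nonarch_abs_eq0. Qed.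
Lemma nrmM x y : nrm (x * y) = nrm x * nrm y. Proof. exact: nonarch_absM. Qed.

Lemma nrm_gt0 x : (0 < nrm x) = (x != 0).
Proof. by rewrite lt_def nrm_eq0 nrm_ge0 andbT. Qed.

Lemma nrm0 : nrm 0 = 0.
Proof. by apply/eqP; rewrite nrm_eq0. Qed.

Lemma nrm1 : nrm 1 = 1.
Proof.
have n0 : nrm 1 != 0 by rewrite nrm_eq0 oner_eq0.
by apply: (mulfI n0); rewrite -nrmM !mulr1.
Qed.

Lemma nrmN x : nrm (- x) = nrm x.
Proof.
suff h : nrm (-1) = 1 by rewrite -mulN1r nrmM h mul1r.
have : nrm (-1) ^+ 2 == 1 by rewrite expr2 -nrmM mulrNN mulr1 nrm1.
by rewrite sqrf_eq1 => /orP[/eqP//|/eqP h]; have := nrm_ge0 (-1); rewrite h ler0N1.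
Qed.

Lemma nrmB x y : nrm (x - y) = nrm (y - x).
Proof. by rewrite -nrmN opprB. Qed.

Lemma nrmX x n : nrm (x ^+ n) = nrm x ^+ n.
Proof. by elim: n => [|n IHn]; rewrite ?nrm1// !exprS nrmM IHn. Qed.

Lemma nrmV x : nrm x^-1 = (nrm x)^-1.
Proof.
have [->|x0] := eqVneq x 0; first by rewrite invr0 nrm0 invr0.
have n0 : nrm x != 0 by rewrite nrm_eq0.
by apply: (mulfI n0); rewrite -nrmM !mulfV// nrm1.
Qed.

Lemma nrmXz x (n : int) : nrm (x ^ n) = nrm x ^ n.
Proof. by case: n => n; rewrite ?NegzE ?exprN -?exprnP -?exprnN ?nrmV nrmX. Qed.

Lemma nrmD_le x y e : nrm x <= e -> nrm y <= e -> nrm (x + y) <= e.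
Proof. by move=> h1 h2; apply: le_trans (nonarch_absD nrmP x y) _; rewrite ge_max h1. Qed.

Lemma nrmD_lt x y e : nrm x < e -> nrm y < e -> nrm (x + y) < e.
Proof. by move=> h1 h2; apply: le_lt_trans (nonarch_absD nrmP x y) _; rewrite gt_max h1. Qed.

Lemma nrmB_le x y e : nrm x <= e -> nrm y <= e -> nrm (x - y) <= e.
Proof. by move=> h1 h2; apply: nrmD_le; rewrite ?nrmN. Qed.

Lemma nrmB_lt x y e : nrm x < e -> nrm y < e -> nrm (x - y) < e.
Proof. by move=> h1 h2; apply: nrmD_lt; rewrite ?nrmN. Qed.

Lemma nrmD_dom x y : nrm y < nrm x -> nrm (x + y) = nrm x.
Proof.
move=> yx; apply/eqP; rewrite eq_le; apply/andP; split.
  by apply: nrmD_le => //; exact: ltW.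
rewrite leNgt; apply/negP => h.
have : nrm ((x + y) - y) < nrm x by apply: nrmB_lt.
by rewrite addrK ltxx.
Qed.

Definition cauchy_seq u := forall e, 0 < e -> exists N : nat, forall m n : nat,
  (N <= m)%N -> (N <= n)%N -> nrm (u m - u n) < e.

Definition cvg_seq u l := forall e, 0 < e -> exists N : nat, forall n : nat,
  (N <= n)%N -> nrm (u n - l) < e.

(** Sequential completeness, in the terms in which the completeness of the
    p-adic numbers is given. *)
Definition complete_abs := forall u, cauchy_seq u -> exists l, cvg_seq u l.

Lemma cvg_seqD u v l m : cvg_seq u l -> cvg_seq v m ->
  cvg_seq (fun n => u n + v n) (l + m).
Proof.
move=> hu hv e e0; have [N hN] := hu e e0; have [M hM] := hv e e0.
exists (maxn N M) => n; rewrite geq_max => /andP[nN nM].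
by rewrite opprD addrACA; apply: nrmD_lt; [exact: hN|exact: hM].
Qed.

Lemma cvg_seqMr u l x : cvg_seq u l -> cvg_seq (fun n => u n * x) (l * x).
Proof.
move=> hu e e0; have x1 : 0 < nrm x + 1 by rewrite ltr_wpDl// nrm_ge0.
have [N hN] := hu (e / (nrm x + 1)) (divr_gt0 e0 x1).
exists N => n nN; rewrite -mulrBl nrmM.
apply: le_lt_trans (_ : nrm (u n - l) * (nrm x + 1) < _).
  by rewrite ler_wpM2l ?nrm_ge0// lerDl.
by rewrite -ltr_pdivlMr// hN.
Qed.

Lemma cvg_seq_uniq u l m : cvg_seq u l -> cvg_seq u m -> l = m.
Proof.
move=> hl hm; apply/eqP; rewrite -subr_eq0; apply/negPn/negP; rewrite -nrm_gt0 => lm.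
have [N hN] := hl _ lm; have [M hM] := hm _ lm.
have := @nrmB_lt (u (maxn N M) - m) (u (maxn N M) - l) _ (hM _ (leq_maxr _ _)) (hN _ (leq_maxl _ _)).
by rewrite opprB addrC addrA subrK ltxx.
Qed.

Lemma cauchy_seqB u v : cauchy_seq u -> cauchy_seq v -> cauchy_seq (fun n => u n - v n).
Proof.
move=> hu hv e e0; have [N hN] := hu e e0; have [M hM] := hv e e0.
exists (maxn N M) => m n; rewrite !geq_max => /andP[m1 m2] /andP[n1 n2].
by rewrite opprD addrACA -opprD; apply: nrmB_lt; [exact: hN|exact: hM].
Qed.

Lemma cvg_cauchy_seq u l : cvg_seq u l -> cauchy_seq u.
Proof.
move=> hu e e0; have [N hN] := hu e e0; exists N => m n mN nN.
have -> : u m - u n = (u m - l) - (u n - l) by rewrite opprB addrA subrK.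
by apply: nrmB_lt; exact: hN.
Qed.

End NonarchimedeanAbs.

Section PadicExtension.
Variables (R : realType) (p : nat) (Qp : fieldType) (absQp : Qp -> R).
Variables (F : fieldExtType Qp) (nrm : F -> R).
Hypotheses (p_pr : prime p) (QpP : is_Qp p absQp) (nrmP : nonarch_abs nrm).
Hypothesis nrm_above : forall x : Qp, (nrm x%:A <= 1) = (absQp x <= 1).
Let absP : nonarch_abs absQp := is_Qp_abs QpP.

Lemma absQp_nat n : (0 < n)%N -> absQp n%:R = p%:R^-1 ^+ logn p n.
Proof.
move=> n0; have := is_Qp_rat QpP n%:R; rewrite ratr_nat => ->.
rewrite /padic_abs pnatr_eq0 (gtn_eqF n0).
have -> : numq (n%:R : rat) = n by rewrite -[n%:R]/(n%:Z%:~R) numq_int.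
have -> : denq (n%:R : rat) = 1 by rewrite -[n%:R]/(n%:Z%:~R) denq_int.
by rewrite /= logn1 expr0 div1r exprVn.
Qed.

Lemma absQp_p : absQp p%:R = p%:R^-1.
Proof. by rewrite absQp_nat ?prime_gt0// logn_prime// eqxx expr1. Qed.

Let p_gt1 : 1 < (p%:R : R). Proof. by rewrite ltr1n prime_gt1. Qed.
Let p_gt0 : 0 < (p%:R : R). Proof. by rewrite ltr0n prime_gt0. Qed.

Lemma Qp_p_neq0 : (p%:R : Qp) != 0.
Proof. by rewrite -(nrm_eq0 absP) absQp_p invr_eq0 gt_eqF. Qed.

Lemma nrm_p_gt0 : 0 < nrm (p%:R%:A).
Proof. by rewrite (nrm_gt0 nrmP) scaler_eq0 oner_eq0 orbF Qp_p_neq0. Qed.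

(** Otherwise the inverse of [p] would be integral in [F], hence in [Qp]. *)
Lemma nrm_p_lt1 : nrm (p%:R%:A) < 1.
Proof.
rewrite ltNge; apply/negP => h.
have : nrm (p%:R^-1%:A) <= 1.
  have -> : (p%:R^-1%:A : F) = (p%:R%:A)^-1 by rewrite -!in_algE fmorphV.
  by rewrite (nrmV nrmP) invf_le1// nrm_p_gt0.
rewrite nrm_above (nrmV absP) absQp_p invrK leNgt => /negP; exact.
Qed.

Lemma nrm_algX x k : nrm ((x ^+ k)%:A) = nrm x%:A ^+ k.
Proof. by rewrite -!in_algE rmorphXn (nrmX nrmP). Qed.

(** The two absolute values on [Qp] share their unit ball. Dividing by
    [p ^+ k] compares them at every power of [p], which is enough for them to
    define the same topology ([alg_small], [small_alg]). *)
Lemma nrm_alg_le x k : (nrm x%:A <= nrm p%:R%:A ^+ k) = (absQp x <= p%:R^-1 ^+ k).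
Proof.
have pk : (p%:R ^+ k : Qp) != 0 by rewrite expf_neq0// Qp_p_neq0.
have nk : 0 < nrm p%:R%:A ^+ k by rewrite exprn_gt0// nrm_p_gt0.
have -> : nrm x%:A = nrm (x / p%:R ^+ k)%:A * nrm p%:R%:A ^+ k.
  by rewrite -nrm_algX -(nrmM nrmP) -!in_algE -rmorphM mulfVK.
have pk' : 0 < p%:R^-1 ^+ k :> R by rewrite exprn_gt0// invr_gt0.
rewrite -[X in _ <= X]mul1r ler_pM2r// nrm_above.
rewrite (nrmM absP) (nrmV absP) (nrmX absP) absQp_p -[X in _ = (_ <= X)]mul1r.
by rewrite -ler_pdivrMr.
Qed.

Lemma lt1_expn_lt (t e : R) : 0 <= t < 1 -> 0 < e -> exists k : nat, t ^+ k < e.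
Proof.
move=> /andP[t0 t1] e0.
have /cvgr0_norm_lt/(_ _ e0) [k _ hk] : geometric 1 t @ \oo --> (0 : R).
  by apply: cvg_geometric; rewrite ger0_norm.
exists k; have := hk k (leqnn k); rewrite /geometric /= mul1r ger0_norm//.
exact: exprn_ge0.
Qed.

Lemma alg_small e : 0 < e -> exists2 d : R, 0 < d &
  forall x, absQp x < d -> nrm x%:A < e.
Proof.
move=> e0; have [|k hk] := @lt1_expn_lt (nrm p%:R%:A) e _ e0.
  by rewrite nrm_p_lt1 ltW// nrm_p_gt0.
exists (p%:R^-1 ^+ k); first by rewrite exprn_gt0// invr_gt0.
by move=> x xk; apply: le_lt_trans hk; rewrite nrm_alg_le ltW.
Qed.

Lemma small_alg e : 0 < e -> exists2 d : R, 0 < d &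
  forall x, nrm x%:A < d -> absQp x < e.
Proof.
move=> e0; have [|k hk] := @lt1_expn_lt (p%:R^-1) e _ e0.
  by rewrite invr_ge0 ltW//= invf_lt1.
exists (nrm p%:R%:A ^+ k); first by rewrite exprn_gt0// nrm_p_gt0.
by move=> x xk; apply: le_lt_trans hk; rewrite -nrm_alg_le ltW.
Qed.

(** A sequence of scalars that is Cauchy in [F] is Cauchy in [Qp], by
    [small_alg], and its limit in [Qp] is its limit in [F], by [alg_small]. *)
Lemma cauchy_alg_cvg (u : nat -> Qp) : cauchy_seq nrm (fun n => (u n)%:A) ->
  exists l, cvg_seq nrm (fun n => (u n)%:A) l%:A.
Proof.
move=> cu; have [|l hl] := is_Qp_complete QpP (u := u).
  move=> e e0; have [d d0 hd] := small_alg e0; have [N hN] := cu d d0.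
  by exists N => m n mN nN; apply: hd; rewrite scalerBl; exact: hN.
exists l => e e0; have [d d0 hd] := alg_small e0; have [N hN] := hl d d0.
by exists N => n nN; rewrite -scalerBl; apply: hd; exact: hN.
Qed.

Definition complete_span (X : seq F) := forall u : nat -> F, cauchy_seq nrm u ->
  (forall n, u n \in <<X>>%VS) -> exists2 l, l \in <<X>>%VS & cvg_seq nrm u l.

Lemma nrm_scale a x : nrm (a *: x) = nrm a%:A * nrm x.
Proof. by rewrite -(nrmM nrmP) mulr_algl. Qed.

(** A vector at distance zero from a subspace is a limit of elements of the
    subspace, so it belongs to it if the subspace is complete. *)
Lemma dist_span_gt0 X x : complete_span X -> x \notin <<X>>%VS ->
  exists2 c : R, 0 < c & forall w, w \in <<X>>%VS -> c <= nrm (x + w).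
Proof.
move=> cX xX; apply: contrapT => hn.
have ex n : exists w, w \in <<X>>%VS /\ nrm (x + w) < n.+1%:R^-1.
  apply: contrapT => hw; apply: hn; exists n.+1%:R^-1; first by rewrite invr_gt0.
  by move=> w wX; rewrite leNgt; apply/negP => hlt; apply: hw; exists w.
have [w hw] := choice ex.
have wx : cvg_seq nrm w (- x).
  move=> e e0.
  exists (Num.bound e^-1) => n nN; rewrite opprK addrC.
  apply: lt_trans (hw n).2 _; rewrite invf_plt ?posrE//.
  apply: lt_le_trans (archi_boundP _) _; first by rewrite invr_ge0 ltW.
  by rewrite ler_nat (leq_trans nN).
have [l lX wl] := cX _ (cvg_cauchy_seq nrmP wx) (fun n => (hw n).1).
have lx : l = - x := cvg_seq_uniq nrmP wl wx.
by move: xX; rewrite -memvN -lx lX.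
Qed.

(** By induction on the number of generators. If [x] lies outside the
    complete span of [X], its distance to that span bounds the coordinate
    along [x] of a vector of the larger span by a multiple of its norm; hence
    the coordinates of a Cauchy sequence are Cauchy. *)
Lemma complete_span_all X : complete_span X.
Proof.
elim: X => [|x X IHX].
  move=> u cu uX; exists 0; first exact: mem0v.
  move=> e e0; exists 0%N => n _; have := uX n.
  by rewrite span_nil memv0 => /eqP ->; rewrite subrr (nrm0 nrmP).
have [xX|xX] := boolP (x \in <<X>>%VS).
  have sx : (<<x :: X>> = <<X>>)%VS by rewrite span_cons; apply/addv_idPr.
  by rewrite /complete_span sx.
have [c c0 hc] := dist_span_gt0 IHX xX.
(* The coordinate along [x] is controlled by the norm. *)
have lower a w : w \in <<X>>%VS -> c * nrm a%:A <= nrm (a *: x + w).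
  have [->|a0 wX] := eqVneq a 0.
    by rewrite !scale0r (nrm0 nrmP) mulr0 nrm_ge0.
  have -> : a *: x + w = a *: (x + a^-1 *: w) by rewrite scalerDr scalerA mulfV// scale1r.
  by rewrite nrm_scale mulrC ler_wpM2l ?nrm_ge0// hc// memvZ.
move=> u cu uX.
have dec n : exists aw : Qp * F, aw.2 \in <<X>>%VS /\ u n = aw.1 *: x + aw.2.
  have := uX n; rewrite span_cons => /memv_addP [y yx [w wX ->]].
  by have /vlineP [a ->] := yx; exists (a, w).
have [aw haw] := choice dec.
have cA : cauchy_seq nrm (fun n => (aw n).1%:A).
  move=> e e0; have [N hN] := cu (c * e) (mulr_gt0 c0 e0).
  exists N => m n mN nN; rewrite -scalerBl -(ltr_pM2l c0).
  apply: le_lt_trans (hN m n mN nN).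
  rewrite (haw m).2 (haw n).2 opprD addrACA -scalerBl; apply: lower.
  by rewrite memvB//; [exact: (haw m).1|exact: (haw n).1].
have [a ha] := cauchy_alg_cvg cA.
have hax : cvg_seq nrm (fun n => (aw n).1 *: x) (a *: x).
  have := cvg_seqMr nrmP x ha; rewrite mulr_algl.
  by under eq_fun do rewrite mulr_algl.
have cW : cauchy_seq nrm (fun n => (aw n).2).
  rewrite (_ : (fun n => _) = (fun n => u n - (aw n).1 *: x)); last first.
    by apply/funext => n; rewrite (haw n).2 addrC addKr.
  by apply: cauchy_seqB => //; exact: cvg_cauchy_seq hax.
have [w wX hw] := IHX _ cW (fun n => (haw n).1).
exists (a *: x + w).
  by rewrite span_cons memv_add// memvZ// memv_line.
rewrite (_ : u = (fun n => (aw n).1 *: x + (aw n).2)); first exact: cvg_seqD.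
by apply/funext => n; exact: (haw n).2.
Qed.

(** The field is the span of a finite basis. *)
Lemma padic_extension_complete : complete_abs nrm.
Proof.
move=> u cu; have [|l _ hl] := @complete_span_all (vbasis {:F}) u cu.
  by move=> n; rewrite (span_basis (vbasisP _)) memvf.
by exists l.
Qed.

(** Both [2] and its inverse are p-adic integers when [p] is odd. *)
Lemma nrm_two : odd p -> nrm 2%:R = 1.
Proof.
move=> op.
have a2 : absQp 2%:R = 1.
  rewrite absQp_nat// logn_coprime ?expr0//.
  by rewrite prime_coprime// dvdn_prime2//; apply: contraTneq op => ->.
have e2 : (2%:R : F) = 2%:R%:A by rewrite -in_algE rmorph_nat.
apply/eqP; rewrite eq_le {1}e2 nrm_above a2 lexx /=.
have n2 : 0 < nrm 2%:R.
  by rewrite (nrm_gt0 nrmP) e2 -in_algE fmorph_eq0 -(nrm_eq0 absP) a2 oner_eq0.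
rewrite -invf_le1// -(nrmV nrmP) e2.
have -> : ((2%:R%:A)^-1 : F) = 2%:R^-1%:A by rewrite -!in_algE fmorphV.
by rewrite nrm_above (nrmV absP) a2 invr1.
Qed.

End PadicExtension.

(** * Valuations and sums over cosets of ideals *)

(** Completeness is included as a field, so that the rest of the argument
    applies to any nonarchimedean local field, with the residue
    characteristic entering through the absolute value of [2]. *)
Record local_field (R : realType) (K : fieldType) (nrm : K -> R) (varpi : K)
    (q : nat) : Prop := LocalField {
  lf_abs : nonarch_abs nrm;
  lf_uniformizer : [set x | nrm x < 1] = [set varpi * y | y in integers nrm];
  lf_residue : ([set [set y | (nrm (y - x) < 1 : Prop)] | x in integers nrm] #= `I_q)%card;
  lf_varpi : nrm varpi = q%:R^-1;
  lf_varpi_neq0 : varpi != 0;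
  lf_complete : complete_abs nrm
}.

Section LocalField.
Variables (R : realType) (K : fieldType) (nrm : K -> R) (varpi : K) (q : nat).
Hypothesis lfP : local_field nrm varpi q.
Let nrmP := lf_abs lfP.
Implicit Types (x y z : K) (m n : int) (D : set K).

Notation Pi := (nrm varpi).
Notation B := (ideal_pow nrm varpi).

Lemma Pi_gt0 : 0 < Pi.
Proof. by rewrite (nrm_gt0 nrmP) (lf_varpi_neq0 lfP). Qed.

Lemma Pi_lt1 : Pi < 1.
Proof.
have : [set x | nrm x < 1] varpi.
  by rewrite (lf_uniformizer lfP); exists 1; rewrite ?mulr1//= /integers /= (nrm1 nrmP).
by [].
Qed.

Lemma q_gt1 : (1 < q)%N.
Proof.
have := Pi_lt1; have := Pi_gt0; rewrite (lf_varpi lfP) invr_gt0 ltr0n => q0.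
by rewrite invf_lt1 ?ltr0n// ltr1n.
Qed.

Lemma q_neq0 (V : numFieldType) : (q%:R : V) != 0.
Proof. by rewrite pnatr_eq0 -lt0n (ltn_trans _ q_gt1). Qed.

Lemma Pi_le m n : (Pi ^ m <= Pi ^ n) = (n <= m).
Proof.
have e k : Pi ^ k = Pi^-1 ^ (- k) by rewrite exprz_inv opprK.
by rewrite !e ler_eXz2l ?lerN2// invf_gt1 ?Pi_gt0 ?Pi_lt1.
Qed.

Lemma Pi_lt m n : (Pi ^ m < Pi ^ n) = (n < m).
Proof. by rewrite !ltNge Pi_le. Qed.

Lemma Piz_gt0 n : 0 < Pi ^ n.
Proof. by rewrite exprz_gt0// Pi_gt0. Qed.

Lemma nrm_varpiz n : nrm (varpi ^ n) = Pi ^ n.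
Proof. exact: nrmXz. Qed.

Lemma varpiz_neq0 n : varpi ^ n != 0.
Proof. by rewrite expfz_neq0// (lf_varpi_neq0 lfP). Qed.

(** Dividing by [varpi] raises the absolute value by a fixed factor, so that
    an element of the unit ball becomes a unit after finitely many steps. *)
Lemma nrm_small_val k x : Pi ^+ k < nrm x <= 1 -> exists n : nat, nrm x = Pi ^+ n.
Proof.
elim: k x => [|k IHk] x /andP[h1 h2]; first by move: (lt_le_trans h1 h2); rewrite expr0 ltxx.
have [x1|] := ltP (nrm x) 1; last first.
  by move=> x1; exists 0%N; apply/eqP; rewrite eq_le h2.
have : [set x | nrm x < 1] x by [].
rewrite (lf_uniformizer lfP) => -[y y1 xE].
move: h1; rewrite -xE (nrmM nrmP) exprS ltr_pM2l ?Pi_gt0// => h1.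
have [|n nE] := IHk y; first by rewrite h1.
by exists n.+1; rewrite exprS nE.
Qed.

Lemma nrm_val x : x != 0 -> exists n : int, nrm x = Pi ^ n.
Proof.
move=> x0.
have small y : y != 0 -> nrm y <= 1 -> exists n : nat, nrm y = Pi ^+ n.
  move=> y0 y1; have [k hk] : exists k : nat, Pi ^+ k < nrm y.
    apply: lt1_expn_lt; last by rewrite (nrm_gt0 nrmP).
    by rewrite Pi_lt1 ltW// Pi_gt0.
  by apply: (@nrm_small_val k); rewrite hk.
have [x1|x1] := leP (nrm x) 1.
  by have [n nE] := small x x0 x1; exists n%:Z; rewrite nE.
have [||n nE] := small x^-1; first by rewrite invr_eq0.
  by rewrite (nrmV nrmP) invf_le1 ?ltW// (lt_trans ltr01).
exists (- n%:Z); apply: invr_inj.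
by rewrite -(nrmV nrmP) nE invr_expz opprK.
Qed.

Lemma nrm_lt_Pi x n : (nrm x < Pi ^ n) = (nrm x <= Pi ^ (n + 1)).
Proof.
have [->|/nrm_val[m ->]] := eqVneq x 0.
  by rewrite (nrm0 nrmP) Piz_gt0 ltW ?Piz_gt0.
by rewrite Pi_lt Pi_le lezD1.
Qed.

Lemma nrm_lt1 x : (nrm x < 1) = (nrm x <= Pi ^ 1).
Proof. by rewrite -(expr0z Pi) nrm_lt_Pi. Qed.

Lemma ideal0 n : B n 0.
Proof. by rewrite /ideal_pow /= (nrm0 nrmP) ltW// Piz_gt0. Qed.

Lemma idealD n x y : B n x -> B n y -> B n (x + y).
Proof. exact: nrmD_le. Qed.

Lemma idealN n x : B n x -> B n (- x).
Proof. by rewrite /ideal_pow /= (nrmN nrmP). Qed.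

Lemma idealB n x y : B n x -> B n y -> B n (x - y).
Proof. exact: nrmB_le. Qed.

Lemma ideal_le m n x : m <= n -> B n x -> B m x.
Proof. by move=> mn; rewrite /ideal_pow /= => h; apply: le_trans h _; rewrite Pi_le. Qed.

Lemma idealM m n x y : B m x -> B n y -> B (m + n) (x * y).
Proof.
rewrite /ideal_pow /= => hx hy.
by rewrite (nrmM nrmP) expfzDr ?gt_eqF ?Pi_gt0// ler_pM ?nrm_ge0.
Qed.

Lemma ideal_divz m n x : B (m + n) x -> B n (x / varpi ^ m).
Proof.
rewrite /ideal_pow /= (nrmM nrmP) (nrmV nrmP) nrm_varpiz ler_pdivrMr ?Piz_gt0//.
by rewrite -expfzDr ?gt_eqF ?Pi_gt0// [n + m]addrC.
Qed.

(** The choice depends on the coset as a set only, so equality of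
    representatives is membership in the same coset ([rep_eqP]). Sums over
    cosets then become sums over finite sets of field elements. *)
Definition rep n x : K := xget 0 [set y | nrm (y - x) <= Pi ^ n].

Lemma rep_near n x : B n (rep n x - x).
Proof.
rewrite /rep; case: xgetP => [y -> //|/(_ x)].
by rewrite /= subrr => /(_ (ideal0 n)).
Qed.

Lemma rep_eq n x y : B n (x - y) -> rep n x = rep n y.
Proof.
move=> xy; rewrite /rep; congr (xget 0 _); apply/seteqP; split=> z /= h.
  have -> : z - y = (z - x) + (x - y) by rewrite addrA subrK.
  exact: idealD.
have -> : z - x = (z - y) - (x - y) by rewrite opprB addrA subrK.
exact: idealB.
Qed.

Lemma rep_eqP n x y : rep n x = rep n y <-> B n (x - y).
Proof.
split; last exact: rep_eq.
move=> h; have -> : x - y = (rep n y - y) - (rep n x - x).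
  by rewrite h; ring.
by apply: idealB; exact: rep_near.
Qed.

Lemma rep_idem n x : rep n (rep n x) = rep n x.
Proof. by apply: rep_eq; exact: rep_near. Qed.

Definition coset_stable n D := forall x y, D x -> B n y -> D (x + y).

Definition coset_inv (V : Type) n D (f : K -> V) :=
  forall x y, D x -> B n y -> f (x + y) = f x.

Lemma stable_near n D x y : coset_stable n D -> D x -> B n (y - x) -> D y.
Proof. by move=> sD Dx yx; rewrite -(subrKC x y); exact: sD. Qed.

Lemma inv_near (V : Type) n D (f : K -> V) x y :
  coset_inv n D f -> D x -> B n (y - x) -> f y = f x.
Proof. by move=> sf Dx yx; rewrite -(subrKC x y); exact: sf. Qed.

Lemma stable_rep n D x : coset_stable n D -> D x -> D (rep n x).
Proof. by move=> sD Dx; apply: stable_near sD Dx (rep_near n x). Qed.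

Lemma inv_rep (V : Type) n D (f : K -> V) x : coset_inv n D f -> D x ->
  f (rep n x) = f x.
Proof. by move=> sf Dx; apply: inv_near sf Dx (rep_near n x). Qed.

Lemma ideal_stable m n : m <= n -> coset_stable n (B m).
Proof. by move=> mn x y hx hy; apply: idealD => //; exact: ideal_le hy. Qed.

(** Meant for [D] stable under translation by [varpi ^ n] and [f] constant on
    its cosets, when it is the sum over the cosets contained in [D]; it is
    zero by convention if they are infinite in number. *)
Definition coset_sum (V : nmodType) n D (f : K -> V) : V :=
  \sum_(c \in rep n @` D) f c.

Lemma eq_coset_sum (V : nmodType) n D (f g : K -> V) : coset_stable n D ->
  (forall x, D x -> f x = g x) -> coset_sum n D f = coset_sum n D g.
Proof.
move=> sD fg; apply: eq_fsbigr => c; rewrite inE => -[x Dx <-].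
by apply: fg; exact: stable_rep.
Qed.

(** The last two hypotheses say that [phi] induces a bijection between the
    cosets of the source and those of the target. *)
Lemma coset_sum_reindex (V : nmodType) n n' D D' (phi : K -> K) (f : K -> V) :
  coset_stable n D -> coset_inv n' D' f ->
  (forall x, D x -> D' (phi x)) ->
  (forall y, D' y -> exists2 x, D x & B n' (phi x - y)) ->
  (forall x y, D x -> D y -> B n' (phi x - phi y) <-> B n (x - y)) ->
  coset_sum n D (fun x => f (phi x)) = coset_sum n' D' f.
Proof.
move=> sD sf phiD phis phii; rewrite /coset_sum.
rewrite [RHS](@reindex_fsbig _ _ _ _ _ (fun c => rep n' (phi c)) (rep n @` D)).
  apply: eq_fsbigr => c; rewrite inE => -[x Dx <-].
  by rewrite (inv_rep sf)//; apply: phiD; exact: stable_rep.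
split.
- by move=> _ [x Dx <-]; exists (phi (rep n x)) => //; apply: phiD; exact: stable_rep.
- move=> _ _ /[!inE] -[x Dx <-] [y Dy <-] /rep_eqP.
  rewrite phii; [|exact: stable_rep..].
  by move/rep_eqP; rewrite !rep_idem.
- move=> _ [y Dy <-]; have [x Dx xy] := phis y Dy.
  exists (rep n x); first by exists x.
  apply/rep_eqP; have -> : phi (rep n x) - y = (phi (rep n x) - phi x) + (phi x - y).
    by rewrite addrA subrK.
  apply: idealD => //; apply/phii => //; first exact: stable_rep.
  exact: rep_near.
Qed.

Lemma coset_sum_scale (V : nmodType) j n D D' (f : K -> V) :
  coset_stable n D -> coset_inv (j + n) D' f ->
  (forall x, D' (varpi ^ j * x) <-> D x) ->
  coset_sum n D (fun x => f (varpi ^ j * x)) = coset_sum (j + n) D' f.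
Proof.
move=> sD sf DD'.
apply: (@coset_sum_reindex V n (j + n) D D' (fun x => varpi ^ j * x)) => //.
- by move=> x /DD'.
- move=> y Dy; have yE : varpi ^ j * (y / varpi ^ j) = y.
    by rewrite mulrC mulfVK// varpiz_neq0.
  by exists (y / varpi ^ j); [apply/DD'; rewrite yE|rewrite yE subrr; exact: ideal0].
- move=> x y _ _; rewrite -mulrBr; split=> h.
    rewrite -[x - y](mulfVK (varpiz_neq0 j)) mulrAC [_ * varpi ^ j]mulrC.
    exact: ideal_divz.
  by apply: idealM => //; rewrite /ideal_pow /= nrm_varpiz.
Qed.

Lemma ideal_scale j n x : B (j + n) (varpi ^ j * x) <-> B n x.
Proof.
split=> [h|h].
  rewrite -[x](mulfVK (varpiz_neq0 j)) mulrAC [_ * varpi ^ j]mulrC.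
  exact: ideal_divz.
by apply: idealM => //; rewrite /ideal_pow /= nrm_varpiz.
Qed.

Lemma coset_sum_translate (V : nmodType) n D (f : K -> V) h :
  coset_stable n D -> coset_inv n D f -> (forall x, D x <-> D (x + h)) ->
  coset_sum n D (fun x => f (x + h)) = coset_sum n D f.
Proof.
move=> sD sf Dh; apply: (@coset_sum_reindex V n n D D (fun x => x + h)) => //.
- by move=> x /Dh.
- move=> y Dy; exists (y - h); first by apply/Dh; rewrite subrK.
  by rewrite subrK subrr; exact: ideal0.
- by move=> x y _ _; rewrite opprD addrACA subrr addr0.
Qed.

(** Representatives of the residue classes correspond to the classes
    themselves, which are the sets counted by [q]. *)
Lemma residue_reps_card : (rep 1 @` B 0 #= `I_q)%card.
Proof.
apply: card_eq_trans (lf_residue lfP).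
have -> : [set [set y | (nrm (y - x) < 1 : Prop)] | x in integers nrm] =
    (fun c => [set y | (nrm (y - c) < 1 : Prop)]) @` (rep 1 @` B 0).
  have cosetE x : [set y | (nrm (y - rep 1 x) < 1 : Prop)] = [set y | (nrm (y - x) < 1 : Prop)].
    have xr := rep_near 1 x; rewrite /ideal_pow /= -nrm_lt1 in xr.
    apply/seteqP; split=> y /= yx.
      have -> : y - x = (y - rep 1 x) + (rep 1 x - x) by rewrite addrA subrK.
      exact: nrmD_lt.
    have -> : y - rep 1 x = (y - x) - (rep 1 x - x) by rewrite opprB addrA subrK.
    exact: nrmB_lt.
  apply/seteqP; split=> [_ [x x1 <-]|_ [_ [x x1 <-] <-]]; last by exists x.
  by exists (rep 1 x) => //; exists x.
rewrite card_eq_sym; apply: inj_card_eq => _ _ /[!inE] -[x x1 <-] [y y1 <-] e.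
have : [set z | (nrm (z - rep 1 x) < 1 : Prop)] (rep 1 x) by rewrite /= subrr (nrm0 nrmP).
rewrite e /= nrm_lt1 => /(rep_eq (n := 1)); by rewrite !rep_idem.
Qed.

Lemma residue_reps_finite : finite_set (rep 1 @` B 0).
Proof. by exists q; exact: residue_reps_card. Qed.

(** By expansion in digits: a coset of [varpi ^ (j + 1)] is given by the
    coset of [varpi ^ j] that contains it and by one residue class. *)
Lemma ideal_reps_finite m n : finite_set (rep n @` B m).
Proof.
have up k : finite_set (rep (m + Posz k) @` B m).
  elim: k => [|k IHk].
    apply: (@sub_finite_set _ _ [set rep m 0]); last exact: finite_set1.
    by rewrite addr0 => _ [x Bx <-]; apply: rep_eq; rewrite subr0.
  apply: (@sub_finite_set _ _ ((fun c => rep (m + Posz k.+1) (c.1 + varpi ^ (m + Posz k) * c.2)) @`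
     ((rep (m + Posz k) @` B m) `*` (rep 1 @` B 0)))); last first.
    by apply: finite_image; apply: finite_setX => //; exact: residue_reps_finite.
  move=> _ [x Bx <-].
  set j := m + Posz k; have jS : m + Posz k.+1 = j + 1 by rewrite /j -addn1 PoszD addrA.
  pose y := (x - rep j x) / varpi ^ j.
  have By : B 0 y.
    apply: ideal_divz; rewrite addr0 -opprB; apply: idealN; exact: rep_near.
  exists (rep j x, rep 1 y); first by split => /=; [exists x|exists y].
  rewrite jS; apply: rep_eq => /=.
  have -> : rep j x + varpi ^ j * rep 1 y - x = varpi ^ j * (rep 1 y - y).
    rewrite mulrBr [X in _ = _ - X]mulrC mulfVK ?varpiz_neq0//; ring.
  apply: idealM; last exact: rep_near.
  by rewrite /ideal_pow /= nrm_varpiz.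
have [mn|nm] := leP m n.
  have : 0 <= n - m by rewrite subr_ge0.
  by case nmE: (n - m) => [k|//] _; rewrite -(subrKC m n) nmE; exact: up.
apply: (@sub_finite_set _ _ [set rep n 0]); last exact: finite_set1.
move=> _ [x Bx <-]; apply: rep_eq; rewrite subr0; apply: ideal_le Bx; exact: ltW.
Qed.

Lemma reps_finite m n D : D `<=` B m -> finite_set (rep n @` D).
Proof.
move=> Dm; apply: sub_finite_set (ideal_reps_finite m n).
exact: image_subset.
Qed.

Lemma coset_sum_cst1 (V : pzSemiRingType) : coset_sum 1 (B 0) (fun=> 1 : V) = q%:R.
Proof.
rewrite /coset_sum fsbig_finite; last exact: residue_reps_finite.
by rewrite big_const_seq count_predT (card_fset_set residue_reps_card) iter_addr_0.
Qed.

Lemma coset_sum0 (V : nmodType) n D (f : K -> V) : coset_stable n D ->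
  (forall x, D x -> f x = 0) -> coset_sum n D f = 0.
Proof. by move=> sD f0; apply: fsbig1 => _ [x Dx <-]; apply: f0; exact: stable_rep. Qed.

Lemma coset_sumD (V : nmodType) n m D (f g : K -> V) : D `<=` B m ->
  coset_sum n D (fun x => f x + g x) = coset_sum n D f + coset_sum n D g.
Proof. by move=> /(reps_finite n) fD; rewrite /coset_sum !fsbig_finite// big_split. Qed.

Lemma coset_sum_exchange (V : nmodType) n n' m m' D D' (f : K -> K -> V) :
  D `<=` B m -> D' `<=` B m' ->
  coset_sum n D (fun x => coset_sum n' D' (f x)) =
  coset_sum n' D' (fun y => coset_sum n D (f^~ y)).
Proof.
move=> /(reps_finite n) fD /(reps_finite n') fD'.
exact: exchange_fsbig.
Qed.

Lemma coset_sumMl (V : idomainType) n D (f : K -> V) a :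
  coset_sum n D (fun x => a * f x) = a * coset_sum n D f.
Proof. by rewrite /coset_sum mulr_fsumr. Qed.

Lemma coset_sumMr (V : idomainType) n D (f : K -> V) a :
  coset_sum n D (fun x => f x * a) = coset_sum n D f * a.
Proof. by rewrite /coset_sum mulr_fsuml. Qed.

Lemma coset_sumU (V : nmodType) n m D D' (f : K -> V) :
  coset_stable n D -> coset_stable n D' -> D `<=` B m -> D' `<=` B m ->
  (forall x, D x -> ~ D' x) ->
  coset_sum n (D `|` D') f = coset_sum n D f + coset_sum n D' f.
Proof.
move=> sD sD' /(reps_finite n) fD /(reps_finite n) fD' DD'.
rewrite /coset_sum image_setU fsbigU// => _ [[x Dx <-] [y D'y yx]] /=.
exfalso; apply: (DD' (rep n x)); first exact: stable_rep.
by rewrite -yx; exact: stable_rep.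
Qed.

Lemma coset_sum_single (V : nmodType) n D (f : K -> V) a :
  coset_stable n D -> coset_inv n D f -> D a ->
  (forall x, D x -> ~ B n (x - a) -> f x = 0) -> coset_sum n D f = f a.
Proof.
move=> sD sf Da f0; rewrite /coset_sum -(@fsbig_widen _ _ _ _ [set rep n a]).
- by rewrite fsbig_set1 (inv_rep sf).
- by move=> _ ->; exists a.
- move=> _ [[x Dx <-] /= xa]; apply: f0; first exact: stable_rep.
  by move=> /rep_eqP h; apply: xa; rewrite -h rep_idem.
Qed.

(** Translation by [h] permutes the cosets in [D] and multiplies the sum by
    [zeta]. *)
Lemma coset_sum_cancel (V : idomainType) n D (f : K -> V) h zeta :
  coset_stable n D -> coset_inv n D f -> (forall x, D x <-> D (x + h)) ->
  (forall x, D x -> f (x + h) = zeta * f x) -> zeta != 1 ->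
  coset_sum n D f = 0.
Proof.
move=> sD sf Dh fh z1.
have := coset_sum_translate sD sf Dh; rewrite (eq_coset_sum sD fh) coset_sumMl => /eqP.
by rewrite -subr_eq0 -{2}[coset_sum _ _ _]mul1r -mulrBl mulf_eq0 subr_eq0 (negbTE z1) => /eqP.
Qed.

End LocalField.

(** * Squares and the quadratic residue symbol *)

Section OddResidueCharacteristic.
Variables (R : realType) (K : fieldType) (nrm : K -> R) (varpi : K) (q : nat).
Hypothesis lfP : local_field nrm varpi q.
Hypothesis nrm2 : nrm 2%:R = 1.
Let nrmP := lf_abs lfP.
Implicit Types (x y z u v w t : K) (D : set K).

Notation Pi := (nrm varpi).
Notation B := (ideal_pow nrm varpi).
Notation crep := (rep nrm varpi).
Notation csum := (coset_sum nrm varpi).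
Notation cinv := (coset_inv nrm varpi).

Lemma two_neq0 : (2%:R : K) != 0.
Proof. by rewrite -(nrm_eq0 nrmP) nrm2 oner_eq0. Qed.

Lemma nrm_half x : nrm (x / 2%:R) = nrm x.
Proof. by rewrite (nrmM nrmP) (nrmV nrmP) nrm2 invr1 mulr1. Qed.

Lemma mem_ideal0 x : B 0 x = (nrm x <= 1) :> Prop.
Proof. by rewrite /ideal_pow /= expr0z. Qed.

Lemma mem_ideal1 x : B 1 x = (nrm x < 1) :> Prop.
Proof. by rewrite (nrm_lt1 lfP). Qed.

(** The root [1 + y] corresponds to a fixed point of
    [y |-> (t - y ^+ 2) / 2], a contraction of the maximal ideal as [2] is a
    unit. *)
Lemma sqrt_one_plus t : nrm t < 1 -> exists y, (1 + y) ^+ 2 = 1 + t.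
Proof.
move=> t1; have P0 := Pi_gt0 lfP; have P1 := Pi_lt1 lfP.
rewrite (nrm_lt1 lfP) in t1.
have P0' := ltW P0; have P1' := ltW P1.
have PX a b : Pi ^+ (a + b) <= Pi ^+ a.
  by rewrite exprD ler_piMr ?exprn_ge0// exprn_ile1.
pose y n := iter n (fun y => (t - y ^+ 2) / 2%:R) 0.
have yS n : y n.+1 = (t - y n ^+ 2) / 2%:R by [].
have yPi n : nrm (y n) <= Pi.
  elim: n => [|n IHn]; first by rewrite (nrm0 nrmP) ltW.
  rewrite yS nrm_half; apply: (nrmB_le nrmP) => //.
  rewrite (nrmX nrmP) expr2; apply: le_trans (ler_pM _ _ IHn IHn) _; rewrite ?nrm_ge0//.
  by rewrite ler_piMl.
have sub2 a b : nrm a <= Pi -> nrm b <= Pi -> nrm (a ^+ 2 - b ^+ 2) <= nrm (a - b) * Pi.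
  move=> ha hb; rewrite subr_sqr (nrmM nrmP) ler_wpM2l ?nrm_ge0//.
  exact: (nrmD_le nrmP).
have yd n : nrm (y n.+1 - y n) <= Pi ^+ n.+1.
  elim: n => [|n IHn]; first by rewrite /y /= subr0; exact: (yPi 1%N).
  rewrite yS [in X in _ - X]yS -mulrBl nrm_half opprB addrC addrA subrK -opprB (nrmN nrmP).
  apply: le_trans (sub2 _ _ (yPi _) (yPi _)) _.
  by rewrite [leRHS]exprSr ler_wpM2r// ltW.
have yk N k : nrm (y (N + k)%N - y N) <= Pi ^+ N.+1.
  elim: k => [|k IHk]; first by rewrite addn0 subrr (nrm0 nrmP) exprn_ge0// ltW.
  rewrite addnS -[_ - _](subrKA (y (N + k)%N)) -opprB opprB; apply: (nrmD_le nrmP) => //.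
  by apply: le_trans (yd _) _; rewrite -addSn PX.
have [l hl] : exists l, cvg_seq nrm y l.
  apply: (lf_complete lfP) => e e0.
  have [N hN] : exists N : nat, Pi ^+ N < e by apply: lt1_expn_lt => //; rewrite P1 ltW.
  exists N => m n mN nN; apply: le_lt_trans hN.
  have -> : y m - y n = (y m - y N) - (y n - y N) by ring.
  apply: le_trans (_ : Pi ^+ N.+1 <= _); last first.
    by rewrite -addn1 PX.
  by apply: (nrmB_le nrmP); [rewrite -(subnKC mN)|rewrite -(subnKC nN)].
have lPi : nrm l <= Pi.
  have [N hN] := hl Pi P0; have -> : l = y N - (y N - l) by ring.
  by apply: (nrmB_le nrmP) => //; rewrite ltW// hN.
have lE : l = (t - l ^+ 2) / 2%:R.
  apply: (cvg_seq_uniq nrmP (u := fun n => y n.+1)).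
    by move=> e e0; have [N hN] := hl e e0; exists N => n nN; rewrite hN// leqW.
  move=> e e0; have [N hN] := hl e e0; exists N => n nN.
  rewrite yS -mulrBl nrm_half.
  have -> : t - y n ^+ 2 - (t - l ^+ 2) = - (y n ^+ 2 - l ^+ 2) by ring.
  rewrite (nrmN nrmP); apply: le_lt_trans (sub2 _ _ (yPi _) lPi) _.
  apply: le_lt_trans (hN n nN); rewrite ler_piMr ?nrm_ge0// ltW//.
exists l; have : 2%:R * l = t - l ^+ 2 by rewrite {1}lE mulrC mulfVK// two_neq0.
move=> h; have -> : t = 2%:R * l + l ^+ 2 by rewrite h subrK.
by ring.
Qed.

Definition is_square x := exists y, x = y ^+ 2.

(** Being a square is a property of the residue class of a unit, which turns
    the quadratic residue symbol into a statement about squares of [K]. *)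
Lemma square_near x y : nrm x = 1 -> nrm (y - x) < 1 -> is_square x -> is_square y.
Proof.
move=> x1 yx [z xz].
have x0 : x != 0 by rewrite -(nrm_eq0 nrmP) x1 oner_eq0.
have [s hs] : exists s, (1 + s) ^+ 2 = 1 + (y - x) / x.
  by apply: sqrt_one_plus; rewrite (nrmM nrmP) (nrmV nrmP) x1 invr1 mulr1.
exists (z * (1 + s)); rewrite exprMn hs -xz; field; exact: x0.
Qed.

Lemma nrm_near x y : nrm (y - x) < 1 -> (nrm y < 1) = (nrm x < 1).
Proof.
move=> yx; apply/idP/idP => h.
  have -> : x = y - (y - x) by ring.
  exact: nrmB_lt.
have -> : y = (y - x) + x by ring.
exact: nrmD_lt.
Qed.

(** The quadratic residue symbol of the residue field, inflated to the ring
    of integers. The value [0] on the maximal ideal makes [1 + qres w] the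
    number of square roots of the residue class of [w] in all cases
    ([count_sqrt]). *)
Definition qres x : int :=
  if nrm x < 1 then 0 else if `[< is_square x >] then 1 else -1.

Lemma qres_inv : cinv 1 (B 0) qres.
Proof.
move=> x y; rewrite mem_ideal0 mem_ideal1 => x1 y1; have xy : nrm (x + y - x) < 1 by rewrite addrAC subrr add0r.
rewrite /qres (nrm_near xy); case: ltP => // x1'.
have nx : nrm x = 1 by apply/eqP; rewrite eq_le x1.
have ny : nrm (x + y) = 1.
  apply/eqP; rewrite eq_le; apply/andP; split.
    by apply: (nrmD_le nrmP) => //; exact: ltW.
  by rewrite leNgt (nrm_near xy) -leNgt.
suff -> : is_square (x + y) = is_square x by [].
apply/propext; split; apply: square_near => //.
by rewrite (nrmB nrmP).
Qed.

Lemma qres_unit x : nrm x = 1 -> qres x = 1 \/ qres x = -1.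
Proof. by rewrite /qres => ->; rewrite ltxx; case: asboolP; [left|right]. Qed.

Lemma qres_square x : nrm x = 1 -> qres (x ^+ 2) = 1.
Proof.
move=> x1; rewrite /qres (nrmX nrmP) x1 expr1n ltxx asboolT//.
by exists x.
Qed.

Lemma qres_sqM u x : nrm u = 1 -> qres (u ^+ 2 * x) = qres x.
Proof.
move=> u1; have u0 : u != 0 by rewrite -(nrm_eq0 nrmP) u1 oner_eq0.
rewrite /qres (nrmM nrmP) (nrmX nrmP) u1 expr1n mul1r.
suff -> : is_square (u ^+ 2 * x) = is_square x by [].
apply/propext; split=> -[y yE].
  by exists (y / u); rewrite expr_div_n -yE mulrAC mulfV ?mul1r// expf_neq0.
by exists (u * y); rewrite exprMn yE.
Qed.

Lemma qres1_is_square x : nrm x = 1 -> qres x = 1 -> is_square x.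
Proof. by rewrite /qres => ->; rewrite ltxx; case: ifPn => // /asboolP. Qed.

Lemma indicator_sum (V : nmodType) (f : K -> V) a : B 0 a -> cinv 1 (B 0) f ->
  csum 1 (B 0) (fun x => if nrm (x - a) < 1 then f x else 0) = f a.
Proof.
move=> a0 sf.
have st : coset_stable nrm varpi 1 (B 0) by exact: (ideal_stable lfP).
rewrite (coset_sum_single lfP (a := a)) ?subrr ?(nrm0 nrmP) ?ltr01//.
- move=> x y x0 y1.
  have -> : (nrm (x + y - a) < 1) = (nrm (x - a) < 1).
    by apply: nrm_near; rewrite mem_ideal1 in y1; rewrite (_ : _ - _ = y)//; ring.
  by rewrite sf.
- by move=> x _; rewrite mem_ideal1 => /negP/negbTE ->.
Qed.

Lemma indicator_cst_sum (V : pzSemiRingType) a : B 0 a ->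
  csum 1 (B 0) (fun x => if nrm (x - a) < 1 then 1 else 0 : V) = 1.
Proof. by move=> a0; rewrite (indicator_sum (f := fun=> 1)). Qed.

(** The class of zero has one square root, zero. A unit square [w0 ^+ 2] has
    the two roots [w0] and [- w0], which are distinct since [2] is a unit. *)
Lemma count_sqrt (V : pzRingType) w : B 0 w ->
  csum 1 (B 0) (fun v => if nrm (v ^+ 2 - w) < 1 then 1 else 0 : V) =
  (1 + qres w)%:~R.
Proof.
have st : coset_stable nrm varpi 1 (B 0) by exact: (ideal_stable lfP).
rewrite mem_ideal0 => w1; rewrite /qres; case: ifP => [w1'|/negbT w1'].
  rewrite addr0 -[RHS](@indicator_cst_sum V 0); last exact: (ideal0 lfP).
  apply: (eq_coset_sum lfP st) => v v1.
  suff -> : (nrm (v ^+ 2 - w) < 1) = (nrm (v - 0) < 1) by [].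
  rewrite subr0 -[RHS](_ : (nrm (v ^+ 2) < 1) = _).
    by apply/esym; apply: nrm_near; rewrite opprB addrC subrK.
  by rewrite (nrmX nrmP) expr_lt1// nrm_ge0.
have nw : nrm w = 1 by apply/eqP; rewrite eq_le w1 leNgt.
case: asboolP => [[w0 ww0]|nsq].
  have nw0 : nrm w0 = 1.
    by apply/eqP; rewrite -(@eqrXn2 _ 2)// ?nrm_ge0// -(nrmX nrmP) -ww0 nw expr1n.
  have B0w : B 0 w0 by rewrite mem_ideal0 nw0.
  have B0w' : B 0 (- w0) by exact: (idealN lfP).
  transitivity (csum 1 (B 0) (fun x => if nrm (x - w0) < 1 then 1 else 0 : V) +
      csum 1 (B 0) (fun x => if nrm (x - - w0) < 1 then 1 else 0 : V)); last first.
    by rewrite !indicator_cst_sum.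
  rewrite -(coset_sumD lfP _ (m := 0))//; apply: (eq_coset_sum lfP st) => v.
  rewrite mem_ideal0 opprK => v1; rewrite ww0 subr_sqr (nrmM nrmP).
  have a1 : nrm (v - w0) <= 1 by apply: (nrmB_le nrmP); rewrite ?nw0.
  have b1 : nrm (v + w0) <= 1 by apply: (nrmD_le nrmP); rewrite ?nw0.
  case: (ltP (nrm (v - w0)) 1) => ha; case: (ltP (nrm (v + w0)) 1) => hb.
  - have : nrm (2%:R * w0) < 1.
      have -> : 2%:R * w0 = (v + w0) - (v - w0) by ring.
      exact: nrmB_lt.
    by rewrite (nrmM nrmP) nrm2 nw0 mulr1 ltxx.
  - have -> : nrm (v + w0) = 1 by apply/eqP; rewrite eq_le b1.
    by rewrite mulr1 ha addr0.
  - have -> : nrm (v - w0) = 1 by apply/eqP; rewrite eq_le a1.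
    by rewrite mul1r hb add0r.
  - have -> : nrm (v - w0) = 1 by apply/eqP; rewrite eq_le a1.
    have -> : nrm (v + w0) = 1 by apply/eqP; rewrite eq_le b1.
    by rewrite mulr1 ltxx addr0.
rewrite addrN; apply: (coset_sum0 lfP st) => v v1; case: ifP => // h; exfalso.
have nv : nrm (v ^+ 2) = 1.
  rewrite mem_ideal0 in v1; apply/eqP; rewrite eq_le (nrmX nrmP) exprn_ile1 ?nrm_ge0//=.
  by rewrite -(nrmX nrmP) leNgt (nrm_near h) -leNgt nw.
by apply: nsq; apply: (square_near nv); [rewrite (nrmB nrmP)|exists v].
Qed.

Lemma ideal0_sqr v : B 0 v -> B 0 (v ^+ 2).
Proof. by rewrite !mem_ideal0 (nrmX nrmP) => v1; rewrite exprn_ile1// nrm_ge0. Qed.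

(** Gathering the terms according to the class [w] of [v ^+ 2]. *)
Lemma coset_sum_sq (V : idomainType) (f : K -> V) : cinv 1 (B 0) f ->
  csum 1 (B 0) (fun v => f (v ^+ 2)) =
  csum 1 (B 0) (fun w => (1 + qres w)%:~R * f w).
Proof.
move=> sf; have st : coset_stable nrm varpi 1 (B 0) by exact: (ideal_stable lfP).
have -> : csum 1 (B 0) (fun v => f (v ^+ 2)) = csum 1 (B 0) (fun v =>
    csum 1 (B 0) (fun w => (if nrm (v ^+ 2 - w) < 1 then 1 else 0) * f w)).
  apply: (eq_coset_sum lfP st) => v v0; rewrite -(indicator_sum (ideal0_sqr v0) sf).
  apply: (eq_coset_sum lfP st) => w _; rewrite (nrmB nrmP).
  by case: ifP; rewrite ?mul1r ?mul0r.
rewrite (coset_sum_exchange lfP _ _ (m := 0) (m' := 0))//.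
apply: (eq_coset_sum lfP st) => w w0.
by rewrite coset_sumMr count_sqrt.
Qed.

(** Both sides of [coset_sum_sq] for the constant function [1] count the
    residue field. *)
Lemma coset_sum_qres : csum 1 (B 0) qres = 0.
Proof.
have := @coset_sum_sq int (fun=> 1) (fun _ _ _ _ => erefl).
under [in RHS]eq_fun do rewrite mulr1 intz.
by rewrite (coset_sumD lfP _ (m := 0))// -[X in X = _]addr0 => /addrI.
Qed.

(** Used by contradiction against sums that are known to vanish. *)
Lemma coset_sum_gt0 m n D (f : K -> int) a : D `<=` B m -> coset_stable nrm varpi n D ->
  cinv n D f -> D a -> (forall x, D x -> 0 <= f x) -> 0 < f a ->
  0 < csum n D f.
Proof.
move=> Dm sD sf Da f0 fa; rewrite /coset_sum (fsbigD1 (crep n a)); last 2 first.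
- exact: (reps_finite lfP n Dm).
- by exists a.
rewrite ltr_pwDl//; first by rewrite (inv_rep lfP sf).
by apply: fsumr_ge0 => _ [[x Dx <-] _]; apply: f0; exact: (stable_rep lfP sD).
Qed.

Lemma unit_mul_sum (V : nmodType) (f : K -> V) u : nrm u = 1 -> cinv 1 (B 0) f ->
  csum 1 (B 0) (fun x => f (u * x)) = csum 1 (B 0) f.
Proof.
move=> u1 sf; have st : coset_stable nrm varpi 1 (B 0) by exact: (ideal_stable lfP).
have u0 : u != 0 by rewrite -(nrm_eq0 nrmP) u1 oner_eq0.
apply: (coset_sum_reindex lfP st sf) => [x|y|x y _ _].
- by rewrite !mem_ideal0 (nrmM nrmP) u1 mul1r.
- move=> y0; exists (y / u); first by move: y0; rewrite !mem_ideal0 (nrmM nrmP) (nrmV nrmP) u1 invr1 mulr1.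
  by rewrite mulrC mulfVK// subrr; exact: (ideal0 lfP).
- by rewrite -mulrBr !mem_ideal1 (nrmM nrmP) u1 mul1r.
Qed.

(** If all units were squares the sum of [qres] would be positive. *)
Lemma nonsquare_unit : exists2 e, nrm e = 1 & qres e = -1.
Proof.
apply: contrapT => hn.
have st : coset_stable nrm varpi 1 (B 0) by exact: (ideal_stable lfP).
have : 0 < csum 1 (B 0) qres.
  apply: (@coset_sum_gt0 0 1 (B 0) qres 1) => //; first exact: qres_inv.
  - by rewrite mem_ideal0 (nrm1 nrmP).
  - move=> x; rewrite mem_ideal0 => x1; have [x1'|x1'] := ltP (nrm x) 1.
      by rewrite /qres x1'.
    have nx : nrm x = 1 by apply/eqP; rewrite eq_le x1.
    by have [->//|h] := qres_unit nx; exfalso; apply: hn; exists x.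
  - by rewrite -(expr1n K 2) qres_square// (nrm1 nrmP).
by rewrite coset_sum_qres ltxx.
Qed.

(** The sum of [qres x + qres (e * x)] vanishes, and each term is
    nonpositive: for [x] a square unit it is [1 + qres e = 0]. If [e * w]
    were a nonresidue the term at [w] would be negative. *)
Lemma qres_nonsquareM e w : nrm e = 1 -> nrm w = 1 -> qres e = -1 -> qres w = -1 ->
  qres (e * w) = 1.
Proof.
move=> e1 w1 qe qw; have st : coset_stable nrm varpi 1 (B 0) by exact: (ideal_stable lfP).
have ew1 : nrm (e * w) = 1 by rewrite (nrmM nrmP) e1 w1 mulr1.
have [//|qew] := qres_unit ew1.
have B0e x : B 0 x -> B 0 (e * x) by rewrite !mem_ideal0 (nrmM nrmP) e1 mul1r.
have qe_inv : cinv 1 (B 0) (fun x => qres (e * x)).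
  move=> x y x0 y1; rewrite mulrDr qres_inv//; first exact: B0e.
  by move: y1; rewrite !mem_ideal1 (nrmM nrmP) e1 mul1r.
have : 0 < csum 1 (B 0) (fun x => (-1) * (qres x + qres (e * x))).
  apply: (@coset_sum_gt0 0 1 (B 0) _ w) => //.
  - by move=> x y x0 y1; rewrite qres_inv// qe_inv.
  - by rewrite mem_ideal0 w1.
  - move=> x; rewrite mem_ideal0 => x1; have [x1'|x1'] := ltP (nrm x) 1.
      by rewrite /qres (nrmM nrmP) e1 mul1r x1'.
    have nx : nrm x = 1 by apply/eqP; rewrite eq_le x1.
    have nex : nrm (e * x) = 1 by rewrite (nrmM nrmP) e1 nx mulr1.
    have [qx|->] := qres_unit nx; last by have [->|->] := qres_unit nex.
    rewrite qx; have [y yE] := qres1_is_square nx qx.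
    have ny : nrm y = 1.
      by apply/eqP; rewrite -(@eqrXn2 _ 2)// ?nrm_ge0// -(nrmX nrmP) -yE nx expr1n.
    by rewrite yE [e * _]mulrC qres_sqM// qe.
  - by rewrite qw qew.
rewrite coset_sumMl (coset_sumD lfP _ (m := 0))// (unit_mul_sum e1 qres_inv).
by rewrite coset_sum_qres addr0 mulr0 ltxx.
Qed.

(** The case of two nonresidues is [qres_nonsquareM]; the others reduce to
    [qres_sqM]. *)
Lemma qresM x y : nrm x <= 1 -> nrm y <= 1 -> qres (x * y) = qres x * qres y.
Proof.
move=> x1 y1; have [x1'|x1'] := ltP (nrm x) 1.
  have xy1 : nrm (x * y) < 1.
    by rewrite (nrmM nrmP); apply: le_lt_trans x1'; rewrite ler_piMr ?nrm_ge0.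
  by rewrite {2}/qres x1' mul0r /qres xy1.
have nx : nrm x = 1 by apply/eqP; rewrite eq_le x1.
have [y1'|y1'] := ltP (nrm y) 1.
  by rewrite {3}/qres y1' mulr0 /qres (nrmM nrmP) nx mul1r y1'.
have ny : nrm y = 1 by apply/eqP; rewrite eq_le y1.
have sqrt_unit u z : nrm u = 1 -> u = z ^+ 2 -> nrm z = 1.
  by move=> u1 uz; apply/eqP; rewrite -(@eqrXn2 _ 2)// ?nrm_ge0// -(nrmX nrmP) -uz u1 expr1n.
have [qx|qx] := qres_unit nx.
  have [z zE] := qres1_is_square nx qx.
  by rewrite qx mul1r zE qres_sqM// (sqrt_unit x).
have [qy|qy] := qres_unit ny.
  have [z zE] := qres1_is_square ny qy.
  by rewrite qy mulr1 zE [x * _]mulrC qres_sqM// (sqrt_unit y).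
by rewrite qx qy qres_nonsquareM.
Qed.

Lemma qres_sqr1 x : nrm x = 1 -> qres x * qres x = 1.
Proof. by move=> /qres_unit [] ->. Qed.

Lemma qresV x : nrm x = 1 -> qres x^-1 = qres x.
Proof.
move=> x1; have x0 : x != 0 by rewrite -(nrm_eq0 nrmP) x1 oner_eq0.
have nV : nrm x^-1 = 1 by rewrite (nrmV nrmP) x1 invr1.
by rewrite -(qres_sqM x nV); congr qres; field.
Qed.

End OddResidueCharacteristic.

(** * Gauss sums of the residue field *)

Section GaussSums.
Variables (R : realType) (K : fieldType) (nrm : K -> R) (varpi : K) (q : nat).
Hypothesis lfP : local_field nrm varpi q.
Hypothesis nrm2 : nrm 2%:R = 1.
Let nrmP := lf_abs lfP.
Variables (V : idomainType) (psi : K -> V).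
Hypothesis psiD : forall x y, psi (x + y) = psi x * psi y.
Hypothesis psi_int : forall x, nrm x <= 1 -> psi x = 1.
Hypothesis psi_nontriv : exists2 x, ideal_pow nrm varpi (-1) x & psi x != 1.
Implicit Types (x y z u v w t : K).

Notation Pi := (nrm varpi).
Notation B := (ideal_pow nrm varpi).
Notation csum := (coset_sum nrm varpi).
Notation cinv := (coset_inv nrm varpi).
Notation cstable := (coset_stable nrm varpi).
Notation qr := (qres nrm).

Let st : cstable 1 (B 0). Proof. exact: (ideal_stable lfP). Qed.

Lemma psi_invariant n t D : B (- n) t -> cinv n D (fun x => psi (t * x)).
Proof.
move=> tn x y _ yn; rewrite mulrDr psiD (psi_int (x := t * y)) ?mulr1//.
by have := idealM lfP tn yn; rewrite addNr (mem_ideal0 nrm varpi).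
Qed.

(** Translation by [x / t], with [psi x != 1], multiplies the sum by [psi x]. *)
Lemma linear_sum0 t : nrm t = Pi ^ (-1) -> csum 1 (B 0) (fun v => psi (t * v)) = 0.
Proof.
move=> nt; have [x xB px] := psi_nontriv.
have t0 : t != 0 by rewrite -(nrm_eq0 nrmP) nt gt_eqF// (Piz_gt0 lfP).
have xt : B 0 (x / t).
  rewrite (mem_ideal0 nrm varpi) (nrmM nrmP) (nrmV nrmP) ler_pdivrMr ?(nrm_gt0 nrmP)//.
  by rewrite mul1r nt.
apply: (coset_sum_cancel lfP (h := x / t) (zeta := psi x)) => //.
- by apply: psi_invariant; rewrite /ideal_pow /= nt.
- move=> v; split=> [v0|v0]; first exact: (idealD lfP).
  by rewrite -(addrK (x / t) v); exact: (idealB lfP).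
- by move=> v _; rewrite mulrDr psiD mulrCA mulfV// mulr1 mulrC.
Qed.

(** The coset sum runs over the residue field, on which [psi (varpi^-1 * _)]
    is a nontrivial additive character. *)
Definition gauss_sum u := csum 1 (B 0) (fun v => psi (varpi^-1 * (u * v ^+ 2))).

Let nrm_varpiV u : nrm u = 1 -> nrm (varpi^-1 * u) = Pi ^ (-1).
Proof. by move=> u1; rewrite (nrmM nrmP) u1 mulr1 (nrmV nrmP). Qed.

(** Counting square roots turns the sum over squares into a sum against
    [1 + qres w], and the part without [qres] cancels. *)
Lemma gauss_sumE u : nrm u = 1 ->
  gauss_sum u = csum 1 (B 0) (fun w => (qr w)%:~R * psi (varpi^-1 * u * w)).
Proof.
move=> u1; have sf : cinv 1 (B 0) (fun w => psi (varpi^-1 * u * w)).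
  by apply: psi_invariant; rewrite /ideal_pow /= nrm_varpiV.
rewrite /gauss_sum; under eq_fun do rewrite mulrA.
rewrite (coset_sum_sq lfP nrm2 sf).
under eq_fun do rewrite rmorphD rmorph1 mulrDl mul1r.
by rewrite (coset_sumD lfP _ (m := 0))// linear_sum0 ?add0r// nrm_varpiV.
Qed.

(** Substitute [w / u] for [w] in the form [gauss_sumE]. *)
Lemma gauss_sum_unit u : nrm u = 1 -> gauss_sum u = (qr u)%:~R * gauss_sum 1.
Proof.
move=> u1; have n1 : nrm 1 = 1 := nrm1 nrmP.
rewrite !gauss_sumE// -coset_sumMl.
have sf : cinv 1 (B 0) (fun w => (qr u)%:~R * ((qr w)%:~R * psi (varpi^-1 * 1 * w))).
  move=> x y x0 y1; rewrite (qres_inv lfP nrm2 x0 y1).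
  by rewrite (@psi_invariant 1 _ (B 0) _ x y x0 y1)// /ideal_pow /= nrm_varpiV.
rewrite -(unit_mul_sum lfP u1 sf); apply: (eq_coset_sum lfP st) => w.
rewrite (mem_ideal0 nrm varpi) => w1; rewrite (qresM lfP nrm2) ?u1// mulr1 rmorphM /= !mulrA.
by rewrite -rmorphM (qres_sqr1 u1) mul1r.
Qed.

(** Opening the product and substituting [w = v + t] leaves a sum over [v] of
    a linear character, which only survives for [t = 0]. *)
Lemma gauss_sum_mulN : gauss_sum 1 * gauss_sum (-1) = q%:R.
Proof.
have nN1 : nrm (-1) = 1 by rewrite (nrmN nrmP) (nrm1 nrmP).
pose g v t := psi (varpi^-1 * ((-1) * t ^+ 2)) * psi (varpi^-1 * (- 2%:R * t) * v).
have nV x : nrm (varpi^-1 * x) = Pi ^ (-1) * nrm x by rewrite (nrmM nrmP) (nrmV nrmP).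
have PM : Pi ^ (-1) * Pi = 1 by rewrite mulVf// gt_eqF// (Pi_gt0 lfP).
have PV0 : 0 < Pi ^ (-1) by rewrite (Piz_gt0 lfP).
have sq_inv : cinv 1 (B 0) (fun t => psi (varpi^-1 * ((-1) * t ^+ 2))).
  move=> t y; rewrite (mem_ideal0 nrm varpi) => t1 y1.
  have -> : varpi^-1 * (-1 * (t + y) ^+ 2) =
     varpi^-1 * (-1 * t ^+ 2) + varpi^-1 * (- (2%:R * t + y) * y) by ring.
  rewrite psiD (psi_int (x := _ * (_ * y))) ?mulr1//.
  have yP : nrm y <= Pi := y1.
  have h : nrm (2%:R * t + y) <= 1.
    apply: (nrmD_le nrmP); first by rewrite (nrmM nrmP) nrm2 mul1r.
    exact: le_trans yP (ltW (Pi_lt1 lfP)).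
  rewrite nV (nrmM nrmP) (nrmN nrmP) -PM ler_wpM2l ?(ltW PV0)// -[leRHS]mul1r.
  by rewrite ler_pM ?nrm_ge0.
have -> : gauss_sum 1 * gauss_sum (-1) =
    csum 1 (B 0) (fun v => csum 1 (B 0) (g v)).
  rewrite /gauss_sum -coset_sumMr; apply: (eq_coset_sum lfP st) => v v0.
  rewrite -(@coset_sum_translate _ _ _ _ _ lfP _ 1 (B 0) _ v st sq_inv); last first.
    move=> x; split=> x0; first exact: (idealD lfP).
    by rewrite -(addrK v x); exact: (idealB lfP).
  rewrite -coset_sumMl; apply: (eq_coset_sum lfP st) => t t0.
  by rewrite /g -!psiD; congr psi; ring.
rewrite (coset_sum_exchange lfP _ _ (m := 0) (m' := 0))//.
have inner t : B 0 t -> csum 1 (B 0) (fun v => g v t) =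
   if nrm (t - 0) < 1 then q%:R else 0.
  rewrite (mem_ideal0 nrm varpi) subr0 => t1.
  rewrite /g coset_sumMl; case: ltP => t1'.
    rewrite (nrm_lt1 lfP) in t1'.
    rewrite psi_int; last first.
      rewrite nV (nrmM nrmP) nN1 mul1r (nrmX nrmP) expr2 -PM ler_wpM2l ?(ltW PV0)//.
      by rewrite -[leRHS]mulr1 ler_pM ?nrm_ge0.
    rewrite mul1r -(coset_sum_cst1 lfP V); apply: (eq_coset_sum lfP st) => v.
    rewrite (mem_ideal0 nrm varpi) => v1; rewrite psi_int// (nrmM nrmP) nV (nrmM nrmP) (nrmN nrmP) nrm2 mul1r.
    rewrite -PM -mulrA ler_wpM2l ?(ltW PV0)//.
    by rewrite -[leRHS]mulr1 ler_pM ?nrm_ge0.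
  have nt : nrm t = 1 by apply/eqP; rewrite eq_le t1.
  by rewrite linear_sum0 ?mulr0// nV (nrmM nrmP) (nrmN nrmP) nrm2 nt !mulr1.
rewrite (eq_coset_sum lfP st inner).
by rewrite (@indicator_sum _ _ _ _ _ lfP _ (fun=> q%:R) 0)//; exact: (ideal0 lfP).
Qed.

(** By [gauss_sum_unit] the second factor in [gauss_sum_mulN] is the first
    one up to the sign [qres (-1)]. *)
Lemma gauss_sum_sq : gauss_sum 1 ^+ 2 = (qr (-1))%:~R * q%:R.
Proof.
have nN1 : nrm (-1) = 1 by rewrite (nrmN nrmP) (nrm1 nrmP).
have hl : (qr (-1))%:~R * (qr (-1))%:~R = 1 :> V by rewrite -rmorphM (qres_sqr1 nN1).
rewrite -gauss_sum_mulN (gauss_sum_unit nN1); set l := (_%:~R) in hl *.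
by transitivity (l * l * gauss_sum 1 ^+ 2); [rewrite hl mul1r|ring].
Qed.

End GaussSums.

(** * Hilbert symbols and square classes *)

Section HilbertSymbolGeneral.
Variables (R : realType) (K : fieldType).
Implicit Types (a b c x y z : K).

Lemma hilbert_congr a b a' b' :
  ((exists x y z : K, [|| x != 0, y != 0 | z != 0] /\
     z ^+ 2 = a * x ^+ 2 + b * y ^+ 2) <->
   (exists x y z : K, [|| x != 0, y != 0 | z != 0] /\
     z ^+ 2 = a' * x ^+ 2 + b' * y ^+ 2)) -> hilbert R a b = hilbert R a' b'.
Proof. by rewrite /hilbert => /propext ->. Qed.

Lemma hilbert_eq1 a b x y z : [|| x != 0, y != 0 | z != 0] ->
  z ^+ 2 = a * x ^+ 2 + b * y ^+ 2 -> hilbert R a b = 1.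
Proof. by move=> nz e; rewrite /hilbert asboolT//; exists x, y, z. Qed.

Lemma hilbertC a b : hilbert R a b = hilbert R b a.
Proof.
by apply: hilbert_congr; split=> -[x [y [z [nz e]]]]; exists y, x, z;
  (split; [rewrite orbCA|rewrite addrC]).
Qed.

Lemma hilbert_sqr a b c : c != 0 -> hilbert R a (b * c ^+ 2) = hilbert R a b.
Proof.
move=> c0; apply: hilbert_congr; split=> -[x [y [z [nz e]]]].
  exists x, (c * y), z; split; first by rewrite mulf_eq0 (negbTE c0).
  by rewrite e; ring.
exists x, (y / c), z; split; first by rewrite mulf_eq0 invr_eq0 (negbTE c0) orbF.
by rewrite e; field.
Qed.

Lemma hilbert_sql a b c : c != 0 -> hilbert R (a * c ^+ 2) b = hilbert R a b.
Proof. by move=> c0; rewrite hilbertC hilbert_sqr// hilbertC. Qed.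

Lemma hilbert_square a b c : a = c ^+ 2 -> hilbert R a b = 1.
Proof.
move=> ->; apply: (@hilbert_eq1 _ _ 1 0 c); first by rewrite oner_eq0.
by rewrite expr1n mulr1 expr0n mulr0 addr0.
Qed.

(** [- a] is a norm from the extension by a square root of [a]: multiplying
    the equation [z ^+ 2 = a * x ^+ 2 + b * y ^+ 2] by [a] exchanges the
    roles of [x] and [z]. *)
Lemma hilbert_negmul a b : a != 0 -> hilbert R a (- (a * b)) = hilbert R a b.
Proof.
have half a' b' : a' != 0 ->
    (exists x y z : K, [|| x != 0, y != 0 | z != 0] /\
     z ^+ 2 = a' * x ^+ 2 + b' * y ^+ 2) ->
    (exists x y z : K, [|| x != 0, y != 0 | z != 0] /\
     z ^+ 2 = a' * x ^+ 2 + - (a' * b') * y ^+ 2).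
  move=> a0 [x [y [z [nz e]]]]; exists z, y, (a' * x); split.
    by move: nz; rewrite mulf_eq0 (negbTE a0) /= => /or3P[]->; rewrite ?orbT.
  by rewrite e; ring.
move=> a0; apply: hilbert_congr; split; last exact: half.
move=> /(half _ _ a0) [x [y [z [nz e]]]]; exists x, (a * y), z; split.
  by rewrite mulf_eq0 (negbTE a0).
by rewrite e; ring.
Qed.

End HilbertSymbolGeneral.

Section HilbertSymbol.
Variables (R : realType) (K : fieldType) (nrm : K -> R) (varpi : K) (q : nat).
Hypothesis lfP : local_field nrm varpi q.
Hypothesis nrm2 : nrm 2%:R = 1.
Let nrmP := lf_abs lfP.
Implicit Types (a b c x y z u v w t : K) (k n : int).

Notation Pi := (nrm varpi).
Notation B := (ideal_pow nrm varpi).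
Notation csum := (coset_sum nrm varpi).
Notation cinv := (coset_inv nrm varpi).
Notation cstable := (coset_stable nrm varpi).
Notation qr := (qres nrm).
Let st : cstable 1 (B 0). Proof. exact: (ideal_stable lfP). Qed.

Let unit_neq0 u : nrm u = 1 -> u != 0.
Proof. by move=> u1; rewrite -(nrm_eq0 nrmP) u1 oner_eq0. Qed.

Let unitV u : nrm u = 1 -> nrm u^-1 = 1.
Proof. by move=> u1; rewrite (nrmV nrmP) u1 invr1. Qed.

Let unitM u v : nrm u = 1 -> nrm v = 1 -> nrm (u * v) = 1.
Proof. by move=> u1 v1; rewrite (nrmM nrmP) u1 v1 mulr1. Qed.

Let qres_uM u v : nrm u = 1 -> nrm v = 1 -> qr (u * v) = qr u * qr v.
Proof. by move=> u1 v1; rewrite (qresM lfP nrm2) ?u1 ?v1. Qed.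

Lemma qres1_near w : nrm (w - 1) < 1 -> qr w = 1.
Proof.
move=> w1; have h1 := nrm1 nrmP.
have B01 : B 0 1 by rewrite (mem_ideal0 nrm varpi) h1.
have -> : qr w = qr 1.
  rewrite -[w](subrK 1) addrC; apply: (qres_inv lfP nrm2) => //.
  by rewrite (mem_ideal1 lfP).
by rewrite -(expr1n K 2) (qres_square lfP).
Qed.

(** Otherwise [qres (1 - w) + qres w] would be nonnegative for all [w] and
    equal to [1] at [w = 0], against the vanishing of the sum of [qres]. *)
Lemma nonresidue_pair : exists n : K,
  [/\ nrm n = 1, nrm (1 - n) = 1, qr n = -1 & qr (1 - n) = -1].
Proof.
apply: contrapT => hn; have h1 := nrm1 nrmP.
have B01 : B 0 1 by rewrite (mem_ideal0 nrm varpi) h1.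
have inv1 : cinv 1 (B 0) (fun w => qr (1 - w)).
  move=> x y x0 y1; rewrite opprD addrA (qres_inv lfP nrm2)//.
    exact: (idealB lfP).
  exact: (idealN lfP).
have sum1 : csum 1 (B 0) (fun w => qr (1 - w)) = 0.
  transitivity (csum 1 (B 0) qr); last exact: (coset_sum_qres lfP).
  apply: (coset_sum_reindex lfP (phi := fun x => 1 - x) st (qres_inv lfP nrm2)) => [x x0|y y0|x y x0 y0].
  - exact: (idealB lfP).
  - exists (1 - y); first exact: (idealB lfP).
    by rewrite subKr subrr; exact: (ideal0 lfP).
  - have -> : 1 - x - (1 - y) = - (x - y) by ring.
    by split=> /(idealN lfP); rewrite ?opprK.
have : 0 < csum 1 (B 0) (fun w => qr (1 - w) + qr w).
  apply: (@coset_sum_gt0 _ _ _ _ _ lfP 0 1 (B 0) _ 0) => //.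
  - by move=> x y x0 y1; rewrite inv1// (qres_inv lfP nrm2).
  - exact: (ideal0 lfP).
  - move=> w; rewrite (mem_ideal0 nrm varpi) => w1.
    have [w1'|w1'] := ltP (nrm w) 1.
      rewrite qres1_near ?addr_ge0//; last by rewrite addrAC subrr add0r (nrmN nrmP).
      by rewrite /qres w1'.
    have nw : nrm w = 1 by apply/eqP; rewrite eq_le w1.
    have [lt1|] := ltP (nrm (1 - w)) 1.
      by rewrite {1}/qres lt1 add0r qres1_near// (nrmB nrmP).
    move=> ge1; have n1 : nrm (1 - w) = 1.
      by apply/eqP; rewrite eq_le ge1 andbT; apply: (nrmB_le nrmP); rewrite ?h1.
    have [->|q1] := qres_unit n1; first by have [->|->] := qres_unit nw.
    have [->|q2] := qres_unit nw; first by rewrite q1.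
    by exfalso; apply: hn; exists w.
  - by rewrite subr0 qres1_near ?subrr ?(nrm0 nrmP)// /qres (nrm0 nrmP) ltr01.
by rewrite (coset_sumD lfP _ (m := 0))// sum1 (coset_sum_qres lfP nrm2) ltxx.
Qed.

(** If neither entry is a square, then both differ by squares from the
    nonresidues [n] and [1 - n] of [nonresidue_pair], and [1 = n + (1 - n)]
    is the representation sought. *)
Lemma hilbert_unit_unit a b : nrm a = 1 -> nrm b = 1 -> hilbert R a b = 1.
Proof.
move=> a1 b1; have [qa|qa] := qres_unit a1.
  by have [c cE] := qres1_is_square a1 qa; exact: hilbert_square cE.
have [qb|qb] := qres_unit b1.
  by have [c cE] := qres1_is_square b1 qb; rewrite hilbertC; exact: hilbert_square cE.
have [n [n1 n1' qn qn']] := nonresidue_pair.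
have sqdiv u v : nrm u = 1 -> nrm v = 1 -> qr u = -1 -> qr v = -1 -> is_square (u / v).
  move=> u1 v1 qu qv; apply: (qres1_is_square (unitM u1 (unitV v1))).
  by rewrite qres_uM ?unitV// (qresV lfP)// qu qv.
have [x xE] := sqdiv n a n1 a1 qn qa.
have [y yE] := sqdiv (1 - n) b n1' b1 qn' qb.
apply: (@hilbert_eq1 _ _ _ _ x y 1); first by rewrite oner_eq0 !orbT.
rewrite -xE -yE; field; by rewrite !unit_neq0.
Qed.

(** For a nonresidue [a] the form [z ^+ 2 - a * x ^+ 2] only takes values of
    even valuation. *)
Lemma hilbert_unit_odd a b k : nrm a = 1 -> nrm b = Pi ^ (2 * k + 1) ->
  hilbert R a b = (qr a)%:~R.
Proof.
move=> a1 bk; have [qa|qa] := qres_unit a1.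
  by have [c cE] := qres1_is_square a1 qa; rewrite (hilbert_square _ _ cE) qa.
rewrite /hilbert asboolF ?qa// => -[x [y [z [nz e]]]].
have {}e : z ^+ 2 - a * x ^+ 2 = b * y ^+ 2 by rewrite e addrAC subrr add0r.
(* The form is anisotropic modulo [varpi], so no cancellation occurs. *)
have form_norm : nrm (z ^+ 2 - a * x ^+ 2) = (Num.max (nrm z) (nrm x)) ^+ 2.
  have nax : nrm (a * x ^+ 2) = nrm x ^+ 2 by rewrite (nrmM nrmP) a1 mul1r (nrmX nrmP).
  have [zx|xz|zx] := ltgtP (nrm z) (nrm x).
  - have h : nrm (- z ^+ 2) < nrm (a * x ^+ 2).
      by rewrite (nrmN nrmP) nax (nrmX nrmP) ltrXn2r// nrm_ge0.
    by rewrite -opprB (nrmN nrmP) (nrmD_dom nrmP h) nax.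
  - have h : nrm (- (a * x ^+ 2)) < nrm (z ^+ 2).
      by rewrite (nrmN nrmP) nax (nrmX nrmP) ltrXn2r// nrm_ge0.
    by rewrite (nrmD_dom nrmP h) (nrmX nrmP).
  - have [x0|x0] := eqVneq x 0.
      move: zx; rewrite x0 (nrm0 nrmP) => /eqP; rewrite (nrm_eq0 nrmP) => /eqP ->.
      by rewrite expr0n mulr0 subr0 (nrm0 nrmP) expr0n.
    have -> : z ^+ 2 - a * x ^+ 2 = x ^+ 2 * ((z / x) ^+ 2 - a) by field.
    rewrite (nrmM nrmP) (nrmX nrmP) zx.
    suff -> : nrm ((z / x) ^+ 2 - a) = 1 by rewrite mulr1.
    have zx1 : nrm (z / x) = 1.
      by rewrite (nrmM nrmP) (nrmV nrmP) zx mulfV// (nrm_eq0 nrmP).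
    apply/eqP; rewrite eq_le; apply/andP; split.
      by apply: (nrmB_le nrmP); rewrite ?a1// (nrmX nrmP) zx1 expr1n.
    rewrite leNgt; apply/negP => h.
    suff : is_square a by move=> [s sE]; move: qa; rewrite /qres a1 ltxx asboolT//; exists s.
    apply: (@square_near _ _ _ _ _ lfP nrm2 ((z / x) ^+ 2)).
    + by rewrite (nrmX nrmP) zx1 expr1n.
    + by rewrite (nrmB nrmP).
    + by exists (z / x).
have [y0|y0] := eqVneq y 0.
  move: form_norm; rewrite e y0 expr0n mulr0 (nrm0 nrmP) => /esym/eqP.
  rewrite expf_eq0 /= => /eqP mx.
  have x0 : x = 0.
    by apply/eqP; rewrite -(nrm_eq0 nrmP) eq_le nrm_ge0// andbT -mx le_max lexx orbT.
  have z0 : z = 0.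
    by apply/eqP; rewrite -(nrm_eq0 nrmP) eq_le nrm_ge0// andbT -mx le_max lexx.
  by move: nz; rewrite x0 y0 z0 eqxx.
move: form_norm; rewrite e (nrmM nrmP) (nrmX nrmP) bk.
have [j ->] := nrm_val lfP y0.
have [i ->] : exists i : int, Num.max (nrm z) (nrm x) = Pi ^ i.
  have [zx|zx] := leP (nrm z) (nrm x).
    have x0 : x != 0.
      apply/eqP => x0; have z0 : z = 0.
        by apply/eqP; rewrite -(nrm_eq0 nrmP) eq_le nrm_ge0// andbT -(nrm0 nrmP) -x0.
      have /eqP := e; rewrite x0 z0 !expr0n mulr0 subr0 eq_sym mulf_eq0 expf_eq0 (negbTE y0) orbF.
      by rewrite -(nrm_eq0 nrmP) bk gt_eqF// (Piz_gt0 lfP).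
    exact: (nrm_val lfP).
  apply: (nrm_val lfP); rewrite -(nrm_gt0 nrmP); apply: le_lt_trans zx; exact: nrm_ge0.
have P0 : Pi != 0 by rewrite gt_eqF// (Pi_gt0 lfP).
rewrite !expr2 -!expfzDr// => /eqP; rewrite eq_le !(Pi_le lfP) -eq_le => /eqP; lia.
Qed.

Let pi0 : varpi != 0 := lf_varpi_neq0 lfP.

Lemma hilbert_varpiz_even a k u : hilbert R a (varpi ^ (2 * k) * u) = hilbert R a u.
Proof.
have -> : varpi ^ (2 * k) * u = u * (varpi ^ k) ^+ 2.
  by rewrite expr2 -expfzDr // mulrC; congr (_ * _ ^ _); ring.
by rewrite hilbert_sqr// (varpiz_neq0 lfP).
Qed.

Lemma hilbert_varpiz_odd a k u :
  hilbert R a (varpi ^ (2 * k + 1) * u) = hilbert R a (varpi * u).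
Proof.
by rewrite expfzDr // -mulrA hilbert_varpiz_even.
Qed.

Lemma hilbert_unit_varpi e u : nrm e = 1 -> nrm u = 1 ->
  hilbert R e (varpi * u) = (qr e)%:~R.
Proof.
move=> e1 u1; apply: (@hilbert_unit_odd _ _ 0) => //.
by rewrite (nrmM nrmP) u1 mulr1.
Qed.

Lemma hilbert_varpi_unit e u : nrm e = 1 -> nrm u = 1 ->
  hilbert R (varpi * e) u = (qr u)%:~R.
Proof. by move=> e1 u1; rewrite hilbertC hilbert_unit_varpi. Qed.

(** By [hilbert_negmul] the second entry may be replaced by minus the product
    of the two, which is a unit times a square. *)
Lemma hilbert_varpi_varpi e u : nrm e = 1 -> nrm u = 1 ->
  hilbert R (varpi * e) (varpi * u) = (qr (-1) * qr e * qr u)%:~R.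
Proof.
move=> e1 u1; have pe0 : varpi * e != 0 by rewrite mulf_neq0// unit_neq0.
rewrite -hilbert_negmul//.
have -> : - (varpi * e * (varpi * u)) = (-1 * e * u) * varpi ^+ 2 by ring.
have N1 : nrm (-1) = 1 by rewrite (nrmN nrmP) (nrm1 nrmP).
rewrite hilbert_sqr // hilbert_varpi_unit ?unitM//.
by rewrite !qres_uM ?unitM.
Qed.

Definition square_class a : set K := [set a * b ^+ 2 | b in [set b | b != 0]].

Lemma square_class_eqP a b : square_class a = square_class b ->
  exists2 c, c != 0 & b = a * c ^+ 2.
Proof.
move=> e; have : square_class b b by exists 1; rewrite ?expr1n ?mulr1//= oner_eq0.
by rewrite -e => -[c c0 <-]; exists c.
Qed.

Lemma square_class_mul a c : c != 0 -> square_class (a * c ^+ 2) = square_class a.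
Proof.
move=> c0; apply/seteqP; split=> _ [b /= b0 <-].
  by exists (c * b); rewrite ?exprMn ?mulrA//= mulf_neq0.
by exists (b / c); rewrite /= ?mulf_neq0 ?invr_eq0//; field.
Qed.

Variable e : K.
Hypotheses (e1 : nrm e = 1) (qe : qr e = -1).

(** The quotient of two nonresidues is a square. *)
Lemma unit_square_class u : nrm u = 1 -> exists2 c, c != 0 & u = c ^+ 2 \/ u = e * c ^+ 2.
Proof.
move=> u1; have [qu|qu] := qres_unit u1.
  have [c uE] := qres1_is_square u1 qu; exists c; last by left.
  by apply: contraTneq (unit_neq0 u1) => c0; rewrite uE c0 expr0n eqxx.
have [c cE] : is_square (u / e).
  by apply: qres1_is_square (unitM u1 (unitV e1)) _; rewrite qres_uM ?unitV// (qresV lfP)// qu qe.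
exists c.
  apply: contraTneq (unit_neq0 (unitM u1 (unitV e1))) => c0; by rewrite cE c0 expr0n eqxx.
by right; rewrite -cE mulrC mulfVK// unit_neq0.
Qed.

(** The parity of the valuation and the residue symbol of the angular
    component determine the class. *)
Lemma square_classesE : square_classes K =
  [set square_class 1; square_class e; square_class varpi; square_class (varpi * e)].
Proof.
have e0 := unit_neq0 e1.
apply/seteqP; split=> [_ [a /= a0 <-]|].
  have [n an] := nrm_val lfP a0.
  have [k nk] : exists k, n = 2 * k \/ n = 2 * k + 1.
    by exists (n %/ 2)%Z; lia.
  have u1 : nrm (a / varpi ^ n) = 1.
    rewrite (nrmM nrmP) (nrmV nrmP) (nrm_varpiz lfP) an mulfV// gt_eqF//.
    exact: (Piz_gt0 lfP).
  have aE : a = varpi ^ n * (a / varpi ^ n) by rewrite mulrC mulfVK// (varpiz_neq0 lfP).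
  have [c c0 hc] := unit_square_class u1.
  have ck0 : varpi ^ k * c != 0 by rewrite mulf_neq0// (varpiz_neq0 lfP).
  have sqk : varpi ^ (2 * k) = (varpi ^ k) ^+ 2.
    by rewrite expr2 -expfzDr//; congr (_ ^ _); ring.
  rewrite -/(square_class a) aE; case: nk => nk; subst n; case: hc => ->.
  - left; left; left; rewrite sqk -(square_class_mul 1 ck0); congr square_class; ring.
  - left; left; right; rewrite sqk -(square_class_mul e ck0); congr square_class; ring.
  - left; right; rewrite expfzDr// sqk -(square_class_mul varpi ck0) expr1z; congr square_class; ring.
  - right; rewrite expfzDr// sqk -(square_class_mul (varpi * e) ck0) expr1z; congr square_class; ring.
by move=> A [[[->|->]|->]|->];
  [exists 1|exists e|exists varpi|exists (varpi * e)]; rewrite //= ?oner_eq0 ?mulf_neq0.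
Qed.

Lemma odd_val_neq_square_unit c u v : nrm u = 1 -> nrm v = 1 -> varpi * u != v * c ^+ 2.
Proof.
move=> u1 v1; apply/eqP => h.
have c0 : c != 0.
  apply: contra_eq_neq h => ->; by rewrite expr0n mulr0 mulf_neq0// unit_neq0.
have [i ci] := nrm_val lfP c0.
have := congr1 nrm h.
rewrite (nrmM nrmP varpi) (nrmM nrmP v) (nrmX nrmP) u1 v1 mul1r mulr1 ci.
have P0 : Pi != 0 by rewrite gt_eqF// (Pi_gt0 lfP).
rewrite -{1}[Pi]expr1z expr2 -expfzDr// => /eqP; rewrite eq_le !(Pi_le lfP) -eq_le => /eqP; lia.
Qed.

Lemma nonsquare_e c : e != c ^+ 2.
Proof.
apply/eqP => h; move: qe; rewrite /qres e1 ltxx asboolT//; by exists c.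
Qed.

(** The four classes are distinct: the parity of the valuation separates the
    last two from the first two, and [e] is not a square. *)
Lemma prod_square_classes (V : comPzSemiRingType) (G : K -> V) :
  (forall a c, c != 0 -> G (a * c ^+ 2) = G a) ->
  \big[*%R/1]_(A \in square_classes K) G (xget 0 A) =
  G 1 * G e * (G varpi * G (varpi * e)).
Proof.
move=> GP; have n1 := nrm1 nrmP; have e0 := unit_neq0 e1.
have Gcl a : G (xget 0 (square_class a)) = G a.
  case: xgetP => [_ _ [c c0 <-]|/(_ a)]; first exact: GP.
  by case; exists 1; rewrite ?expr1n ?mulr1//= oner_eq0.
have cl1e : square_class 1 <> square_class e.
  by move=> /square_class_eqP [c _ /eqP]; rewrite mul1r (negbTE (nonsquare_e c)).
have clv u v : nrm u = 1 -> nrm v = 1 -> square_class v <> square_class (varpi * u).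
  move=> u1 v1 /square_class_eqP [c _ /eqP].
  by rewrite (negbTE (odd_val_neq_square_unit c u1 v1)).
have clve : square_class varpi <> square_class (varpi * e).
  move=> /square_class_eqP [c _ /(mulfI pi0) /eqP].
  by rewrite (negbTE (nonsquare_e c)).
have cl1v := clv 1 1 n1 n1; have clev := clv 1 e n1 e1.
rewrite !mulr1 in cl1v clev.
have cl1ve := clv e 1 e1 n1; have cleve := clv e e e1 e1.
rewrite square_classesE.
rewrite !fsbigU ?finite_setU; try by (repeat split; exact: finite_set1).
- by rewrite !fsbig_set1 !Gcl mulrA.
- by move=> A [-> h]; case: cl1e.
- by move=> A [[->|->] h]; [case: cl1v|case: clev].
- by move=> A [[[->|->]|->] h]; [case: cl1ve|case: cleve|case: clve].
Qed.

End HilbertSymbol.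

(** * Haar measure and integrals of locally constant functions *)

Section LocalCompactness.
Variables (R : realType) (K : fieldType) (nrm : K -> R) (varpi : K) (q : nat).
Hypothesis lfP : local_field nrm varpi q.
Let nrmP := lf_abs lfP.
Implicit Types (x y z : K) (D : set K).

Notation Pi := (nrm varpi).
Notation B := (ideal_pow nrm varpi).

Lemma nbhs_valuedP (x : valued nrm) (P : set (valued nrm)) :
  nbhs x P <-> exists2 e : R, 0 < e & forall y : K, nrm (y - x) < e -> P y.
Proof.
split.
  rewrite nbhsE => -[U [oU Ux] UP].
  by have [e e0 eU] := oU x Ux; exists e => // y /eU /UP.
move=> [e e0 eP]; rewrite nbhsE; exists [set y : valued nrm | nrm (y - x) < e] => //.
split; last by rewrite /= subrr (nrm0 nrmP).
move=> y /= ye; exists e => // z ze.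
have -> : z - x = (z - y) + (y - x) by rewrite addrA subrK.
exact: nrmD_lt.
Qed.

Lemma stable_open n D : coset_stable nrm varpi n D -> open (D : set (valued nrm)).
Proof.
move=> sD; rewrite openE => x Dx; apply/nbhs_valuedP.
exists (Pi ^ n); first exact: (Piz_gt0 lfP).
by move=> y yx; apply: (stable_near sD Dx); exact: ltW.
Qed.

Lemma ultra_finite_union (T : Type) (G : set_system T) (I : Type) (s : seq I)
    (A : I -> set T) : UltraFilter G -> G (\big[setU/set0]_(i <- s) A i) ->
  exists i, G (A i).
Proof.
move=> UG; elim: s => [|i s IHs].
  by rewrite big_nil => G0; exfalso; exact: (filter_not_empty G G0).
rewrite big_cons => GU; have [GA|GA] := in_ultra_setVsetC (A i) UG; first by exists i.
apply: IHs; apply: filterS (filterI GU GA) => x [[|//]].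
by move=> /[swap] /[apply].
Qed.

Lemma coset_mem n c x : [set c + y | y in B n] x <-> B n (x - c).
Proof.
split=> [[y yn <-]|xc]; first by rewrite addrAC subrr add0r.
by exists (x - c); rewrite ?subrKC.
Qed.

(** A bounded set stable under an ideal is a finite union of its cosets; this
    is what reduces topology and measure to finite sums. *)
Lemma stable_coset_union n m D : D `<=` B m -> coset_stable nrm varpi n D ->
  D = \big[setU/set0]_(c <- finmap.enum_fset (fset_set (rep nrm varpi n @` D)))
        [set c + y | y in B n].
Proof.
move=> Dm sD; rewrite -bigcup_seq; apply/seteqP; split=> x.
  move=> Dx; exists (rep nrm varpi n x).
    rewrite /= in_fset_set; last exact: (reps_finite lfP n Dm).
    by rewrite inE; exists x.
  by apply/coset_mem; rewrite -opprB; apply: (idealN lfP); exact: (rep_near lfP).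
move=> [c]; rewrite /= in_fset_set; last exact: (reps_finite lfP n Dm).
rewrite inE => -[y Dy <-] /coset_mem xc.
exact: (stable_near sD (stable_rep lfP sD Dy) xc).
Qed.

(** An ultrafilter on a ball selects one coset at each level; these cosets
    shrink to a point by completeness. *)
Lemma ideal_compact n : compact (B n : set (valued nrm)).
Proof.
rewrite compact_ultra /= => G UG GB.
have pick (k : nat) : exists c : K, G [set c + y | y in B k%:Z].
  have [nk|kn] := leP n k%:Z.
    have sB := ideal_stable lfP nk.
    have := GB; rewrite {1}(stable_coset_union (fun x h => h) sB).
    exact: ultra_finite_union.
  exists 0; apply: filterS GB => x xB; apply/coset_mem; rewrite subr0.
  by apply: (ideal_le lfP) xB; exact: ltW.
have [c hc] := choice pick.
have near_c k j : (k <= j)%N -> B k%:Z (c j - c k).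
  move=> kj; have [x [/coset_mem xk /coset_mem xj]] := filter_ex (filterI (hc k) (hc j)).
  have -> : c j - c k = (x - c k) - (x - c j) by ring.
  by apply: (idealB lfP) => //; apply: (ideal_le lfP) xj.
have ccauchy : cauchy_seq nrm c.
  move=> e e0; have [N hN] : exists N : nat, Pi ^+ N < e.
    by apply: lt1_expn_lt => //; rewrite (Pi_lt1 lfP) ltW// (Pi_gt0 lfP).
  exists N => i j iN jN; apply: le_lt_trans hN.
  have -> : c i - c j = (c i - c N) - (c j - c N) by ring.
  by apply: (idealB lfP (n := N%:Z)); exact: near_c.
have [l hl] := lf_complete lfP ccauchy.
have lc k : B k%:Z (l - c k).
  have [N hN] := hl (Pi ^ k%:Z) (Piz_gt0 lfP _).
  have -> : l - c k = (c (maxn N k) - c k) - (c (maxn N k) - l) by ring.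
  apply: (idealB lfP); first by apply: near_c; exact: leq_maxr.
  by apply: ltW; apply: hN; exact: leq_maxl.
exists l; split.
  have [k nk] : exists k : nat, n <= k%:Z by exists `|n|%N; lia.
  have [x [xB /coset_mem xk]] := filter_ex (filterI GB (hc k)).
  have -> : l = x + ((l - c k) - (x - c k)) by ring.
  apply: (idealD lfP) => //; apply: (ideal_le lfP) nk _.
  by apply: (idealB lfP).
move=> P /nbhs_valuedP [e e0 eP].
have [k hk] : exists k : nat, Pi ^+ k < e.
  by apply: lt1_expn_lt => //; rewrite (Pi_lt1 lfP) ltW// (Pi_gt0 lfP).
apply: filterS (hc k) => x /coset_mem xk; apply: eP.
apply: le_lt_trans hk; have -> : x - l = (x - c k) - (l - c k) by ring.
by apply: (idealB lfP (n := k%:Z)).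
Qed.

End LocalCompactness.

Section HaarIntegral.
Variables (R : realType) (K : fieldType) (nrm : K -> R) (varpi : K) (q : nat).
Hypothesis lfP : local_field nrm varpi q.
Variable mu : {measure set (borel nrm) -> \bar R}.
Hypothesis haar : is_haar mu.
Implicit Types (x y z : K) (D : set K).

Notation Pi := (nrm varpi).
Notation B := (ideal_pow nrm varpi).
Notation csum := (coset_sum nrm varpi).
Notation cinv := (coset_inv nrm varpi).
Notation cstable := (coset_stable nrm varpi).

Lemma stable_measurable n D : cstable n D -> measurable (D : set (borel nrm)).
Proof. by move=> /(stable_open lfP) oD; apply: sub_sigma_algebra. Qed.

Lemma ideal_measurable n : measurable (B n : set (borel nrm)).
Proof. by apply: (@stable_measurable n); exact: (ideal_stable lfP). Qed.

(** Balls are compact, so their measure is finite ([mu_ideal]). *)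
Definition vol n : R := fine (mu (B n)).

Lemma mu_ideal n : mu (B n) = (vol n)%:E.
Proof.
rewrite /vol fineK// ge0_fin_numE//; case: haar => _ + _; apply.
exact: (ideal_compact lfP).
Qed.

Lemma vol_gt0 n : 0 < vol n.
Proof.
rewrite -lte_fin -mu_ideal; case: haar => _ _; apply.
  by apply: (@stable_open _ _ _ _ _ lfP n); exact: (ideal_stable lfP).
by exists 0; exact: (ideal0 lfP).
Qed.

Lemma coset_stable_coset n c : cstable n [set c + y | y in B n].
Proof.
move=> x y /coset_mem xc yn; apply/coset_mem.
by rewrite addrAC; apply: (idealD lfP).
Qed.

Lemma mu_coset n c : mu [set c + y | y in B n] = (vol n)%:E.
Proof. by rewrite -mu_ideal; case: haar => h _ _; rewrite h//; exact: ideal_measurable. Qed.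

Lemma inv_measurable_fun n D (f : K -> R) : cstable n D -> cinv n D f ->
  measurable_fun (D : set (borel nrm)) (f : borel nrm -> R).
Proof.
move=> sD sf _ Y _; apply: (@stable_measurable n) => x y [Dx Yx] yn; split.
  exact: sD.
by rewrite /= sf.
Qed.

Lemma mu_stable_fin n m D : cstable n D -> D `<=` B m -> (mu D < +oo)%E.
Proof.
move=> sD Dm; apply: (@le_lt_trans _ _ (mu (B m))); last by rewrite mu_ideal ltry.
by apply: le_measure; rewrite ?inE//; [exact: (stable_measurable sD)|exact: ideal_measurable].
Qed.

Lemma inv_integrable n m D (f : K -> R) : cstable n D -> D `<=` B m ->
  cinv n D f -> mu.-integrable (D : set (borel nrm)) (fun x : borel nrm => (f x)%:E).
Proof.
move=> sD Dm sf; apply: measurable_bounded_integrable.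
- exact: (stable_measurable sD).
- exact: mu_stable_fin sD Dm.
- exact: inv_measurable_fun sD sf.
have fD := reps_finite lfP n Dm.
exists (\sum_(c <- finmap.enum_fset (fset_set (rep nrm varpi n @` D))) `|f c|).
split; first exact: num_real.
move=> M ltM x /= Dx; apply: le_trans (ltW ltM).
rewrite -(inv_rep lfP sf Dx) (big_rem (rep nrm varpi n x)) /=; last first.
  by rewrite in_fset_set// inE; exists x.
by rewrite lerDl sumr_ge0.
Qed.

(** [D] is a finite disjoint union of translates of the ideal, which all have
    measure [vol n]. *)
Lemma Rintegral_coset_sum n m D (f : K -> R) : cstable n D -> D `<=` B m ->
  cinv n D f ->
  (\int[mu]_(x in (D : set (borel nrm))) f x)%R = vol n * csum n D f.
Proof.
move=> sD Dm sf; have fD := reps_finite lfP n Dm.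
rewrite /Rintegral /coset_sum fsbig_finite//=.
set s := finmap.enum_fset _.
have DE : D = \big[setU/set0]_(c <- s) [set c + y | y in B n] := stable_coset_union lfP Dm sD.
rewrite {1}DE integral_bigsetU_EFin.
- rewrite (eq_big_seq (fun c => ((vol n) * f c)%:E)).
    by rewrite sumEFin /= mulr_sumr.
  move=> c; rewrite /s in_fset_set// inE => -[x Dx cx].
  have Dc : D c by rewrite -cx; exact: (stable_rep lfP sD).
  rewrite (eq_integral (cst (f c)%:E)); last first.
    move=> y; rewrite inE => /coset_mem yc /=; congr EFin.
    exact: (inv_near sf Dc).
  rewrite integral_cst; last exact: stable_measurable (@coset_stable_coset n c).
  by rewrite mu_coset -EFinM mulrC.
- by move=> c; exact: stable_measurable (@coset_stable_coset n c).
- exact: finmap.fset_uniq.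
- move=> c d; rewrite /s /= !in_fset_set// !inE => -[x Dx cx] [y Dy dy].
  move=> [z [/coset_mem zc /coset_mem zd]].
  rewrite -cx -dy -(rep_idem lfP n x) -(rep_idem lfP n y) cx dy.
  apply: (rep_eq lfP); have -> : c - d = (z - d) - (z - c) by ring.
  exact: (idealB lfP).
- by rewrite -DE; apply/measurable_EFinP; exact: inv_measurable_fun sD sf.
Qed.

Lemma coset_sum_Re n m D (f : K -> R[i]) : D `<=` B m ->
  complex.Re (csum n D f) = csum n D (fun x => complex.Re (f x)).
Proof. by move=> Dm; rewrite /coset_sum !fsbig_finite ?raddf_sum//; exact: (reps_finite lfP n Dm). Qed.

Lemma coset_sum_Im n m D (f : K -> R[i]) : D `<=` B m ->
  complex.Im (csum n D f) = csum n D (fun x => complex.Im (f x)).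
Proof. by move=> Dm; rewrite /coset_sum !fsbig_finite ?raddf_sum//; exact: (reps_finite lfP n Dm). Qed.

Lemma cintegral_coset_sum n m D (f : K -> R[i]) : cstable n D -> D `<=` B m ->
  cinv n D f -> cintegral mu D f = (vol n)%:C%C * csum n D f.
Proof.
move=> sD Dm sf; rewrite /cintegral.
rewrite (Rintegral_coset_sum sD Dm); last by move=> x y Dx yn; rewrite sf.
rewrite (Rintegral_coset_sum sD Dm); last by move=> x y Dx yn; rewrite sf.
rewrite -(coset_sum_Re n f Dm) -(coset_sum_Im n f Dm).
by case: (csum n D f) => a b /=; simpc.
Qed.

(** Both sides integrate [1] over the ideal, which is a union of [q]
    translates of the next one. *)
Lemma volS n : vol n = q%:R * vol (n + 1).
Proof.
have st1 : cstable (n + 1) (B n) by apply: (ideal_stable lfP); rewrite lerDl.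
have := @Rintegral_coset_sum (n + 1) n (B n) (fun=> 1) st1 (fun x h => h) (fun _ _ _ _ => erefl).
rewrite Rintegral_cst; last exact: ideal_measurable.
rewrite mul1r -/(vol n) => ->; rewrite mulrC; congr (_ * _).
rewrite -(coset_sum_cst1 lfP R).
have st : cstable 1 (B 0) by exact: (ideal_stable lfP).
rewrite -(coset_sum_scale lfP (D' := B n) (f := fun=> 1) st)// => x.
by rewrite -{1}[n]addr0; exact: (ideal_scale lfP).
Qed.

Lemma volE n : vol n = Pi ^ n * vol 0.
Proof.
have step m : vol (m + 1) = Pi * vol m.
  by rewrite (volS m) (lf_varpi lfP) mulrA mulVf ?mul1r// (q_neq0 lfP).
have P0 : Pi != 0 by rewrite gt_eqF// (Pi_gt0 lfP).
have pos (k : nat) m : vol (m + k%:Z) = Pi ^ k%:Z * vol m.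
  elim: k => [|k IHk]; first by rewrite addr0 mul1r.
  by rewrite -addn1 PoszD addrA step IHk expfzDr// expr1z; ring.
case: n => n; first by rewrite -[Posz n]add0r pos add0r.
have := pos n.+1 (Negz n); rewrite NegzE addNr => ->.
by rewrite mulrA -expfzDr// addNr mul1r.
Qed.

End HaarIntegral.

(** * Self-dual measures *)

Section SelfDualMeasure.
Variables (R : realType) (K : fieldType) (nrm : K -> R) (varpi : K) (q : nat).
Hypothesis lfP : local_field nrm varpi q.
Let nrmP := lf_abs lfP.
Implicit Types (x y z : K) (D : set K).

Notation Pi := (nrm varpi).
Notation B := (ideal_pow nrm varpi).
Notation csum := (coset_sum nrm varpi).
Notation cinv := (coset_inv nrm varpi).
Notation cstable := (coset_stable nrm varpi).

(** The characters [x |-> psi (a * x)] with [psi] normalized have as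
    conductor minus the valuation of [a] ([twist_conductor]); the sums and
    integrals below depend on the character through this exponent. *)
Record conductor (V : nzRingType) (psi : K -> V) (n : int) : Prop := Conductor {
  conductorD : forall x y, psi (x + y) = psi x * psi y;
  conductor_trivial : forall x, B n x -> psi x = 1;
  conductor_nontrivial : exists2 x, B (n - 1) x & psi x != 1
}.

Lemma linear_inv (V : nzRingType) (psi : K -> V) n m k y D : conductor psi n ->
  B k y -> n <= m + k -> cinv m D (fun x => psi (x * y)).
Proof.
move=> cp yk nmk x h _ hm; rewrite mulrDl (conductorD cp) [psi (h * y)](conductor_trivial cp) ?mulr1//.
by apply: (ideal_le lfP nmk); exact: (idealM lfP).
Qed.

(** For [y] outside the dual ideal, [x |-> psi (x * y)] is a nontrivial
    character of the ideal over which the sum is taken. *)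
Lemma linear_cancel (V : idomainType) (psi : K -> V) n m M y : conductor psi n ->
  m <= M -> cinv M (B m) (fun x => psi (x * y)) ->
  ~ B (n - m) y -> csum M (B m) (fun x => psi (x * y)) = 0.
Proof.
move=> cp mM inv yB; have [x xn px] := conductor_nontrivial cp.
have ny : Pi ^ (n - m) < nrm y by rewrite ltNge; apply/negP.
have y0 : y != 0 by rewrite -(nrm_gt0 nrmP); apply: lt_trans ny; exact: (Piz_gt0 lfP).
have st : cstable M (B m) by exact: (ideal_stable lfP).
have hm : B m (x / y).
  have [k yk] := nrm_val lfP y0; move: ny; rewrite yk (Pi_lt lfP) => kn.
  rewrite /ideal_pow /= (nrmM nrmP) (nrmV nrmP) yk ler_pdivrMr ?(Piz_gt0 lfP)//.
  rewrite -expfzDr ?gt_eqF ?(Pi_gt0 lfP)//.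
  by apply: (ideal_le lfP) xn; lia.
apply: (coset_sum_cancel lfP (h := x / y) (zeta := psi x)) => //.
- move=> v; split=> [v0|v0]; first exact: (idealD lfP).
  by rewrite -(addrK (x / y) v); exact: (idealB lfP).
- by move=> v _; rewrite mulrDl (conductorD cp) mulfVK// mulrC.
Qed.

Lemma conductor_locally_cst (psi : K -> R[i]) n : conductor psi n ->
  continuous (psi : valued nrm -> R[i]).
Proof.
move=> cp x; have h : nbhs x [set y | psi y = psi x].
  apply/(nbhs_valuedP lfP); exists (Pi ^ n); first exact: (Piz_gt0 lfP).
  move=> y yx; rewrite /= -(subrKC x y) (conductorD cp).
  by rewrite (conductor_trivial cp (x := y - x)) ?mulr1//; exact: ltW.
exact: (@cvg_near_cst (valued nrm) R[i] (psi x) psi (nbhs x) (nbhs_filter x) h).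
Qed.

Variable mu : {measure set (borel nrm) -> \bar R}.
Hypothesis haar : is_haar mu.
Notation mvol := (vol varpi mu).

Lemma cintegral_setT D (f : K -> R[i]) : (forall x, ~ D x -> f x = 0) ->
  cintegral mu setT f = cintegral mu D f.
Proof.
move=> f0; rewrite /cintegral [in RHS]Rintegral_mkcond [X in _ = _ +i* X]Rintegral_mkcond.
by congr (_ +i* _); apply: eq_Rintegral => x _; rewrite patchE; case: ifPn => //;
  rewrite notin_setE => /f0 ->.
Qed.

(** These multiples of indicators of ideals are the test functions for
    Fourier inversion. *)
Definition ideal_fun m (c : R[i]) : K -> R[i] := fun x => if nrm x <= Pi ^ m then c else 0.

Lemma ideal_fun_schwartz m c : schwartz_bruhat nrm (ideal_fun m c).
Proof.
split.
  move=> x; apply/(nbhs_valuedP lfP); exists (Pi ^ m); first exact: (Piz_gt0 lfP).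
  move=> y yx; rewrite /ideal_fun; suff -> : (nrm y <= Pi ^ m) = (nrm x <= Pi ^ m) by [].
  have yx' : B m (y - x) by exact: ltW.
  apply/idP/idP => h.
    by rewrite -[x](subKr y); exact: (idealB lfP).
  by rewrite -(subrK x y); exact: (idealD lfP).
exists (B m : set (valued nrm)); first exact: (ideal_compact lfP).
by move=> x /negP xB; rewrite /ideal_fun (negbTE xB).
Qed.

Lemma coset_sum_ideal_cst (f : K -> R[i]) m c : (forall x, B m x -> f x = c) ->
  csum m (B m) f = c.
Proof.
move=> fc; have st : cstable m (B m) by exact: (ideal_stable lfP).
rewrite (coset_sum_single lfP (a := 0)) ?fc//; try exact: (ideal0 lfP).
- by move=> x y xm ym; rewrite !fc//; exact: (idealD lfP).
- by move=> x xm; rewrite subr0.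
Qed.

(** On the dual ideal the character is trivial and the integral is a volume;
    elsewhere it cancels by [linear_cancel]. *)
Lemma fourier_ideal_fun (psi : K -> R[i]) n m c : conductor psi n ->
  fourier mu psi (ideal_fun m c) = ideal_fun (n - m) (c * (mvol m)%:C).
Proof.
move=> cp; apply/funext => y; rewrite /fourier (@cintegral_setT (B m)); last first.
  by move=> x /negP xB; rewrite /ideal_fun (negbTE xB) mul0r.
have [k yk] : exists k, B k y.
  have [->|/(nrm_val lfP) [k yk]] := eqVneq y 0; first by exists 0; exact: (ideal0 lfP).
  by exists k; rewrite /ideal_pow /= yk.
have fE x : B m x -> ideal_fun m c x * psi (x * y) = c * psi (x * y).
  by rewrite /ideal_fun /ideal_pow /= => ->.
rewrite {2}/ideal_fun; case: ifPn => yn.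
  have one x : B m x -> ideal_fun m c x * psi (x * y) = c.
    move=> xm; rewrite fE// (conductor_trivial cp) ?mulr1//.
    by have := idealM lfP xm yn; rewrite addrC subrK.
  have st : cstable m (B m) by exact: (ideal_stable lfP).
  rewrite (cintegral_coset_sum lfP haar st (m := m))//.
    by rewrite (coset_sum_ideal_cst one) mulrC.
  by move=> x h xm hm; rewrite !one//; exact: (idealD lfP).
(* A level at which the character of [x] is constant on cosets. *)
pose M := Num.max m (n - k).
have mM : m <= M by rewrite le_max lexx.
have nM : n <= M + k by rewrite -lerBlDr le_max lexx orbT.
have st : cstable M (B m) by exact: (ideal_stable lfP).
have inv := linear_inv (D := B m) cp yk nM.
rewrite (cintegral_coset_sum lfP haar st (m := m))//; last first.
  move=> x h xm hM; rewrite !fE//; first by rewrite inv.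
  by apply: (idealD lfP) => //; exact: (ideal_le lfP) hM.
rewrite (eq_coset_sum lfP st fE) coset_sumMl (linear_cancel cp mM inv) ?mulr0//.
by apply/negP.
Qed.

(** Fourier inversion at [0] for the indicator of the ring of integers reads
    [mvol 0 * mvol n = 1]. *)
Lemma self_dual_vol psi n : conductor psi n -> self_dual_haar psi mu ->
  mvol 0 ^+ 2 = Pi ^ (- n).
Proof.
move=> cp [_ /(_ _ (ideal_fun_schwartz 0 1) 0)].
rewrite (fourier_ideal_fun _ _ cp) (fourier_ideal_fun _ _ cp) subr0 subrr oppr0.
rewrite /ideal_fun (nrm0 nrmP) expr0z ler01 mul1r -rmorphM (volE lfP haar n).
move=> /complexI h; have P0 := Piz_gt0 lfP n.
apply: (mulIf (lt0r_neq0 P0)); rewrite -expfzDr ?gt_eqF ?(Pi_gt0 lfP)//.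
by rewrite addNr expr0z -h; ring.
Qed.

Lemma vol_ge0 m : 0 <= mvol m.
Proof. exact/ltW/(vol_gt0 lfP haar). Qed.

Lemma self_dual_volE psi n m : conductor psi n -> self_dual_haar psi mu ->
  mvol m = Pi ^ m * Num.sqrt (Pi ^ (- n)).
Proof.
move=> cp sd; rewrite (volE lfP haar) -(self_dual_vol cp sd) sqrtr_sqr.
by rewrite ger0_norm// vol_ge0.
Qed.

End SelfDualMeasure.

(** * The Weil index *)

Section QuadraticCharacterSums.
Variables (R : realType) (K : fieldType) (nrm : K -> R) (varpi : K) (q : nat).
Hypothesis lfP : local_field nrm varpi q.
Hypothesis nrm2 : nrm 2%:R = 1.
Let nrmP := lf_abs lfP.
Variable psi : K -> R[i].
Hypothesis cpsi : conductor nrm varpi psi 0.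
Implicit Types (x y z a u : K) (D : set K) (n j k : int).

Notation Pi := (nrm varpi).
Notation B := (ideal_pow nrm varpi).
Notation csum := (coset_sum nrm varpi).
Notation cinv := (coset_inv nrm varpi).
Notation cstable := (coset_stable nrm varpi).

Let P0 : Pi != 0. Proof. by rewrite gt_eqF// (Pi_gt0 lfP). Qed.

Lemma twist_conductor a n : nrm a = Pi ^ n -> conductor nrm varpi (twist psi a) (- n).
Proof.
move=> an; have a0 : a != 0 by rewrite -(nrm_gt0 nrmP) an (Piz_gt0 lfP).
split=> [x y|x xn|]; rewrite /twist.
- by rewrite mulrDr (conductorD cpsi).
- apply: (conductor_trivial cpsi); rewrite -(subrr n).
  by apply: (idealM lfP) => //; rewrite /ideal_pow /= an.
have [x xB px] := conductor_nontrivial cpsi.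
exists (x / a); last by rewrite mulrC mulfVK.
rewrite /ideal_pow /= (nrmM nrmP) (nrmV nrmP) an ler_pdivrMr ?(Piz_gt0 lfP)//.
by rewrite -expfzDr// addrAC addNr.
Qed.

Lemma quad_inv a n j M D : nrm a = Pi ^ n -> D `<=` B j -> j <= M ->
  0 <= n + j + M -> cinv M D (fun x => psi (a * x ^+ 2)).
Proof.
move=> an Dj jM njM x y Dx yM.
have -> : a * (x + y) ^+ 2 = a * x ^+ 2 + a * (2%:R * x + y) * y by ring.
rewrite (conductorD cpsi) [psi (_ * y)](conductor_trivial cpsi) ?mulr1//.
apply: (ideal_le lfP njM); apply: (idealM lfP) => //; apply: (idealM lfP).
  by rewrite /ideal_pow /= an.
apply: (idealD lfP); last exact: (ideal_le lfP) yM.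
by rewrite /ideal_pow /= (nrmM nrmP) nrm2 mul1r; exact: Dj.
Qed.

Lemma coset_sum_cst_neq0 M m : m <= M -> csum M (B m) (fun=> 1 : R[i]) != 0.
Proof.
move=> mM; have fD := ideal_reps_finite lfP m M.
rewrite /coset_sum (fsbigD1 (rep nrm varpi M 0))//; last first.
  by exists 0 => //; exact: (ideal0 lfP).
by rewrite gt_eqF// ltr_pwDl// fsumr_ge0.
Qed.

(** Replacing [x] by [x + y] with [y] in [B k] multiplies [psi (a * x ^+ 2)]
    by [psi (2 * a * x * y)], since [psi (a * y ^+ 2) = 1]. For [x] outside
    [B k'] this is a nontrivial character of [y], so averaging over [y] gives
    zero. *)
Lemma quad_sum_away a n k k' j M : nrm a = Pi ^ n -> n + k + k' = 0 -> k' <= k ->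
  j <= k' -> k <= M -> 0 <= n + j + M ->
  csum M (B j `\` B k') (fun x => psi (a * x ^+ 2)) = 0.
Proof.
move=> an nkk kk jk kM njM; set E := B j `\` B k'.
have Ej : E `<=` B j by move=> x [].
have E_shift y : B k' y -> forall x, E x <-> E (x + y).
  have half y' : B k' y' -> forall x, E x -> E (x + y').
    move=> yk x [xj xk]; split; first by apply: (idealD lfP) => //; exact: (ideal_le lfP) yk.
    by move=> h; apply: xk; rewrite -(addrK y' x); exact: (idealB lfP).
  move=> yk x; split; first exact: half.
  have ykN : B k' (- y) by exact: (idealN lfP).
  by move=> /(half _ ykN); rewrite addrK.
have sE : cstable M E.
  move=> x y Ex yM; have yk : B k' y by apply: (ideal_le lfP) yM; lia.
  exact: (E_shift y yk x).1 Ex.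
have inv : cinv M E (fun x => psi (a * x ^+ 2)).
  by apply: (quad_inv an Ej) => //; lia.
have sB : cstable M (B k) by exact: (ideal_stable lfP).
(* Translation by [y] leaves the sum unchanged. *)
have avg y : B k y -> csum M E (fun x => psi (a * x ^+ 2)) =
    csum M E (fun x => psi (a * x ^+ 2) * psi (y * (2%:R * a * x))).
  move=> yk; have yk' : B k' y by exact: (ideal_le lfP) yk.
  rewrite -(coset_sum_translate lfP sE inv (E_shift y yk')).
  apply: (eq_coset_sum lfP sE) => x _.
  have -> : a * (x + y) ^+ 2 = a * x ^+ 2 + (y * (2%:R * a * x) + a * (y * y)) by ring.
  rewrite !(conductorD cpsi) [psi (a * (y * y))](conductor_trivial cpsi) ?mulr1//.
  apply: (ideal_le lfP (n := n + (k + k))); first lia.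
  apply: (idealM lfP); first by rewrite /ideal_pow /= an.
  exact: (idealM lfP).
apply: (mulfI (coset_sum_cst_neq0 kM)); rewrite mulr0 -coset_sumMr.
rewrite (eq_coset_sum lfP sB (g := fun y =>
  csum M E (fun x => psi (a * x ^+ 2) * psi (y * (2%:R * a * x))))); last first.
  by move=> y yk; rewrite mul1r; exact: avg.
rewrite (coset_sum_exchange lfP _ _ (m := k) (m' := j))//.
apply: (coset_sum0 lfP sE) => x [xj xk]; rewrite coset_sumMl.
have n2a : nrm (2%:R * a * x) = Pi ^ n * nrm x.
  by rewrite !(nrmM nrmP) nrm2 mul1r an.
rewrite (linear_cancel lfP cpsi) ?mulr0//.
  apply: (linear_inv lfP (k := n + j) cpsi); last lia.
  apply: (idealM lfP) => //.
  by rewrite /ideal_pow /= (nrmM nrmP) nrm2 mul1r an.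
rewrite /ideal_pow /= n2a sub0r => h; apply: xk; rewrite /ideal_pow /=.
rewrite -(ler_pM2l (Piz_gt0 lfP n)); apply: le_trans h _.
by rewrite -expfzDr// (Pi_le lfP); lia.
Qed.

Variable mu : {measure set (borel nrm) -> \bar R}.
Hypothesis haar : is_haar mu.
Notation mvol := (vol varpi mu).

(** The integral over a large ball reduces to [B k'], by [quad_sum_away],
    where the integrand is constant modulo [B k]. *)
Lemma quad_integral a n k k' j : nrm a = Pi ^ n -> n + k + k' = 0 -> k' <= k -> j <= k' ->
  cintegral mu (B j) (fun x => psi (a * x ^+ 2)) =
  (mvol k)%:C * csum k (B k') (fun x => psi (a * x ^+ 2)).
Proof.
(* A common level modulo which the integrand is constant on the whole of
   [B j]. *)
move=> an nkk kk jk; pose M := Num.max k (- n - j).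
have kM : k <= M by rewrite le_max lexx.
have njM : 0 <= n + j + M.
  have : - n - j <= M by rewrite le_max lexx orbT.
  lia.
clearbody M.
have stM m : m <= M -> cstable M (B m) by move=> h; exact: (ideal_stable lfP).
have sk : cstable k (B k') by exact: (ideal_stable lfP).
have invj : cinv M (B j) (fun x => psi (a * x ^+ 2)).
  by apply: (quad_inv an (j := j)) => //; lia.
have invk' : cinv M (B k') (fun x => psi (a * x ^+ 2)).
  by apply: (quad_inv an (j := k')) => //; lia.
have invk : cinv k (B k') (fun x => psi (a * x ^+ 2)).
  by apply: (quad_inv an (j := k')) => //; lia.
rewrite -(cintegral_coset_sum lfP haar sk (m := k'))//.
have jM : j <= M by lia.
have k'M : k' <= M by lia.
rewrite (cintegral_coset_sum lfP haar (stM _ jM) (m := j))//.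
rewrite (cintegral_coset_sum lfP haar (stM _ k'M) (m := k'))//; congr (_ * _).
have -> : B j = (B j `\` B k') `|` B k'.
  apply/seteqP; split=> x.
    by move=> xj; have [h|h] := pselect (B k' x); [right|left].
  by move=> [[]//|h]; exact: (ideal_le lfP) h.
rewrite (coset_sumU lfP (m := j)).
- by rewrite (quad_sum_away an nkk) ?add0r.
- move=> x y [xj xk] yM; split; first by apply: (idealD lfP) => //; exact: (ideal_le lfP) yM.
  move=> h; apply: xk; rewrite -(addrK y x); apply: (idealB lfP) => //.
  exact: (ideal_le lfP) yM.
- exact: stM.
- by move=> x [].
- by move=> x; exact: (ideal_le lfP).
- by move=> x [].
Qed.

End QuadraticCharacterSums.

Section WeilIndex.
Variables (R : realType) (K : fieldType) (nrm : K -> R) (varpi : K) (q : nat).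
Hypothesis lfP : local_field nrm varpi q.
Hypothesis nrm2 : nrm 2%:R = 1.
Let nrmP := lf_abs lfP.
Variable dx : (K -> R[i]) -> {measure set (borel nrm) -> \bar R}.
Hypothesis dxP : forall psi' : K -> R[i], additive_character nrm psi' ->
  (exists x, psi' x != 1) -> self_dual_haar psi' (dx psi').
Variable psi : K -> R[i].
Hypothesis psiA : additive_character nrm psi.
Hypothesis psiN : normalized_character nrm varpi psi.
Implicit Types (x y z a u : K) (n j k : int).

Notation Pi := (nrm varpi).
Notation B := (ideal_pow nrm varpi).
Notation csum := (coset_sum nrm varpi).

Let P0 : Pi != 0. Proof. by rewrite gt_eqF// (Pi_gt0 lfP). Qed.

Lemma psi_conductor : conductor nrm varpi psi 0.
Proof.
have [h1 h2] := psiN; split; first by case: psiA.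
  by move=> x; rewrite (mem_ideal0 nrm varpi) => x1; exact: h1.
by [].
Qed.
Let cpsi := psi_conductor.

Lemma twist_self_dual a : a != 0 -> self_dual_haar (twist psi a) (dx (twist psi a)).
Proof.
move=> a0; have [n an] := nrm_val lfP a0.
have ca := twist_conductor lfP cpsi an.
apply: dxP; last by have [x _ px] := conductor_nontrivial ca; exists x.
split; first exact: (conductorD ca).
  by move=> x; case: psiA => _ h _; exact: h.
exact: (conductor_locally_cst lfP ca).
Qed.

Lemma twist_twist a b : twist (twist psi a) b = twist psi (a * b).
Proof. by apply/funext => x; rewrite /twist mulrA. Qed.

(** By [quad_integral] the sequence of integrals in the definition is
    eventually constant. The factor in front is the volume of [B k] for the
    measure self-dual with respect to the twist of [psi] by [2 * a], whose
    conductor is that of the twist by [a] as [2] is a unit. *)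
Lemma weil_index_value a n k k' : nrm a = Pi ^ n -> n + k + k' = 0 -> k' <= k ->
  weil_index varpi dx (twist psi a) =
  (Pi ^ k * Num.sqrt (Pi ^ n))%:C * csum k (B k') (fun x => psi (a * x ^+ 2)).
Proof.
move=> an nkk kk; rewrite /weil_index; apply: (cvg_lim (@norm_hausdorff _ R[i])).
apply: cvg_near_cst; exists `|k'|%N => // r /= kr.
have a0 : a != 0 by rewrite -(nrm_gt0 nrmP) an (Piz_gt0 lfP).
have a20 : a * 2%:R != 0 by rewrite mulf_neq0// (two_neq0 lfP nrm2).
have na2 : nrm (a * 2%:R) = Pi ^ n by rewrite (nrmM nrmP) nrm2 mulr1.
rewrite twist_twist; have sd := twist_self_dual a20.
have ca := twist_conductor lfP cpsi na2.
have jk : - r%:Z <= k' by lia.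
rewrite -[n]opprK -(self_dual_volE lfP sd.1 k ca sd).
exact: (quad_integral lfP nrm2 cpsi sd.1 an nkk kk jk).
Qed.

(** The exponents may be taken equal to [- k], and the integrand is then
    trivial on the remaining ball. *)
Lemma weil_index_even k u : nrm u = 1 ->
  weil_index varpi dx (twist psi (varpi ^ (2 * k) * u)) = 1.
Proof.
move=> u1; have an : nrm (varpi ^ (2 * k) * u) = Pi ^ (2 * k).
  by rewrite (nrmM nrmP) u1 mulr1 (nrm_varpiz lfP).
rewrite (weil_index_value an (k := - k) (k' := - k))//; last by ring.
rewrite (coset_sum_ideal_cst lfP (c := 1)) ?mulr1.
  have -> : Pi ^ (2 * k) = (Pi ^ k) ^+ 2 by rewrite expr2 -expfzDr//; congr (_ ^ _); ring.
  by rewrite sqrtr_sqr ger0_norm ?ltW ?(Piz_gt0 lfP)// -expfzDr// addNr.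
move=> x xk; apply: (conductor_trivial cpsi).
apply: (ideal_le lfP (n := 2 * k + (- k + - k))); first lia.
apply: (idealM lfP); first by rewrite /ideal_pow /= an.
exact: (idealM lfP).
Qed.

(** The exponents differ by one, so that a sum over one residue field
    remains. *)
Lemma weil_index_odd k u : nrm u = 1 ->
  weil_index varpi dx (twist psi (varpi ^ (2 * k + 1) * u)) =
  (Num.sqrt Pi)%:C * gauss_sum nrm varpi psi u.
Proof.
move=> u1; have an : nrm (varpi ^ (2 * k + 1) * u) = Pi ^ (2 * k + 1).
  by rewrite (nrmM nrmP) u1 mulr1 (nrm_varpiz lfP).
rewrite (weil_index_value an (k := - k) (k' := - k - 1)); [|ring|lia].
congr (_%:C * _).
  have -> : Pi ^ (2 * k + 1) = (Pi ^ k) ^+ 2 * Pi.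
    by rewrite expr2 -expfzDr// [LHS]expfzDr// expr1z; congr (_ ^ _ * _); ring.
  rewrite sqrtrM ?sqr_ge0// sqrtr_sqr ger0_norm ?ltW ?(Piz_gt0 lfP)//.
  by rewrite mulrA -expfzDr// addNr mul1r.
have st : coset_stable nrm varpi 1 (B 0) by exact: (ideal_stable lfP).
have kE : - k = (- k - 1) + 1 by ring.
have := @coset_sum_scale _ _ _ _ _ lfP R[i] (- k - 1) 1 (B 0) (B (- k - 1))
  (fun x => psi (varpi ^ (2 * k + 1) * u * x ^+ 2)) st.
rewrite -kE => <-.
- rewrite /gauss_sum; apply: (eq_coset_sum lfP st) => v _; congr psi.
  rewrite exprMn mulrACA.
  have -> : varpi ^ (2 * k + 1) * (varpi ^ (- k - 1)) ^+ 2 = varpi^-1.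
    by rewrite expr2 -!expfzDr ?(lf_varpi_neq0 lfP)// -exprN1; congr (_ ^ _); ring.
  by [].
- apply: (quad_inv lfP nrm2 cpsi an (j := - k - 1)) => //; lia.
- by move=> x; have := ideal_scale lfP (- k - 1) 0 x; rewrite addr0.
Qed.

Lemma weil_index_psi : weil_index varpi dx psi = 1.
Proof.
have := @weil_index_even 0 1 (nrm1 nrmP); rewrite mulr0 expr0z mulr1.
by rewrite (_ : twist psi 1 = psi)//; apply/funext => x; rewrite /twist mul1r.
Qed.

Lemma weil_ratio_even k u : nrm u = 1 ->
  weil_ratio varpi dx psi (varpi ^ (2 * k) * u) = 1.
Proof. by move=> u1; rewrite /weil_ratio weil_index_psi weil_index_even// divr1. Qed.

Lemma weil_ratio_odd k u : nrm u = 1 ->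
  weil_ratio varpi dx psi (varpi ^ (2 * k + 1) * u) =
  (qres nrm u)%:~R * ((Num.sqrt Pi)%:C * gauss_sum nrm varpi psi 1).
Proof.
move=> u1; rewrite /weil_ratio weil_index_psi divr1 weil_index_odd//.
rewrite (gauss_sum_unit lfP nrm2 (conductorD cpsi)) //.
- by rewrite mulrCA.
- by move=> x x1; apply: (conductor_trivial cpsi); rewrite (mem_ideal0 nrm varpi).
- exact: (conductor_nontrivial cpsi).
Qed.

(** The normalized Gauss sum is a fourth root of unity. Its square is also
    the Hilbert symbol of [varpi] and [-1], whence the constant of the
    product formula. *)
Lemma weil_root_sq : ((Num.sqrt Pi)%:C * gauss_sum nrm varpi psi 1) ^+ 2 =
  (qres nrm (-1))%:~R.
Proof.
rewrite exprMn -rmorphXn sqr_sqrtr ?nrm_ge0//.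
rewrite (gauss_sum_sq lfP nrm2 (conductorD cpsi)); last exact: (conductor_nontrivial cpsi).
  rewrite (lf_varpi lfP) mulrCA fmorphV rmorph_nat mulVf ?mulr1//.
  exact: (q_neq0 lfP).
by move=> x x1; apply: (conductor_trivial cpsi); rewrite (mem_ideal0 nrm varpi).
Qed.

End WeilIndex.

(** * Integrals over countable unions *)

Section CountableIntegral.
Variables (d : measure_display) (T : measurableType d) (R : realType).
Variable mu : {measure set T -> \bar R}.
Variables (D : nat -> set T) (g : T -> R) (s : nat -> R) (C t : R).
Hypotheses (mD : forall i, measurable (D i)) (tD : trivIset setT D).
Hypothesis mg : forall i, measurable_fun (D i) g.
Hypothesis gs : forall i x, D i x -> `|g x| <= s i.
Hypothesis s0 : forall i, 0 <= s i.
Hypothesis sC : forall i, ((s i)%:E * mu (D i) <= (C * t ^+ i)%:E)%E.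
Hypotheses (t0 : 0 <= t) (t1 : t < 1).

Lemma bigcup_measurable_fun : measurable_fun (\bigcup_i D i) (EFin \o g).
Proof. by apply/measurable_EFinP/measurable_fun_bigcup. Qed.

Lemma geometric_sum_le n : \sum_(0 <= i < n) t ^+ i <= (1 - t)^-1.
Proof.
rewrite big_mkord -[X in _ <= X]mul1r ler_pdivlMr ?subr_gt0//.
by rewrite mulrC -[1 - t]opprB mulNr -subrX1 opprB gerBl exprn_ge0.
Qed.

(** The supremum on each piece times its measure decays geometrically. *)
Lemma bigcup_integrable : mu.-integrable (\bigcup_i D i) (EFin \o g).
Proof.
apply/integrableP; split; first exact: bigcup_measurable_fun.
rewrite ge0_integral_bigcup//; last first.
  by apply: measurableT_comp; [exact: abse_measurable|exact: bigcup_measurable_fun].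
have C0 : 0 <= C.
  have := sC 0; rewrite expr0 mulr1 -lee_fin; apply: le_trans.
  by rewrite mule_ge0// lee_fin.
have bound i : (\int[mu]_(x in D i) `|(EFin \o g) x| <= (C * t ^+ i)%:E)%E.
  apply: le_trans (sC i); apply: integral_le_bound => //.
  - exact/measurable_EFinP.
  - by rewrite lee_fin.
  - by apply: aeW => x Dx /=; rewrite lee_fin gs.
apply: (@le_lt_trans _ _ (C / (1 - t))%:E); last exact: ltry.
apply: lime_le.
  by apply: is_cvg_nneseries => i _ _; exact: integral_ge0.
apply: nearW => n; apply: (@le_trans _ _ (\sum_(0 <= i < n) (C * t ^+ i)%:E)%E).
  by apply: lee_sum => i _; exact: bound.
by rewrite sumEFin lee_fin -mulr_sumr ler_wpM2l// geometric_sum_le.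
Qed.

Lemma bigcup_Rintegral (b : nat -> R) l :
  (forall i, (\int[mu]_(x in D i) g x)%R = b i) ->
  series b @ \oo --> l -> (\int[mu]_(x in \bigcup_i D i) g x)%R = l.
Proof.
move=> gb bl; rewrite /Rintegral (integral_bigcup tD mD bigcup_integrable).
rewrite (eq_eseriesr (g := fun i => (b i)%:E)); last first.
  move=> i _; rewrite -gb /Rintegral fineK//; apply: integrable_fin_num => //.
  apply: integrableS bigcup_integrable => //; first exact: bigcup_measurable.
  exact: bigcup_sup.
have : (fun n => \sum_(0 <= i < n) (b i)%:E)%E @ \oo --> l%:E.
  under eq_fun do rewrite sumEFin.
  by apply: cvg_EFin; [exact: nearW|exact: bl].
by move=> /cvg_lim -> //.
Qed.

End CountableIntegral.

Section CountableComplexIntegral.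
Variables (R : realType) (K : fieldType) (nrm : K -> R).
Variable mu : {measure set (borel nrm) -> \bar R}.
Variables (D : nat -> set K) (f : K -> R[i]) (s : nat -> R) (C t : R).
Hypotheses (mD : forall i, measurable (D i : set (borel nrm))) (tD : trivIset setT D).
Hypothesis mRe : forall i, measurable_fun (D i : set (borel nrm)) (fun x : borel nrm => complex.Re (f x)).
Hypothesis mIm : forall i, measurable_fun (D i : set (borel nrm)) (fun x : borel nrm => complex.Im (f x)).
Hypothesis fs : forall i x, D i x -> normc (f x) <= s i.
Hypothesis s0 : forall i, 0 <= s i.
Hypothesis sC : forall i, ((s i)%:E * mu (D i) <= (C * t ^+ i)%:E)%E.
Hypotheses (t0 : 0 <= t) (t1 : t < 1).

Lemma bigcup_cintegrable : cintegrable mu (\bigcup_i D i) f.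
Proof.
by split; apply: (bigcup_integrable (s := s) mD tD _ _ s0 sC t0 t1) => // i x Dx;
  apply: le_trans (fs Dx); [exact: Re_le_normc|exact: Im_le_normc].
Qed.

Lemma bigcup_cintegral (b : nat -> R[i]) l :
  (forall i, cintegral mu (D i) f = b i) ->
  series b @ \oo --> l -> cintegral mu (\bigcup_i D i) f = l.
Proof.
move=> fb /cvgC_ReIm [bRe bIm].
have hR i x : D i x -> `|complex.Re (f x)| <= s i.
  by move=> Dx; apply: le_trans (fs Dx); exact: Re_le_normc.
have hI i x : D i x -> `|complex.Im (f x)| <= s i.
  by move=> Dx; apply: le_trans (fs Dx); exact: Im_le_normc.
rewrite /cintegral.
rewrite (bigcup_Rintegral mD tD mRe hR s0 sC t0 t1 (b := fun i => complex.Re (b i)) (l := complex.Re l)).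
- rewrite (bigcup_Rintegral mD tD mIm hI s0 sC t0 t1 (b := fun i => complex.Im (b i)) (l := complex.Im l)).
  + by case: (l).
  + by move=> i; rewrite -fb.
  + apply: cvg_trans bIm; apply: near_eq_cvg; apply: nearW => n.
    by rewrite /series /= raddf_sum.
- by move=> i; rewrite -fb.
- apply: cvg_trans bRe; apply: near_eq_cvg; apply: nearW => n.
  by rewrite /series /= raddf_sum.
Qed.

End CountableComplexIntegral.

(** * Zeta integrals of tame functions *)

Section ComplexPowers.
Variable R : realType.
Implicit Types (a : R) (s : R[i]).

Lemma cexp_mulz (z : R[i]) (n : int) : cexp (n%:~R * z) = cexp z ^ n.
Proof.
case: n => n; first by rewrite -pmulrn cexpMn.
by rewrite NegzE mulrNz mulNr cexpN -pmulrn cexpMn exprnN.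
Qed.

Lemma ln_expz a (n : int) : 0 < a -> ln (a ^ n) = n%:~R * ln a.
Proof.
move=> a0; case: n => n; first by rewrite -exprnP lnXn// -mulr_natl pmulrn.
by rewrite NegzE -exprnN lnV ?posrE ?exprn_gt0// lnXn// mulrNz mulNr -mulr_natl pmulrn.
Qed.

Lemma cpow_expz a (n : int) s : 0 < a -> cpow (a ^ n) s = cpow a s ^ n.
Proof.
move=> a0; rewrite !cpowE -cexp_mulz ln_expz// rmorphM rmorph_int.
by congr cexp; ring.
Qed.

Lemma cpow_neq0 a s : cpow a s != 0.
Proof. by rewrite cpowE cexp_neq0. Qed.

Lemma normc_cpow a s : normc (cpow a s) = expR (complex.Re s * ln a).
Proof. by rewrite cpowE normc_cexp; case: s => x y /=; rewrite mulr0 subr0. Qed.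

Lemma mero_at_cpow a (c : R[i]) z0 : mero_at (fun s => c * cpow a s) z0.
Proof.
apply: mero_atM; first exact: mero_at_cst.
rewrite (_ : cpow a = fun s => cexp ((ln a)%:C * s)); first exact: mero_at_cexp.
by apply/funext => s; rewrite cpowE mulrC.
Qed.

End ComplexPowers.

Section TameSeries.
Variables (R : realType) (A Be Bo X : R[i]).
Hypotheses (X0 : X != 0) (X1 : normc X < 1).

Definition tame_coef (n : int) : R[i] :=
  if n <= -2 then 0 else if n == -1 then A else if odd `|n|%N then Bo else Be.

Definition tame_value : R[i] := A / X + (Be + Bo * X) / (1 - X ^+ 2).

Let X2 : 1 - X ^+ 2 != 0.
Proof.
rewrite subr_eq0; apply/eqP => h; have := congr1 (@normc R) h.
rewrite normc1 normcX => /esym/eqP; rewrite expr2 => /eqP h1.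
have := normc_ge0 X; move: X1 h1; nra.
Qed.

(* The part of the sum from the index [J] on is
   [X ^+ J * tail J / (1 - X ^+ 2)]. *)
Let tail J : R[i] := if odd J then Bo + Be * X else Be + Bo * X.

(** Two interleaved geometric series of ratio [X ^+ 2]; the remainder depends
    on the parity of the number of terms through [tail]. *)
Lemma tame_partial_sum J : \sum_(j < J) X ^+ j * (if odd j then Bo else Be) =
  (Be + Bo * X) / (1 - X ^+ 2) - X ^+ J * tail J / (1 - X ^+ 2).
Proof.
elim: J => [|J IHJ]; first by rewrite big_ord0 expr0 mul1r subrr.
rewrite big_ord_recr /= IHJ [X ^+ J.+1]exprS /tail /=.
by case: (odd J) => /=; field.
Qed.

Lemma tame_series (r : nat) : (0 < r)%N ->
  series (fun i => X ^ (i%:Z - r%:Z) * tame_coef (i%:Z - r%:Z)) @ \oo --> tame_value.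
Proof.
case: r => // r _; rewrite -(cvg_shiftn r.+1).
pose C := (normc (Be + Bo * X) + normc (Bo + Be * X)) / normc (1 - X ^+ 2).
apply: (@cvgC_squeeze _ _ _ _ _ _ (geometric C (normc X))); last first.
  by apply: cvg_geometric; rewrite ger0_norm ?normc_ge0.
apply: nearW => J; rewrite /series /= big_mkord addnC.
rewrite big_split_ord /= big_ord_recr /= big1 ?add0r; last first.
  move=> i _; rewrite /tame_coef; case: ifPn; rewrite ?mulr0//.
  by have := ltn_ord i; lia.
have -> : (r%:Z - r.+1%:Z = -1)%R by lia.
have -> : \sum_(i < J) X ^ ((r.+1 + i)%N%:Z - r.+1%:Z) * tame_coef ((r.+1 + i)%N%:Z - r.+1%:Z) =
   \sum_(j < J) X ^+ j * (if odd j then Bo else Be).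
  apply: eq_bigr => j _; have -> : (r.+1 + j)%N%:Z - r.+1%:Z = j%:Z by lia.
  by rewrite /tame_coef /=.
rewrite tame_partial_sum {1}/tame_coef /= /tame_value exprN1.
have -> : X^-1 * A + ((Be + Bo * X) / (1 - X ^+ 2) - X ^+ J * tail J / (1 - X ^+ 2)) -
   (A / X + (Be + Bo * X) / (1 - X ^+ 2)) = - (X ^+ J * tail J / (1 - X ^+ 2)).
  by rewrite [X^-1 * A]mulrC; set a := A / X; set b := _ / _; set e := _ / _; ring.
rewrite normcN_eq !normcM normcV normcX /geometric /= /C [leRHS]mulrC mulrA.
rewrite ler_wpM2r ?invr_ge0 ?normc_ge0// ler_wpM2l ?exprn_ge0 ?normc_ge0//.
by rewrite /tail; case: ifP => _; rewrite ?lerDl ?lerDr normc_ge0.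
Qed.

End TameSeries.

Section TameZeta.
Variables (R : realType) (K : fieldType) (nrm : K -> R) (varpi : K) (q : nat).
Hypothesis lfP : local_field nrm varpi q.
Hypothesis nrm2 : nrm 2%:R = 1.
Let nrmP := lf_abs lfP.
Variable psi : K -> R[i].
Hypothesis cpsi : conductor nrm varpi psi 0.
Hypothesis psi_norm : forall x, normc (psi x) = 1.
Variable mu : {measure set (borel nrm) -> \bar R}.
Hypothesis haar : is_haar mu.
Hypothesis vol0 : vol varpi mu 0 = 1.
Implicit Types (x y z a u h : K) (D : set K) (n j k : int).

Notation Pi := (nrm varpi).
Notation B := (ideal_pow nrm varpi).
Notation csum := (coset_sum nrm varpi).
Notation cinv := (coset_inv nrm varpi).
Notation cstable := (coset_stable nrm varpi).
Notation qr := (qres nrm).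

Let P0 : Pi != 0. Proof. by rewrite gt_eqF// (Pi_gt0 lfP). Qed.
Let PC n : (Pi ^ n)%:C = Pi%:C ^ n :> R[i].
Proof. by rewrite fmorphXz. Qed.
Let PC0 : Pi%:C != 0 :> R[i].
Proof. by rewrite (fmorph_eq0 (real_complex R)). Qed.

Definition shell n : set K := [set x | nrm x = Pi ^ n].

(** All shells are scaled back to the units, where residue classes are
    summed. *)
Lemma shell_scale n x : shell n (varpi ^ n * x) <-> shell 0 x.
Proof.
rewrite /shell /= (nrmM nrmP) (nrm_varpiz lfP) expr0z; split=> [h|->]; last by rewrite mulr1.
by apply: (mulfI (lt0r_neq0 (Piz_gt0 lfP n))); rewrite h mulr1.
Qed.

Lemma shellE n x : shell n x -> exists2 u, nrm u = 1 & x = varpi ^ n * u.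
Proof.
move=> xn; have xE : x = varpi ^ n * (x / varpi ^ n) by rewrite mulrC mulfVK// (varpiz_neq0 lfP).
by exists (x / varpi ^ n) => //; apply/(shell_scale n); rewrite -xE.
Qed.

Lemma shell_ideal n : shell n `<=` B n.
Proof. by move=> x; rewrite /shell /ideal_pow /= => ->. Qed.

Lemma shell_stable n M : n < M -> cstable M (shell n).
Proof.
move=> nM x y xn yM; rewrite /shell /= (nrmD_dom nrmP)// xn.
by apply: le_lt_trans yM _; rewrite (Pi_lt lfP).
Qed.

Lemma shell_translate n h : B (n + 1) h -> forall x, shell n x <-> shell n (x + h).
Proof.
have st : cstable (n + 1) (shell n) by apply: shell_stable; lia.
move=> hn x; split=> [xn|xn]; first exact: st.
by rewrite -(addrK h x); apply: st => //; exact: (idealN lfP).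
Qed.

(** The units are the integers minus the zero residue class. *)
Lemma unit_sum (f : K -> R[i]) : cinv 1 (B 0) f ->
  csum 1 (shell 0) f = csum 1 (B 0) f - f 0.
Proof.
move=> sf; have s1 : cstable 1 (B 1) by exact: (ideal_stable lfP).
have B10 : B 1 `<=` B 0 by move=> x; exact: (ideal_le lfP).
have -> : B 0 = shell 0 `|` B 1.
  apply/seteqP; split=> x.
    rewrite (mem_ideal0 nrm varpi) => x1; rewrite /shell /= expr0z.
    have [x1'|x1'] := ltP (nrm x) 1; first by right; rewrite (mem_ideal1 lfP).
    by left; apply/eqP; rewrite eq_le x1.
  by move=> [/shell_ideal//|/B10].
rewrite (coset_sumU lfP (m := 0))//.
- rewrite (coset_sum_ideal_cst lfP (m := 1) (c := f 0)) ?addrK// => x x1.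
  by rewrite -[x]add0r sf//; exact: (ideal0 lfP).
- exact: shell_stable.
- exact: shell_ideal.
- by move=> x; rewrite /shell /= expr0z (mem_ideal1 lfP) => ->; rewrite ltxx.
Qed.

(** The two characters of the units that occur: the residue symbol if [b]
    holds, the trivial one otherwise. *)
Definition tame_symbol (b : bool) u : R[i] := (if b then qr u else 1)%:~R.

Lemma tame_symbol_inv b : cinv 1 (B 0) (tame_symbol b).
Proof. by case: b => x y x0 y1 //; rewrite /tame_symbol (qres_inv lfP nrm2 x0 y1). Qed.

Lemma normc_tame_symbol b u : nrm u = 1 -> normc (tame_symbol b u) = 1.
Proof.
rewrite /tame_symbol; case: b => u1; last by rewrite normc1.
by have [->|->] := qres_unit u1; rewrite ?normc1// rmorphN normcN_eq normc1.
Qed.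

Definition tame_unit_sum (b : bool) : R[i] := if b then 0 else q%:R - 1.

Lemma tame_symbol_sum b : csum 1 (shell 0) (tame_symbol b) = tame_unit_sum b.
Proof.
rewrite (unit_sum (@tame_symbol_inv b)) /tame_symbol /tame_unit_sum; case: b.
  have fD := ideal_reps_finite lfP 0 1.
  rewrite /qres (nrm0 nrmP) ltr01 subr0.
  have := congr1 (fun z : int => z%:~R : R[i]) (coset_sum_qres lfP nrm2).
  by rewrite /coset_sum !fsbig_finite// raddf_sum.
by rewrite (coset_sum_cst1 lfP).
Qed.

Definition tame_gauss_sum (b : bool) : R[i] :=
  if b then gauss_sum nrm varpi psi 1 else -1.

Let psi_int x : nrm x <= 1 -> psi x = 1.
Proof. by move=> x1; apply: (conductor_trivial cpsi); rewrite (mem_ideal0 nrm varpi). Qed.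

Let psi_nontriv : exists2 x, B (-1) x & psi x != 1.
Proof. exact: (conductor_nontrivial cpsi). Qed.

(** For the trivial symbol the sum over the units is that over the residue
    field, which vanishes, minus the term [1] of the zero class. *)
Lemma tame_symbol_psi_sum b :
  csum 1 (shell 0) (fun u => tame_symbol b u * psi (varpi^-1 * u)) = tame_gauss_sum b.
Proof.
have sp : cinv 1 (B 0) (fun u => psi (varpi^-1 * u)).
  apply: (psi_invariant lfP (conductorD cpsi)) => //.
  by rewrite /ideal_pow /= (nrmV nrmP).
rewrite unit_sum; last by move=> x y x0 y1; rewrite (tame_symbol_inv b x0 y1) sp.
rewrite mulr0 (psi_int (x := 0)) ?(nrm0 nrmP)// mulr1 /tame_symbol /tame_gauss_sum; case: b.
  rewrite /qres (nrm0 nrmP) ltr01 subr0.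
  rewrite (gauss_sumE lfP nrm2 (conductorD cpsi)) ?(nrm1 nrmP)//.
  by under [in RHS]eq_fun do rewrite mulr1.
under eq_fun do rewrite mul1r.
rewrite (linear_sum0 lfP (conductorD cpsi)) ?sub0r//.
by rewrite (nrmV nrmP).
Qed.

(* Products of Hilbert symbols and Weil ratios have this form: on elements of
   given valuation, a constant times a character of the angular component,
   both depending only on the parity of the valuation. *)
Variables (rho : K -> R[i]) (ae ao : R[i]) (be bo : bool).
Hypothesis rho_even : forall k u, nrm u = 1 ->
  rho (varpi ^ (2 * k) * u) = ae * tame_symbol be u.
Hypothesis rho_odd : forall k u, nrm u = 1 ->
  rho (varpi ^ (2 * k + 1) * u) = ao * tame_symbol bo u.

Lemma parity n : exists k, n = 2 * k \/ n = 2 * k + 1.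
Proof. by exists (n %/ 2)%Z; lia. Qed.

Lemma rho_shell n : exists (a : R[i]) b, forall u, nrm u = 1 ->
  rho (varpi ^ n * u) = a * tame_symbol b u.
Proof.
have [k [->|->]] := parity n; first by exists ae, be => u; exact: rho_even.
by exists ao, bo => u; exact: rho_odd.
Qed.

Lemma rho_inv n : cinv (n + 1) (shell n) rho.
Proof.
move=> x y xn yn; have [a [b ab]] := rho_shell n.
have [u u1 xE] := shellE xn.
have y1 : B 1 (y / varpi ^ n) by exact: (ideal_divz lfP).
have yE : y = varpi ^ n * (y / varpi ^ n) by rewrite mulrC mulfVK// (varpiz_neq0 lfP).
have u0 : B 0 u by rewrite (mem_ideal0 nrm varpi) u1.
have u1' : nrm (u + y / varpi ^ n) = 1.
  by rewrite (nrmD_dom nrmP)// u1; rewrite (mem_ideal1 lfP) in y1.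
by rewrite xE {1}yE -mulrDr !ab// (tame_symbol_inv b u0 y1).
Qed.

Lemma normc_rho_le x : x != 0 -> normc (rho x) <= normc ae + normc ao.
Proof.
move=> /(nrm_val lfP) [n /shellE [u u1 ->]].
have [k [->|->]] := parity n.
  by rewrite rho_even// normcM normc_tame_symbol// mulr1 lerDl normc_ge0.
by rewrite rho_odd// normcM normc_tame_symbol// mulr1 lerDr normc_ge0.
Qed.

Definition theta x := rho x * psi x.
(** On the shell of valuation [n], [rho] is constant modulo [varpi ^ (n + 1)]
    and [psi] is constant modulo the integers. *)
Definition level n := Num.max (n + 1) 0.

Lemma psi_inv D : cinv 0 D psi.
Proof. by move=> x y _ y0; rewrite (conductorD cpsi) (conductor_trivial cpsi y0) mulr1. Qed.

Lemma theta_inv n : cinv (level n) (shell n) theta.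
Proof.
move=> x y xn yn.
have y0 : B 0 y by apply: (ideal_le lfP) yn; rewrite /level le_max lexx orbT.
have y1 : B (n + 1) y by apply: (ideal_le lfP) yn; rewrite /level le_max lexx.
by rewrite /theta (rho_inv xn y1) (psi_inv xn y0).
Qed.

Lemma level_stable n : cstable (level n) (shell n).
Proof. by apply: shell_stable; rewrite /level lt_max ltrDl ltr01. Qed.

Lemma cintegral_shell (c : R[i]) n : cintegral mu (shell n) (fun x => c * theta x) =
  c * ((vol varpi mu (level n))%:C * csum (level n) (shell n) theta).
Proof.
rewrite (cintegral_coset_sum lfP haar (@level_stable n) (@shell_ideal n)).
  by rewrite coset_sumMl mulrCA.
by move=> x y xn yn; rewrite (theta_inv xn yn).
Qed.

Let volP n : vol varpi mu n = Pi ^ n.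
Proof. by rewrite (volE lfP haar) vol0 mulr1. Qed.

(** The coefficients of the principal term and of the even and odd shells;
    the factor [Pi] is the volume of the maximal ideal. *)
Definition res_coef := Pi%:C * (ao * tame_gauss_sum bo).
Definition even_coef := Pi%:C * (ae * tame_unit_sum be).
Definition odd_coef := Pi%:C * (ao * tame_unit_sum bo).

(** Below the conductor the integral over a shell vanishes since [psi] is
    nontrivial on translations under which everything else is invariant. *)
Lemma shell_low n : n <= -2 -> csum (level n) (shell n) theta = 0.
Proof.
move=> n2; have [h hB ph] := psi_nontriv.
have hn : B (n + 1) h by apply: (ideal_le lfP) hB; lia.
apply: (coset_sum_cancel lfP (h := h) (zeta := psi h) (@level_stable n) (@theta_inv n)) => //.
  exact: shell_translate.
by move=> x xn; rewrite /theta (rho_inv xn hn) (conductorD cpsi); ring.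
Qed.

(** For [n >= -1] the level is [n + 1], and scaling by [varpi ^ n] leaves a
    sum over the residue classes of units; the factors in front form the
    volume of a coset. *)
Lemma shell_high n : -1 <= n -> (vol varpi mu (level n))%:C * csum (level n) (shell n) theta =
  Pi%:C ^ n * (Pi%:C * csum 1 (shell 0) (fun u => theta (varpi ^ n * u))).
Proof.
move=> n1; have lE : level n = n + 1 by rewrite /level; lia.
have st : cstable 1 (shell 0) by exact: shell_stable.
have inv : cinv (n + 1) (shell n) theta by rewrite -lE; exact: theta_inv.
rewrite lE -(coset_sum_scale lfP st inv (@shell_scale n)) volP PC expfzDr// expr1z.
by rewrite mulrA.
Qed.

Lemma shell_integral n :
  (vol varpi mu (level n))%:C * csum (level n) (shell n) theta =
  Pi%:C ^ n * tame_coef res_coef even_coef odd_coef n.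
Proof.
rewrite /tame_coef; case: ifPn => [n2|n2]; first by rewrite shell_low// !mulr0.
have st : cstable 1 (shell 0) by exact: shell_stable.
have unitP u : shell 0 u -> nrm u = 1 by rewrite /shell /= expr0z.
rewrite shell_high; last lia.
case: ifPn => [/eqP n1|n1].
  have nE : n = 2 * (-1) + 1 by rewrite n1.
  rewrite /res_coef; congr (_ * (_ * _)); rewrite -tame_symbol_psi_sum -coset_sumMl.
  apply: (eq_coset_sum lfP st) => u /unitP u1.
  by rewrite /theta {1}nE rho_odd// n1 exprN1 mulrA.
have psi1 u : shell 0 u -> psi (varpi ^ n * u) = 1.
  move=> /unitP u1; apply: psi_int; rewrite (nrmM nrmP) u1 mulr1 (nrm_varpiz lfP).
  by rewrite -(expr0z Pi) (Pi_le lfP); lia.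
have [k [nk|nk]] := parity n.
  rewrite (_ : odd _ = false); last by lia.
  rewrite /even_coef; congr (_ * (_ * _)); rewrite -tame_symbol_sum -coset_sumMl.
  apply: (eq_coset_sum lfP st) => u uU.
  by rewrite /theta psi1// mulr1 nk rho_even// unitP.
rewrite (_ : odd _ = true); last by lia.
rewrite /odd_coef; congr (_ * (_ * _)); rewrite -tame_symbol_sum -coset_sumMl.
apply: (eq_coset_sum lfP st) => u uU.
by rewrite /theta psi1// mulr1 nk rho_odd// unitP.
Qed.

Variables (c : R[i]) (phi : K -> R[i]).
Hypothesis c0 : c != 0.
Hypothesis phiE : forall n u, nrm u = 1 ->
  phi (varpi ^ n * u) = c ^ n * theta (varpi ^ n * u).

(** The variable [X] in which the zeta integrals are rational functions. *)
Definition zvar s : R[i] := c * cpow Pi s.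

Lemma zeta_integrandE s n x : shell n x ->
  zeta_integrand nrm phi s x = zvar s ^ n / Pi%:C ^ n * theta x.
Proof.
move=> xn; have [u u1 xE] := shellE xn.
rewrite /zeta_integrand xn PC cpow_expz ?(Pi_gt0 lfP)// /zvar [(c * _) ^ n]expfzMl.
rewrite {1}xE phiE// -xE.
move: (theta x) (cpow Pi s ^ n) (Pi%:C ^ n) (c ^ n) => th w v d.
ring.
Qed.

Lemma zvar_neq0 s : zvar s != 0.
Proof. by rewrite mulf_neq0// cpow_neq0. Qed.

Lemma zeta_domainE r : zeta_domain nrm varpi r = \bigcup_i shell (i%:Z - r%:Z).
Proof.
apply/seteqP; split=> x.
  move=> [xr /= /eqP x0]; have [n xn] := nrm_val lfP x0.
  move: xr; rewrite /ideal_pow /= xn (Pi_le lfP) => rn.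
  by exists (absz (n + r%:Z)) => //; rewrite /shell /= xn; congr (_ ^ _); lia.
move=> [i _ xi]; split.
  by rewrite /ideal_pow /= xi (Pi_le lfP); lia.
by move=> /= x0; move: xi; rewrite /shell /= x0 (nrm0 nrmP) => /esym/eqP; rewrite gt_eqF// (Piz_gt0 lfP).
Qed.

Lemma shell_trivIset (r : nat) : trivIset setT (fun i : nat => shell (i%:Z - r%:Z)).
Proof.
move=> i j _ _ [x [/= xi xj]]; move: xi; rewrite /shell /= xj => /eqP.
by rewrite eq_le !(Pi_le lfP) -eq_le => /eqP; lia.
Qed.

Lemma zeta_inv s n : cinv (level n) (shell n) (zeta_integrand nrm phi s).
Proof.
move=> x y xn yn; have xyn := level_stable xn yn.
by rewrite (zeta_integrandE s xn) (zeta_integrandE s xyn) (theta_inv xn yn).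
Qed.

Let Crho := normc ae + normc ao.
Let Crho0 : 0 <= Crho. Proof. by rewrite addr_ge0 ?normc_ge0. Qed.

(* The bound of the integrand on a shell; its product with the measure of the
   ball containing the shell is geometric in the modulus of [zvar s]. *)
Let sup_bound s (r i : nat) : R := Crho * normc (zvar s) ^ (i%:Z - r%:Z) / Pi ^ (i%:Z - r%:Z).

Let normc_expz (z : R[i]) n : normc (z ^ n) = normc z ^ n.
Proof. by case: n => n; rewrite ?NegzE -?exprnP -?exprnN ?normcV normcX. Qed.

Let sup_boundP s r i x : shell (i%:Z - r%:Z) x ->
  normc (zeta_integrand nrm phi s x) <= sup_bound s r i.
Proof.
move=> xn; rewrite (zeta_integrandE s xn) !normcM normcV !normc_expz psi_norm mulr1 normc_real.
rewrite ger0_norm ?nrm_ge0//.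
have -> : sup_bound s r i =
    normc (zvar s) ^ (i%:Z - r%:Z) / Pi ^ (i%:Z - r%:Z) * Crho.
  by rewrite /sup_bound [RHS]mulrC mulrA.
rewrite ler_wpM2l//.
  by rewrite mulr_ge0 ?invr_ge0 ?exprz_ge0 ?normc_ge0 ?nrm_ge0.
apply: normc_rho_le; rewrite -(nrm_gt0 nrmP) xn; exact: (Piz_gt0 lfP).
Qed.

Let sup_bound_ge0 s r i : 0 <= sup_bound s r i.
Proof.
rewrite /sup_bound; apply: mulr_ge0.
  by apply: mulr_ge0; [exact: Crho0|apply: exprz_ge0; exact: normc_ge0].
by rewrite invr_ge0; apply: exprz_ge0; exact: nrm_ge0.
Qed.

Let sup_bound_mu s r i : ((sup_bound s r i)%:E * mu (shell (i%:Z - r%:Z)) <=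
  (Crho * normc (zvar s) ^ (- r%:Z) * normc (zvar s) ^+ i)%:E)%E.
Proof.
set n := i%:Z - r%:Z.
apply: (@le_trans _ _ ((sup_bound s r i)%:E * mu (B n))%E).
  apply: lee_wpmul2l; first by rewrite lee_fin.
  apply: le_measure; rewrite ?inE//; last exact: shell_ideal.
    exact: (stable_measurable lfP (@level_stable n)).
  exact: (ideal_measurable lfP).
rewrite (mu_ideal lfP haar) volP -EFinM lee_fin /sup_bound -/n mulfVK; last first.
  by rewrite gt_eqF// (Piz_gt0 lfP).
by rewrite -mulrA exprnP -expfzDr ?normc_eq0 ?zvar_neq0// [- _ + _]addrC.
Qed.

Let mshell (r i : nat) : measurable (shell (i%:Z - r%:Z) : set (borel nrm)).
Proof. exact: (stable_measurable lfP (@level_stable _)). Qed.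

Let mRe s (r i : nat) : measurable_fun (shell (i%:Z - r%:Z) : set (borel nrm))
  (fun x : borel nrm => complex.Re (zeta_integrand nrm phi s x)).
Proof.
apply: (inv_measurable_fun lfP (@level_stable _)) => x y xn yn.
by rewrite (zeta_inv s xn yn).
Qed.

Let mIm s (r i : nat) : measurable_fun (shell (i%:Z - r%:Z) : set (borel nrm))
  (fun x : borel nrm => complex.Im (zeta_integrand nrm phi s x)).
Proof.
apply: (inv_measurable_fun lfP (@level_stable _)) => x y xn yn.
by rewrite (zeta_inv s xn yn).
Qed.

Lemma zeta_integrable s r : normc (zvar s) < 1 ->
  cintegrable mu (zeta_domain nrm varpi r) (zeta_integrand nrm phi s).
Proof.
move=> X1; rewrite zeta_domainE.
exact: (bigcup_cintegrable (@mshell r) (@shell_trivIset r) (@mRe s r) (@mIm s r)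
  (@sup_boundP s r) (@sup_bound_ge0 s r) (@sup_bound_mu s r) (normc_ge0 _) X1).
Qed.

Definition zeta_value s := tame_value res_coef even_coef odd_coef (zvar s).

Lemma zeta_integral s r : normc (zvar s) < 1 -> (0 < r)%N ->
  cintegral mu (zeta_domain nrm varpi r) (zeta_integrand nrm phi s) = zeta_value s.
Proof.
move=> X1 r0; rewrite zeta_domainE.
have ser := @tame_series _ res_coef even_coef odd_coef _ (zvar_neq0 s) X1 _ r0.
refine (bigcup_cintegral (@mshell r) (@shell_trivIset r) (@mRe s r) (@mIm s r)
  (@sup_boundP s r) (@sup_bound_ge0 s r) (@sup_bound_mu s r) (normc_ge0 _) X1
  _ ser) => i.
set n := i%:Z - r%:Z.
have -> : cintegral mu (shell n) (zeta_integrand nrm phi s) =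
    cintegral mu (shell n) (fun x => zvar s ^ n / Pi%:C ^ n * theta x).
  by rewrite /cintegral; congr (_ +i* _); apply: eq_Rintegral => x; rewrite inE => xn;
    rewrite (zeta_integrandE s xn).
rewrite cintegral_shell shell_integral; field.
exact: expfz_neq0.
Qed.

Lemma zeta_value_meromorphic : meromorphic zeta_value.
Proof.
apply/meromorphicP => z0; have mX : mero_at zvar z0 by exact: mero_at_cpow.
have mc (a : R[i]) : mero_at (fun=> a) z0 by exact: mero_at_cst.
have -> : zeta_value = fun s => res_coef * (zvar s)^-1 +
    (even_coef + odd_coef * zvar s) * (1 + (-1) * zvar s ^+ 2)^-1.
  by apply/funext => s; rewrite /zeta_value /tame_value mulN1r.
have mden : mero_at (fun s => 1 + (-1) * zvar s ^+ 2) z0.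
  exact: mero_atD (mc 1) (mero_atM (mc (-1)) (mero_atX 2 mX)).
have mnum : mero_at (fun s => even_coef + odd_coef * zvar s) z0.
  exact: mero_atD (mc even_coef) (mero_atM (mc odd_coef) mX).
exact: mero_atD (mero_atM (mc res_coef) (mero_atV mX)) (mero_atM mnum (mero_atV mden)).
Qed.

(** The series over the shells converges where [zvar s] has modulus less than
    one, which is a right half-plane since [ln Pi < 0]. *)
Lemma zeta_value_continuation : is_zeta_continuation varpi mu phi zeta_value.
Proof.
split; first exact: zeta_value_meromorphic.
have lnP : ln Pi < 0 by rewrite ln_lt0// (Pi_gt0 lfP) (Pi_lt1 lfP).
exists (ln (normc c) / - ln Pi) => s hs.
have X1 : normc (zvar s) < 1.
  rewrite normcM normc_cpow -[normc c]lnK ?posrE ?normc_gt0// -expRD expR_lt1.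
  by move: hs; rewrite ltr_pdivrMr ?oppr_gt0// mulrN; lra.
split=> [r|]; first exact: zeta_integrable.
apply: cvg_near_cst; exists 1%N => // r /= r1; exact: zeta_integral.
Qed.

(** Any two continuations agree on a half-plane where both are given by the
    integrals, hence everywhere by the identity theorem. *)
Lemma zeta_continuationE : mero_eq (zeta_continuation varpi mu phi) zeta_value.
Proof.
have ex : exists G, [set G | is_zeta_continuation varpi mu phi G] G.
  by exists zeta_value; exact: zeta_value_continuation.
have [mG [s1 h1]] := xgetPex (fun=> 0) ex.
have [mH [s2 h2]] := zeta_value_continuation.
apply: (mero_identity mG mH).
(* A disc of radius one inside both half-planes. *)
exists (`|s1| + `|s2| + 1)%:C; apply/dnearCP; exists 1 => // z z1 _.
have hz : s1 < complex.Re z /\ s2 < complex.Re z.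
  have := le_lt_trans (Re_le_normc _) z1; rewrite raddfB /= ltr_norml => /andP[].
  have := ler_norm s1; have := ler_norm s2; have := normr_ge0 s1; have := normr_ge0 s2.
  by move=> *; split; lra.
have [/h1 [_ l1] /h2 [_ l2]] := hz.
exact: cvgC_unique l1 l2.
Qed.

End TameZeta.

(** * The gamma factors and their product *)

Section GammaFactorsValues.
Variables (R : realType) (K : fieldType) (nrm : K -> R) (varpi : K) (q : nat).
Hypothesis lfP : local_field nrm varpi q.
Hypothesis nrm2 : nrm 2%:R = 1.
Let nrmP := lf_abs lfP.
Variable dx : (K -> R[i]) -> {measure set (borel nrm) -> \bar R}.
Hypothesis dxP : forall psi' : K -> R[i], additive_character nrm psi' ->
  (exists x, psi' x != 1) -> self_dual_haar psi' (dx psi').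
Variables psi chi : K -> R[i].
Hypothesis psiA : additive_character nrm psi.
Hypothesis psiN : normalized_character nrm varpi psi.
Hypothesis chiM : mult_character nrm chi.
Hypothesis chiU : unramified nrm chi.
Implicit Types (x u : K) (n k : int) (s z : R[i]).

Notation Pi := (nrm varpi).
Notation qr := (qres nrm).
Notation c := (chi varpi).

Let pi0 : varpi != 0 := lf_varpi_neq0 lfP.
Let cpsi := psi_conductor psiA psiN.

Lemma psi_normc x : normc (psi x) = 1.
Proof. by case: psiA => _ /(_ x) h _; have := congr1 (@complex.Re R) h. Qed.

Lemma self_dual_psi : self_dual_haar psi (dx psi).
Proof.
by apply: dxP => //; have [x _ px] := conductor_nontrivial cpsi; exists x.
Qed.

Lemma vol_psi : vol varpi (dx psi) 0 = 1.
Proof.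
have sd := self_dual_psi.
by rewrite (self_dual_volE lfP sd.1 0 cpsi sd) oppr0 !expr0z sqrtr1 mul1r.
Qed.

Lemma chi_varpi_neq0 : c != 0.
Proof. by case: chiM => _ h _; exact: h. Qed.

Lemma chi_varpiz n : chi (varpi ^ n) = c ^ n.
Proof.
have [hM h0 _] := chiM.
have nat_pow (m : nat) : chi (varpi ^+ m) = c ^+ m.
  elim: m => [|m IHm]; first by rewrite !expr0 chiU// (nrm1 nrmP).
  by rewrite !exprS hM ?expf_neq0// IHm.
case: n => m; first exact: nat_pow.
rewrite NegzE -!exprnN; set w := varpi ^+ m.+1.
have w0 : w != 0 by rewrite expf_neq0.
apply: (mulfI (h0 _ w0)); rewrite -hM ?invr_neq0// mulfV// nat_pow mulfV ?expf_neq0 ?chi_varpi_neq0//.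
by rewrite chiU// (nrm1 nrmP).
Qed.

Lemma chi_shell n u : nrm u = 1 -> chi (varpi ^ n * u) = c ^ n.
Proof.
move=> u1; have u0 : u != 0 by rewrite -(nrm_eq0 nrmP) u1 oner_eq0.
by case: chiM => hM _ _; rewrite hM ?(varpiz_neq0 lfP)// chi_varpiz (chiU u1) mulr1.
Qed.

Notation G := (gauss_sum nrm varpi psi 1).
Notation g := ((Num.sqrt Pi)%:C * G).
Notation zval := (zeta_value nrm varpi).
Notation Z := (zvar nrm varpi).

Let symbolE b u : tame_symbol nrm b u = (if b then qr u else 1)%:~R :> R[i].
Proof. by []. Qed.

Definition gamma_phi a x :=
  ((chi x)^-1 * hilbert R a x)^-1 * (weil_ratio varpi dx psi x)^-1 * psi x.

Lemma weil_root_neq0 : g != 0.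
Proof.
have := weil_root_sq lfP nrm2 psiA psiN; apply: contra_eq_neq => ->.
rewrite expr0n eq_sym intr_eq0.
have : nrm (-1) = 1 by rewrite (nrmN nrmP) (nrm1 nrmP).
by move=> /qres_unit [] ->.
Qed.

Lemma intr_sqr1_inv (l : int) : l * l = 1 -> (l%:~R : R[i])^-1 = l%:~R.
Proof.
move=> ll; have h : (l%:~R : R[i]) * l%:~R = 1 by rewrite -rmorphM ll.
have l0 : (l%:~R : R[i]) != 0.
  by apply/eqP => l0; move: h; rewrite l0 mul0r => /eqP; rewrite eq_sym oner_eq0.
by apply: (mulfI l0); rewrite mulfV// h.
Qed.

(** On even shells the Hilbert symbol and the Weil ratio are trivial. On odd
    ones they are [qr e] and [g * qr u], so the tame part is the residue
    symbol times [qr e / g]. *)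
Lemma metaplectic_unit e : nrm e = 1 ->
  mero_eq (fun s => metaplectic_gamma varpi dx (1 - s) (fun x => (chi x)^-1 * hilbert R e x) psi)
    (zval q psi 1 ((qr e)%:~R / g) false true c).
Proof.
move=> e1 z0.
have sd := self_dual_psi.
pose rho x := (hilbert R e x)^-1 * (weil_ratio varpi dx psi x)^-1.
have rE k u : nrm u = 1 -> rho (varpi ^ (2 * k) * u) = 1 * tame_symbol nrm false u.
  move=> u1; rewrite /rho (hilbert_varpiz_even lfP) (hilbert_unit_unit lfP nrm2)//.
  by rewrite (weil_ratio_even lfP nrm2 dxP psiA psiN)// symbolE invr1 mulr1.
have rO k u : nrm u = 1 ->
    rho (varpi ^ (2 * k + 1) * u) = (qr e)%:~R / g * tame_symbol nrm true u.
  move=> u1; rewrite /rho (hilbert_varpiz_odd lfP) (hilbert_unit_varpi lfP nrm2)//.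
  rewrite (weil_ratio_odd lfP nrm2 dxP psiA psiN)// symbolE invfM.
  by rewrite !intr_sqr1_inv ?qres_sqr1//; ring.
have phE n u : nrm u = 1 -> gamma_phi e (varpi ^ n * u) = c ^ n * theta psi rho (varpi ^ n * u).
  by move=> u1; rewrite /gamma_phi /theta /rho chi_shell// invfM invrK; ring.
have := zeta_continuationE lfP nrm2 cpsi psi_normc sd.1 vol_psi rE rO chi_varpi_neq0 phE.
move=> /(_ z0); apply: filterS => z <-.
by rewrite /metaplectic_gamma subKr.
Qed.

(** On even shells the Hilbert symbol is [qr u] and the Weil ratio is
    trivial. On odd ones the factors [qr u] of the two cancel and leave the
    constant. *)
Lemma metaplectic_varpi e : nrm e = 1 ->
  mero_eq (fun s => metaplectic_gamma varpi dx (1 - s)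
     (fun x => (chi x)^-1 * hilbert R (varpi * e) x) psi)
    (zval q psi 1 ((qr (-1) * qr e)%:~R / g) true false c).
Proof.
move=> e1 z0.
have sd := self_dual_psi.
have N1 : nrm (-1) = 1 by rewrite (nrmN nrmP) (nrm1 nrmP).
pose rho x := (hilbert R (varpi * e) x)^-1 * (weil_ratio varpi dx psi x)^-1.
have rE k u : nrm u = 1 -> rho (varpi ^ (2 * k) * u) = 1 * tame_symbol nrm true u.
  move=> u1; rewrite /rho (hilbert_varpiz_even lfP) (hilbert_varpi_unit lfP nrm2)//.
  rewrite (weil_ratio_even lfP nrm2 dxP psiA psiN)// symbolE invr1 mulr1 mul1r.
  by rewrite intr_sqr1_inv// qres_sqr1.
have rO k u : nrm u = 1 -> rho (varpi ^ (2 * k + 1) * u) =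
    (qr (-1) * qr e)%:~R / g * tame_symbol nrm false u.
  move=> u1; rewrite /rho (hilbert_varpiz_odd lfP) (hilbert_varpi_varpi lfP nrm2)//.
  rewrite (weil_ratio_odd lfP nrm2 dxP psiA psiN)// symbolE invfM mulr1.
  have hu := qres_sqr1 u1.
  have hh : (qr (-1) * qr e * qr u) * (qr (-1) * qr e * qr u) = 1.
    by rewrite mulrACA hu mulr1 mulrACA (qres_sqr1 N1) (qres_sqr1 e1).
  rewrite (intr_sqr1_inv hh) (intr_sqr1_inv hu).
  have huC : (qr u)%:~R * (qr u)%:~R = 1 :> R[i] by rewrite -rmorphM hu.
  rewrite [(_ * qr u)%:~R]rmorphM /=.
  by rewrite mulrA -[_ * _ * (qr u)%:~R]mulrA huC !mulr1.
have phE n u : nrm u = 1 ->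
    gamma_phi (varpi * e) (varpi ^ n * u) = c ^ n * theta psi rho (varpi ^ n * u).
  by move=> u1; rewrite /gamma_phi /theta /rho chi_shell// invfM invrK; ring.
have := zeta_continuationE lfP nrm2 cpsi psi_normc sd.1 vol_psi rE rO chi_varpi_neq0 phE.
move=> /(_ z0); apply: filterS => z <-.
by rewrite /metaplectic_gamma subKr.
Qed.

(** The tame part is the constant [1]: the unramified character only enters
    through [c ^+ 2]. *)
Lemma tate_unramified :
  mero_eq (fun s => tate_gamma varpi dx (1 - s) (fun x => chi x ^- 2) psi)
    (zval q psi 1 1 false false (c ^+ 2)).
Proof.
move=> z0; have sd := self_dual_psi.
pose rho (x : K) : R[i] := 1.
have rE k u : nrm u = 1 -> rho (varpi ^ (2 * k) * u) = 1 * tame_symbol nrm false u.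
  by move=> u1; rewrite /rho symbolE mulr1.
have rO k u : nrm u = 1 -> rho (varpi ^ (2 * k + 1) * u) = 1 * tame_symbol nrm false u.
  by move=> u1; rewrite /rho symbolE mulr1.
have phE n u : nrm u = 1 -> (fun x => (chi x ^- 2)^-1 * psi x) (varpi ^ n * u) =
    (c ^+ 2) ^ n * theta psi rho (varpi ^ n * u).
  move=> u1; rewrite /theta /rho chi_shell// invrK mul1r; congr (_ * _).
  by rewrite !expr2 expfzMl.
have c20 : c ^+ 2 != 0 by rewrite expf_neq0// chi_varpi_neq0.
have := zeta_continuationE (phi := fun x => (chi x ^- 2)^-1 * psi x) lfP nrm2 cpsi psi_normc
  sd.1 vol_psi rE rO c20 phE.
move=> /(_ z0); apply: filterS => z <-.
by rewrite /tate_gamma subKr.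
Qed.

(** If [X ^+ 4 = 1] around a point then [X] has modulus one there, whereas
    the modulus of [zvar s] varies with the real part of [s]. This keeps the
    denominators of the final identity away from zero. *)
Lemma zvar_generic z0 : \forall s \near z0^', 1 - Z c s ^+ 4 != 0.
Proof.
have lnP : ln Pi < 0 by rewrite ln_lt0// (Pi_gt0 lfP) (Pi_lt1 lfP).
have mf : mero_at (fun s => 1 + (-1) * Z c s ^+ 4) z0.
  apply: (mero_atD (mero_at_cst 1 z0)); apply: (mero_atM (mero_at_cst (-1) z0)).
  apply: mero_atX; exact: mero_at_cpow.
have [/dnearCP [e e0 he]|] := mero_at_dichotomy mf; last first.
  by apply: filterS => s; rewrite mulN1r.
have norm1 s : normc (s - z0) < e -> s != z0 -> normc (Z c s) = 1.
  move=> se sz; have := he s se sz; rewrite mulN1r => /eqP; rewrite subr_eq0 => /eqP h.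
  have := congr1 (@normc R) h; rewrite normc1 normcX => /esym/eqP.
  by rewrite pexpr_eq1 ?normc_ge0// => /eqP.
have near_pt t : 0 < t < e -> complex.Re (z0 + t%:C) * ln Pi = - ln (normc c).
  move=> /andP[t0 te].
  have d : z0 + t%:C - z0 = t%:C by rewrite addrAC subrr add0r.
  have := @norm1 (z0 + t%:C); rewrite d normc_real gtr0_norm// => /(_ te).
  rewrite -subr_eq0 d -normc_eq0 normc_real gtr0_norm// gt_eqF// => /(_ isT).
  rewrite /zvar normcM normc_cpow => h.
  have c0 : 0 < normc c by rewrite normc_gt0 chi_varpi_neq0.
  have := congr1 (@ln R) h; rewrite ln1 lnM ?posrE ?expR_gt0// expRK => /eqP.
  by rewrite addrC addr_eq0 => /eqP.
(* The real parts of these two points differ, against [ln Pi < 0]. *)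
have h1 := near_pt (e / 2); have h2 := near_pt (e / 3).
exfalso; move: h1 h2; rewrite !raddfD /= => h1 h2.
have {}h1 := h1 ltac:(lra); have {}h2 := h2 ltac:(lra).
have : (e / 2 - e / 3) * ln Pi = 0 by lra.
move=> /eqP; rewrite mulf_eq0 (lt_eqF lnP) orbF => /eqP; lra.
Qed.

Lemma nrm_varpiC : Pi%:C = q%:R^-1 :> R[i].
Proof. by rewrite (lf_varpi lfP) fmorphV rmorph_nat. Qed.

Lemma zeta_valueE ae ao be bo c' s (X := Z c' s) :
  zval q psi ae ao be bo c' s =
  q%:R^-1 * (ao * tame_gauss_sum nrm varpi psi bo) / X +
  (q%:R^-1 * (ae * tame_unit_sum R q be) + q%:R^-1 * (ao * tame_unit_sum R q bo) * X) /
  (1 - X ^+ 2).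
Proof. by rewrite -nrm_varpiC. Qed.

Lemma cpowD (a : R) s z : cpow a (s + z) = cpow a s * cpow a z.
Proof. by rewrite !cpowE mulrDl cexpD. Qed.

Lemma cpowN (a : R) s : cpow a (- s) = (cpow a s)^-1.
Proof. by rewrite !cpowE mulNr cexpN. Qed.

Lemma cpow_q s : cpow q%:R (- s) = cpow Pi s.
Proof.
rewrite !cpowE (lf_varpi lfP) lnV ?posrE ?ltr0n ?(ltn_trans _ (q_gt1 lfP))//.
by rewrite rmorphN mulNr mulrN.
Qed.

Lemma cpow_Pi1 : cpow Pi 1 = q%:R^-1.
Proof.
by rewrite /cpow /= mul1r mul0r cos0 sin0 lnK ?posrE ?(Pi_gt0 lfP)// mulr1 nrm_varpiC.
Qed.

Lemma zvar_double s : Z (c ^+ 2) (2%:R * s) = Z c s ^+ 2.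
Proof. by rewrite /zvar exprMn mulr_natl mulr2n cpowD expr2. Qed.

Lemma Lfactor_zvar s (X := Z c s) :
  [/\ Lfactor varpi q (2%:R * s) (fun x => chi x ^+ 2) = (1 - X ^+ 2)^-1,
      Lfactor varpi q (- (2%:R * s)) (fun x => chi x ^- 2) = (1 - X ^- 2)^-1,
      Lfactor varpi q (1 - 2%:R * s) (fun x => chi x ^- 2) = (1 - q%:R^-1 * X ^- 2)^-1 &
      Lfactor varpi q (1 + 2%:R * s) (fun x => chi x ^+ 2) = (1 - q%:R^-1 * X ^+ 2)^-1].
Proof.
have E2 : cpow Pi (2%:R * s) = cpow Pi s ^+ 2 by rewrite mulr_natl mulr2n cpowD expr2.
have c0 := chi_varpi_neq0; have E0 := cpow_neq0 Pi s.
rewrite /Lfactor /X /zvar; split; rewrite cpow_q ?cpowD ?cpowN ?cpow_Pi1 E2;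
  congr (_ - _)^-1; move: (cpow Pi s) E0 => E E0.
- by rewrite exprMn mulrC.
- by field; rewrite ?c0 ?E0.
- by field; rewrite ?c0 ?E0 ?(q_neq0 lfP).
- by rewrite exprMn; ring.
Qed.

End GammaFactorsValues.

(** Here [S] is the inverse square root of [Q] and [G] the Gauss sum, so that
    [S * G] is the normalized one, of square [l]. The first two factors form
    a difference of squares, the next two are opposite multiples of the Tate
    factor. *)
Lemma product_identity (C : fieldType) (Q S X G l : C) :
  S != 0 -> G != 0 -> X != 0 -> 1 - X ^+ 4 != 0 -> Q = S ^- 2 -> l = (S * G) ^+ 2 ->
  let res a t := Q^-1 * (a * t) in
  let val r e o Y := r / Y + (e + o * Y) / (1 - Y ^+ 2) in
  val (res (1 / (S * G)) G) (res 1 (Q - 1)) (res (1 / (S * G)) 0) X *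
  val (res (-1 / (S * G)) G) (res 1 (Q - 1)) (res (-1 / (S * G)) 0) X *
  (val (res (l * 1 / (S * G)) (-1)) (res 1 0) (res (l * 1 / (S * G)) (Q - 1)) X *
   val (res (l * -1 / (S * G)) (-1)) (res 1 0) (res (l * -1 / (S * G)) (Q - 1)) X) =
  l * val (res 1 (-1)) (res 1 (Q - 1)) (res 1 (Q - 1)) (X ^+ 2) ^+ 2 *
  ((1 - X ^+ 2)^-1 * (1 - X ^- 2)^-1 *
   ((1 - Q^-1 * X ^- 2) * (1 - Q^-1 * X ^+ 2))).
Proof.
move=> S0 G0 X0 X4 -> ->.
have [X2 X2'] : 1 - X ^+ 2 != 0 /\ 1 + X ^+ 2 != 0.
  have := X4; rewrite (_ : 1 - X ^+ 4 = (1 - X ^+ 2) * (1 + X ^+ 2)); last by ring.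
  by rewrite mulf_eq0 negb_or => /andP.
have X2N : X ^+ 2 - 1 != 0 by rewrite -opprB oppr_eq0.
move=> res val; rewrite /val /res.
field.
by rewrite S0 oner_neq0 X0 X2N X2 -exprM X4 G0.
Qed.

Lemma dnear_double (R : realType) (P : R[i] -> Prop) (z0 : R[i]) :
  (\forall z \near (2%:R * z0)^', P z) -> \forall s \near z0^', P (2%:R * s).
Proof.
move=> /dnearCP [e e0 he]; apply/dnearCP; exists (e / 2); first by rewrite divr_gt0.
have two0 : (2%:R : R[i]) != 0 by rewrite pnatr_eq0.
move=> s se sz; apply: he; last by rewrite (inj_eq (mulfI two0)).
rewrite -mulrBr normcM -(rmorph_nat (real_complex R)) normc_real ger0_norm//.
by rewrite mulrC -ltr_pdivlMr.
Qed.

(** The uniformizer is nonzero because [p] is a nonzero element of the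
    maximal ideal. *)
Lemma padic_local_field (R : realType) (p : nat) (Qp : fieldType) (absQp : Qp -> R)
    (F : fieldExtType Qp) (nrm : F -> R) (varpi : F) (q : nat) :
  prime p -> is_Qp p absQp -> normalized_abs absQp nrm varpi q ->
  local_field nrm varpi q.
Proof.
move=> p_pr QpP nP; have nrmP := normalized_abs_abs nP.
have above := normalized_abs_above nP.
split=> //.
- exact: (normalized_abs_uniformizer nP).
- exact: (normalized_abs_residue nP).
- exact: (normalized_abs_varpi nP).
- have : [set x | nrm x < 1] p%:R%:A by exact: (nrm_p_lt1 p_pr QpP nrmP above).
  rewrite (normalized_abs_uniformizer nP) => -[y _ pE].
  apply: contraTneq (nrm_p_gt0 p_pr QpP nrmP) => v0.
  by rewrite -pE v0 mul0r (nrm0 nrmP) ltxx.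
- exact: (padic_extension_complete p_pr QpP nrmP above).
Qed.

Theorem corollary4p5 (R : realType) (p : nat)
    (Qp : fieldType) (absQp : Qp -> R) (F : fieldExtType Qp)
    (nrm : F -> R) (varpi : F) (q : nat)
    (dx : (F -> R[i]) -> {measure set (borel nrm) -> \bar R})
    (psi chi : F -> R[i]) :
  prime p -> is_Qp p absQp -> normalized_abs absQp nrm varpi q ->
  (forall psi' : F -> R[i], additive_character nrm psi' ->
     (exists x, psi' x != 1) -> self_dual_haar psi' (dx psi')) ->
  odd p ->
  additive_character nrm psi -> normalized_character nrm varpi psi ->
  mult_character nrm chi -> unramified nrm chi ->
  mero_eq
    (fun s => \big[*%R/1]_(A \in square_classes F)
       metaplectic_gamma varpi dx (1 - s)
         (fun x => (chi x)^-1 * hilbert R (xget 0 A) x) psi)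
    (fun s => hilbert R varpi (-1) *
       tate_gamma varpi dx (1 - 2 * s) (fun x => chi x ^- 2) psi ^+ 2 *
       (Lfactor varpi q (2 * s) (fun x => chi x ^+ 2) *
        Lfactor varpi q (- (2 * s)) (fun x => chi x ^- 2) /
        (Lfactor varpi q (1 - 2 * s) (fun x => chi x ^- 2) *
         Lfactor varpi q (1 + 2 * s) (fun x => chi x ^+ 2)))).
Proof.
move=> p_pr QpP nP dxP op psiA psiN chiM chiU z0.
have lfP := padic_local_field p_pr QpP nP; have nrmP := lf_abs lfP.
have nrm2 := nrm_two p_pr QpP nrmP (normalized_abs_above nP) op.
have [e e1 qe] := nonsquare_unit lfP nrm2.
have n1 := nrm1 nrmP; have nN1 : nrm (-1) = 1 by rewrite (nrmN nrmP).
have q1 : qres nrm 1 = 1 by rewrite -(expr1n F 2) (qres_square lfP).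
have h1 := metaplectic_unit lfP nrm2 dxP psiA psiN chiM chiU n1 z0.
have he := metaplectic_unit lfP nrm2 dxP psiA psiN chiM chiU e1 z0.
have hv := metaplectic_varpi lfP nrm2 dxP psiA psiN chiM chiU n1 z0.
have hve := metaplectic_varpi lfP nrm2 dxP psiA psiN chiM chiU e1 z0.
have ht := dnear_double (tate_unramified lfP nrm2 dxP psiA psiN chiM chiU (2%:R * z0)).
have hz := zvar_generic lfP chiM z0.
apply: filterS (filterI (filterI (filterI h1 he) (filterI hv hve)) (filterI ht hz)).
move=> s [[[E1 Ee] [Ev Eve]] [Et X4]].
rewrite (@prod_square_classes _ _ _ _ _ lfP nrm2 e e1 qe _ (fun a => metaplectic_gamma
   varpi dx (1 - s) (fun x => (chi x)^-1 * hilbert R a x) psi)); last first.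
  move=> a d d0; congr (metaplectic_gamma _ _ _ _ _).
  by apply/funext => x; rewrite hilbert_sql.
rewrite mulr1 in Ev.
rewrite E1 Ee Ev Eve Et q1 qe.
have -> : hilbert R varpi (-1) = (qres nrm (-1))%:~R.
  by rewrite -[varpi]mulr1 (hilbert_varpi_unit lfP nrm2).
have [-> -> -> ->] := Lfactor_zvar lfP chiM s.
have inv2 (a b : R[i]) : (a^-1 * b^-1)^-1 = a * b by rewrite invfM !invrK.
rewrite inv2 !(zeta_valueE lfP) zvar_double /tame_unit_sum /tame_gauss_sum rmorph1.
rewrite [(qres nrm (-1) * 1)%:~R]rmorphM [(qres nrm (-1) * -1)%:~R]rmorphM rmorphN1 rmorph1 /=.
have S0 : (Num.sqrt (nrm varpi))%:C != 0 :> R[i].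
  by rewrite (fmorph_eq0 (real_complex R)) gt_eqF// sqrtr_gt0 (Pi_gt0 lfP).
have g0 := weil_root_neq0 lfP nrm2 psiA psiN.
have G0 : gauss_sum nrm varpi psi 1 != 0 by apply: contraNneq g0 => ->; rewrite mulr0.
have Q_S : q%:R = ((Num.sqrt (nrm varpi))%:C ^+ 2)^-1 :> R[i].
  rewrite -rmorphXn sqr_sqrtr ?(nrm_ge0 nrmP)//; apply: invr_inj; rewrite invrK.
  exact: esym (nrm_varpiC lfP).
have lg := esym (weil_root_sq lfP nrm2 psiA psiN).
have X0 := zvar_neq0 nrm varpi (chi_varpi_neq0 lfP chiM) s.
exact: product_identity S0 G0 X0 X4 Q_S lg.
Qed.
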